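(* Let $\beta\in(0,\infty)$, $p\ge1$, and let $\xi=([0,L],(X_i)_{i\ge1},(P_i)_{i\ge1})$ be random such that $0\le X_i\le L$, $P_i\ge0$, $i\ge1$, $\mathbb E[L^p]<\infty$ and $\mathbb E[\sum_{j\ge1}P_j^{p\beta}]<1$. For $\eta\in\mathcal P_p$ let $\Phi_\beta(\eta)$ be the distribution of $\phi_\beta(\xi,\tau_i,i\ge1)$, where $\tau_i\sim\eta$, $i\ge1$, are i.i.d. and independent of $\xi$. Then the distributional equation $\Phi_\beta(\eta)=\eta$ has a unique attractive fixpoint in $(\mathcal P_p,W_p)$; that is, there is a unique $\eta^*\in\mathcal P_p$ with $\Phi_\beta(\eta^* )=\eta^*$, and $\Phi_\beta^n(\eta)\to\eta^*$ in $(\mathcal P_p,W_p)$ as $n\to\infty$ for all $\eta\in\mathcal P_p$.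
   Context: Trees. An $\mathbb R$-tree is a separable metric space $(T,d)$ in which any two points are joined by a unique injective path (up to reparametrisation), isometric to an interval of length their distance. All trees are rooted. $\mathbb T$ is the set of root-preserving isometry classes of compact rooted $\mathbb R$-trees, with the pointed Gromov-Hausdorff metric $d_{\rm GH}((T,d,\rho),(T',d',\rho'))=\inf\max\{\delta(\varphi(\rho),\varphi'(\rho')),\delta_{\rm H}(\varphi(T),\varphi'(T'))\}$, infimum over isometric embeddings $\varphi,\varphi'$ into a common metric space $(\mathcal M,\delta)$, $\delta_{\rm H}$ being Hausdorff distance. ${\rm ht}(T)=\sup_{x\in T}d(\rho,x)$. $cT$ denotes $T$ with distances multiplied by $c$. Grafting map. For $\ell>0$, $x_i\in[0,\ell]$ (not necessarily distinct), $p_i\ge0$, and compact rooted $\mathbb R$-trees $\tau_i$, $i\ge1$, attach to the interval $[0,\ell]$, for each $i$, the rescaled tree $p_i^\beta\tau_i$ by identifying its root with $x_i$ (disjoint union, path metric, root $0$). If the resulting tree is compact, $\phi_\beta(([0,\ell],(x_i),(p_i)),\tau_i,i\ge1)\in\mathbb T$ is its class; otherwise it is the class of the one-point tree. Wasserstein space. $\mathcal P_p$ is the set of Borel probability measures $\eta$ on $\mathbb T$ with $\mathbb E[{\rm ht}(\tau)^p]<\infty$ for $\tau\sim\eta$; $W_p(\eta,\eta')=(\inf\mathbb E[d_{\rm GH}(\tau,\tau')^p])^{1/p}$, infimum over couplings $\tau\sim\eta$, $\tau'\sim\eta'$. The interval length $L$ is a random variable in $(0,\infty)$. *)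

(* Defs.v *)
From HB Require Import structures.
From mathcomp Require Import all_boot all_order all_algebra finmap.
From mathcomp Require Import all_classical all_reals all_analysis.

Set Implicit Arguments.
Unset Strict Implicit.
Unset Printing Implicit Defensive.

Import Order.TTheory GRing.Theory Num.Theory.
Import numFieldNormedType.Exports.

Local Open Scope classical_set_scope.
Local Open Scope ring_scope.
Local Open Scope quotient_scope.

Section metric_notions.
Context {R : realType}.

Definition isometric (T U : metricType R) (f : T -> U) : Prop :=
  forall x y, mdist (f x) (f y) = mdist x y.

(* The geodesic is written [g : R -> T], only its values on [0, mdist x y]
   matter; likewise an arbitrary path is [h : R -> T] restricted to [0, 1]. *)
Definition is_Rtree (T : metricType R) : Prop :=
  (exists2 D : set T, countable D & dense D) /\
  forall x y : T, exists g : R -> T,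
    [/\ g 0 = x, g (mdist x y) = y,
        {in `[0, mdist x y] &, forall s t, mdist (g s) (g t) = `|s - t|} &
        forall h : R -> T,
          {within `[0, 1], continuous h} -> {in `[0, 1] &, injective h} ->
          h 0 = x -> h 1 = y ->
          exists u : R -> R,
            [/\ {within `[0, 1], continuous u},
                {in `[0, 1] &, {homo u : s t / s < t}},
                u 0 = 0, u 1 = mdist x y &
                {in `[0, 1], forall s, h s = g (u s)}]].

Definition hausdorff_dist (M : metricType R) (A B : set M) : R :=
  Num.max (sup [set inf [set mdist a b | b in B] | a in A])
          (sup [set inf [set mdist b a | a in A] | b in B]).

End metric_notions.

(* The carrier is a bare type together with its metric structure, rather than
   a [metricType]: otherwise the universe of this record would be strictly
   above that of [metricType], and the space of trees built from it could never
   be given a metric structure itself. *)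
Record rooted_metric (R : realType) := RootedMetric {
  rm_sort :> Type;
  rm_class : Metric.axioms_ R rm_sort;
  root : rm_sort }.

HB.instance Definition _ (R : realType) (t : rooted_metric R) :=
  Metric.copy (rm_sort t) (Metric.Pack (rm_class t)).

Record rooted_tree (R : realType) := RootedTree {
  rt_metric :> rooted_metric R;
  rt_compact : compact [set: rt_metric];
  rt_Rtree : is_Rtree (rm_sort rt_metric) }.

HB.instance Definition _ (R : realType) := gen_eqMixin (rooted_tree R).
HB.instance Definition _ (R : realType) := gen_choiceMixin (rooted_tree R).

Section tree_space.
Context {R : realType}.
Implicit Types t : rooted_tree R.

Definition root_isometric t t' : Prop :=
  exists f : t -> t', [/\ isometric f, bijective f & f (root t) = root t'].

Definition root_isometricb t t' : bool := `[< root_isometric t t' >].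

Lemma root_isometric_refl : reflexive root_isometricb.
Proof. by move=> t; apply/asboolP; exists id; split => //; exists id. Qed.

Lemma root_isometric_imp t t' : root_isometric t t' -> root_isometric t' t.
Proof.
move=> [f [fi [g fK gK] fr]]; exists g; split.
- by move=> x y; rewrite -fi !gK.
- by exists f.
- by rewrite -fr fK.
Qed.

Lemma root_isometric_sym : symmetric root_isometricb.
Proof.
by move=> t t'; apply/asboolP/asboolP; exact: root_isometric_imp.
Qed.

Lemma root_isometric_trans : transitive root_isometricb.
Proof.
move=> t2 t1 t3 /asboolP[f [fi fb fr]] /asboolP[g [gi gb gr]].
apply/asboolP; exists (g \o f); split; last by rewrite /= fr gr.
- by move=> x y /=; rewrite gi fi.
- exact: bij_comp.
Qed.

Canonical root_isometric_equiv := EquivRel root_isometricb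
  root_isometric_refl root_isometric_sym root_isometric_trans.

End tree_space.

Definition tree_space (R : realType) := {eq_quot @root_isometric_equiv R}.

HB.instance Definition _ (R : realType) := Choice.on (tree_space R).
HB.instance Definition _ (R : realType) := EqQuotient.on (tree_space R).

Section one_point.
Variable R : realType.

Definition one_point := unit.
HB.instance Definition _ := Choice.on one_point.

Let d0 (x y : one_point) : R := 0.
Let d0_refl x : d0 x x = 0. Proof. by []. Qed.
Let d0_pos x y : d0 x y = 0 -> x = y. Proof. by case: x; case: y. Qed.
Let d0_sym x y : d0 x y = d0 y x. Proof. by []. Qed.
Let d0_tri y x z : d0 x z <= d0 x y + d0 y z.
Proof. by rewrite addr0. Qed.

HB.instance Definition _ :=
  @isMetric.Build R one_point d0 d0_refl d0_pos d0_sym d0_tri.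

Definition one_point_metric : rooted_metric R :=
  @RootedMetric R one_point (Metric.class one_point) tt.

Let one_point_compact : compact [set: one_point_metric].
Proof.
apply: finite_compact; apply: (@sub_finite_set _ _ [set tt]).
  by move=> [].
exact: finite_set1.
Qed.

Let one_point_Rtree : is_Rtree (rm_sort one_point_metric).
Proof.
split.
  exists setT; last by move=> O [x Ox] oO; exists x.
  apply: (@sub_countable _ _ _ [set tt]); last exact: finite_set_countable.
  by apply: subset_card_le => -[].
move=> x y; exists (fun=> tt).
have dxy : mdist x y = 0 by [].
split => //; [by case: x dxy|by case: y dxy| |].
  by move=> s t; rewrite dxy !itv_boundlr !bnd_simp
    => /andP[s0 s1] /andP[t0 t1]; rewrite (_ : s = t) ?subrr ?normr0//;
    apply/eqP; rewrite eq_le (le_trans s1 t0) (le_trans t1 s0).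
move=> h _ hinj; have /eqP : 0 = 1 :> R.
  apply: hinj; rewrite ?in_itv/= ?lexx ?ler01//.
  by case: (h 0); case: (h 1).
by rewrite eq_sym oner_eq0.
Qed.

Definition one_point_tree : rooted_tree R :=
  RootedTree one_point_compact one_point_Rtree.

End one_point.

HB.instance Definition _ (R : realType) := isPointed.Build (tree_space R)
  (\pi_(tree_space R) (one_point_tree R)).

Section borel.
Context {R : realType}.
Implicit Types t : rooted_tree R.

Definition dGH_trees t t' : R :=
  inf [set r : R | exists (M : metricType R) (f : t -> M) (f' : t' -> M),
    [/\ isometric f, isometric f' &
        r = Num.max (mdist (f (root t)) (f' (root t')))
                    (hausdorff_dist (range f) (range f'))]].

Definition dGH (a b : tree_space R) : R := dGH_trees (repr a) (repr b).

Definition height (a : tree_space R) : R :=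
  sup [set mdist (root (repr a)) x | x in [set: repr a]].

Definition GH_open : set_system (tree_space R) :=
  [set U | forall a, U a -> exists2 e : R, 0 < e & forall b, dGH a b < e -> U b].

End borel.

HB.instance Definition _ (R : realType) :=
  Measurable.copy (tree_space R) (g_sigma_algebraType (@GH_open R)).

Section grafting.
Context {R : realType}.
Variables (beta l : R) (x p : nat -> R) (tau : nat -> tree_space R).

Definition graft_union : Type :=
  ({a : R | a \in `[0, l]} + {i : nat & repr (tau i)})%type.

Definition branch_height (u : {i : nat & repr (tau i)}) : R :=
  p (tag u) `^ beta * mdist (root (repr (tau (tag u)))) (tagged u).

(* The path pseudometric on the disjoint union once the roots of the rescaled
   trees are identified with their attachment points. *)
Definition graft_dist (u v : graft_union) : R :=
  match u, v with
  | inl a, inl b => `|val a - val b|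
  | inl a, inr v' => `|val a - x (tag v')| + branch_height v'
  | inr u', inl b => branch_height u' + `|x (tag u') - val b|
  | inr u', inr v' =>
      if tag u' == tag v' then
        p (tag u') `^ beta * mdist (tagged u') (tagged_as u' v')
      else branch_height u' + `|x (tag u') - x (tag v')| + branch_height v'
  end.

(* [t] is the metric quotient of the disjoint union by [graft_dist]. *)
Definition is_graft (t : rooted_tree R) : Prop :=
  exists q : graft_union -> t,
    [/\ forall y, exists u, q u = y,
        forall u v, mdist (q u) (q v) = graft_dist u v &
        forall a, val a = 0 -> q (inl a) = root t].

(* Since [rooted_tree] only contains compact trees, the second case is the one
   where the resulting tree is not compact. *)
Definition graft : tree_space R :=
  if pselect (exists t, is_graft t) is left h
  then \pi_(tree_space R) (projT1 (cid h))
  else \pi_(tree_space R) (one_point_tree R).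

End grafting.

Section wasserstein.
Context {R : realType}.
Local Open Scope ereal_scope.
Implicit Types eta : probability (tree_space R) R.

(* Leibniz equality of measures would also compare their (unspecified) values
   on non-measurable sets. *)
Definition same_law eta eta' : Prop :=
  forall A, measurable A -> eta A = eta' A.

Definition Pp (p : R) : set (probability (tree_space R) R) :=
  [set eta | \int[eta]_a (height a `^ p)%:E < +oo].

Definition coupling eta eta' :
    set (probability (tree_space R * tree_space R)%type R) :=
  [set pi | forall A, measurable A ->
     pi (A `*` setT) = eta A /\ pi (setT `*` A) = eta' A].

Definition Wp (p : R) eta eta' : \bar R :=
  ereal_inf [set \int[pi]_z (dGH z.1 z.2 `^ p)%:E
            | pi in coupling eta eta'] `^ p^-1.

End wasserstein.

Section grafting_operator.
Context {R : realType}.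
Local Open Scope ereal_scope.
Implicit Types eta nu : probability (tree_space R) R.

Definition iid d (S : measurableType d) (Q : probability S R)
    (tau : nat -> {RV Q >-> tree_space R}) eta : Prop :=
  (forall i A, measurable A -> distribution Q (tau i) A = eta A) /\
  forall (J : {fset nat}) (B : nat -> set (tree_space R)),
    (forall i, measurable (B i)) ->
    Q (\bigcap_(i in [set` J]) (tau i @^-1` B i)) =
    \prod_(i <- J) Q (tau i @^-1` B i).

Variables (beta : R) (d : measure_display) (Omega : measurableType d).
Variable P : probability Omega R.
Variables (L : {RV P >-> R}) (X Pm : nat -> {RV P >-> R}).

(* [nu] is the law of the graft of xi = (L, X, Pm) and of an i.i.d. sequence
   [tau] of law [eta]; the independence of xi and [tau] is obtained by placing
   them on the two factors of a product of probability spaces. *)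
Definition graft_law eta nu : Prop :=
  exists (d' : measure_display) (S : measurableType d') (Q : probability S R)
      (tau : nat -> {RV Q >-> tree_space R}),
    let F := fun z : Omega * S =>
      graft beta (L z.1) (fun i => X i z.1) (fun i => Pm i z.1)
            (fun i => tau i z.2) in
    [/\ iid tau eta, measurable_fun setT F &
        forall A, measurable A -> nu A = (P \x Q) (F @^-1` A)].

Definition Phi eta : probability (tree_space R) R :=
  if pselect (exists nu, graft_law eta nu) is left h then projT1 (cid h)
  else dirac point.

End grafting_operator.

(* Main.v *)
(** The grafting map is a contraction for the transport cost
    [inf E(td(tau, tau')^p)], with ratio [E(sum_j P_j^(p beta)) < 1]. Here [td] is
    a distance between rooted trees given by correspondences that distort the
    distances by at most [2 r] and the distances to the root by at most [r]; it
    satisfies [dGH <= td <= 2 dGH], and grafting trees that are pairwise at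
    distance [td] at most [t_i] on the same segment gives trees at distance at
    most [sup_i p_i^beta t_i], hence at most the [l^p] norm of that family. For
    [dGH], whose optimal embeddings separate the roots, this would fail by a
    factor 2. The fixed point is built pathwise: on the infinite tree of
    independent copies of [xi], the trees obtained by [n] recursive graftings
    satisfy [E(td(T_n, T_(n+1))^p) <= c^n M], so they converge almost surely for
    the complete distance [td], and the law of the limit is invariant because the
    subtrees at the children of the root are independent copies of the whole.
    R-trees enter through two facts: a compact rooted metric space is an R-tree
    iff its Gromov product at the root is ultrametric and the root is joined to
    every point by approximate geodesics, which passes to limits and grafts; and
    the graft is compact iff [p_i^beta ht(tau_i) -> 0]. *)

Require Import Defs.
From HB Require Import structures.
From mathcomp Require Import all_boot all_order all_algebra finmap.
From mathcomp Require Import all_classical all_reals all_analysis.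
From mathcomp Require Import measurable_realfun lra.

Set Implicit Arguments.
Unset Strict Implicit.
Unset Printing Implicit Defensive.

Import Order.TTheory GRing.Theory Num.Theory.
Import numFieldNormedType.Exports Defs.

Local Open Scope classical_set_scope.
Local Open Scope ring_scope.
Local Open Scope quotient_scope.

(** * Compact metric spaces and metric quotients *)

(** A Banach fixed-point argument in the Wasserstein space would need completeness of that space.
    Working on one probability space replaces it by completeness of the space of trees, at the price
    of an infinite product of copies of [Omega]; as [Omega] carries no topology, the product measure
    cannot come from compactness and is obtained by choosing coordinates one at a time. Two further
    obstacles shape the text. A graft is defined through arbitrary representatives and falls back on
    the one-point tree when it is not compact, so its measurability is not visible from the formula:
    it is derived from a uniform estimate on pairs of nearby data, first for finitely many branches.
    And the contraction estimate may fail when only one of two grafts is compact, so it holds only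
    almost everywhere, which forces moment bounds on the heights to accompany the bounds on
    distances. Geometric decay in mean becomes pathwise decay with the ratio [(1 + c) / 2]: it lies
    strictly between [c] and 1, so the increments divided by its powers are still summable in mean.
    Equality of laws is read off from transport costs tending to 0, through open sets. *)

Section metric_compactness.
Context {R : realType}.
Implicit Types M : metricType R.

Definition rate (n : nat) : R := n.+1%:R^-1.

Lemma rate_gt0 n : 0 < rate n. Proof. by rewrite invr_gt0. Qed.

Lemma rate_lt (e : R) : 0 < e -> exists N, forall n, (N <= n)%N -> rate n < e.
Proof.
move=> e0; exists (Num.truncn e^-1) => n nN; rewrite invf_plt ?posrE//.
by apply: lt_le_trans (truncnS_gt _) _; rewrite ler_nat ltnS.
Qed.

Lemma within_continuous_metricP M (A : set R) (h : R -> M) :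
  {within A, continuous h} <->
  forall s, A s -> forall e : R, 0 < e ->
    exists2 de : R, 0 < de & forall t, A t -> `|s - t| < de -> mdist (h s) (h t) < e.
Proof.
rewrite subspace_continuousP; split=> H s As.
  move=> e e0; have /metricType_numDomainType.cvgrPdist_lt/(_ e e0) := H s As.
  rewrite near_withinE => /nbhs_ballP[de /= de0 hde].
  by exists de => // t At st; exact: hde.
apply/metricType_numDomainType.cvgrPdist_lt => e e0.
have [de de0 hde] := H s As e e0.
rewrite near_withinE; apply/nbhs_ballP; exists de => //= t st At; exact: hde.
Qed.

Lemma within_continuous_realP (A : set R) (h : R -> R) :
  {within A, continuous h} <->
  forall s, A s -> forall e : R, 0 < e ->
    exists2 de : R, 0 < de & forall t, A t -> `|s - t| < de -> `|h s - h t| < e.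
Proof.
rewrite subspace_continuousP; split=> H s As.
  move=> e e0; have /cvgrPdist_lt/(_ e e0) := H s As.
  rewrite near_withinE => /nbhs_ballP[de /= de0 hde].
  by exists de => // t At st; exact: hde.
apply/cvgrPdist_lt => e e0; have [de de0 hde] := H s As e e0.
rewrite near_withinE; apply/nbhs_ballP; exists de => //= t st At; exact: hde.
Qed.

Lemma compact_clusterP M : compact [set: M] -> forall u : nat -> M,
  exists x, forall (e : R) N, 0 < e -> exists2 n, (N <= n)%N & mdist x (u n) < e.
Proof.
move=> cM u.
have [|x [_ xc]] := cM (u @ \oo) _; first exact: filterT.
exists x => e N e0.
have [] := xc [set z | exists2 n, (N <= n)%N & z = u n] [set y | mdist x y < e].
- by exists N => // n Nn; exists n.
- by apply/metricType_numDomainType.nbhs_mdistP; exists e.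
- by move=> z [[n Nn ->]] /=; exists n.
Qed.

(** Without a finite net one could go on picking points at distance at least [e] from all earlier
    ones, and such a sequence has no cluster point. *)
Lemma compact_net M : compact [set: M] -> forall e : R, 0 < e ->
  exists s : seq M, forall y, exists2 x, x \in s & mdist x y < e.
Proof.
move=> cM e e0; apply: contrapT => H.
have step (s : seq M) : {y | forall x, x \in s -> e <= mdist x y}.
  apply: cid; apply: contrapT => Hs; apply: H; exists s => y.
  apply: contrapT => Hy; apply: Hs; exists y => x xs.
  by rewrite leNgt; apply/negP => xy; apply: Hy; exists x.
pose l := fix l n := if n is m.+1 then sval (step (l m)) :: l m else [::].
pose u n := sval (step (l n)).
have ul m n : (m < n)%N -> u m \in l n.
  elim: n => // n IH; rewrite ltnS leq_eqVlt /= inE => /orP[/eqP ->|/IH ->].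
    by rewrite eqxx.
  by rewrite orbT.
have sep m n : (m < n)%N -> e <= mdist (u m) (u n).
  by move=> mn; exact: (svalP (step (l n))) (ul _ _ mn).
have [x xu] := compact_clusterP cM u.
have e2 : 0 < e / 2 by rewrite divr_gt0.
have [m _ xm] := xu _ 0%N e2; have [n mn xn] := xu _ m.+1 e2.
have := sep _ _ mn; rewrite leNgt => /negP; apply.
by rewrite (le_lt_trans (metric_triangle _ x _))// (metric_sym _ x) [e]splitr ltrD.
Qed.

Lemma compact_bounded M : compact [set: M] ->
  exists B : R, forall x y : M, mdist x y <= B.
Proof.
move=> cM; have [s sP] := compact_net cM ltr01.
have [B BP] : exists B : R, forall x y : M, x \in s -> y \in s -> mdist x y <= B.
  exists (\sum_(x <- s) \sum_(y <- s) mdist x y) => x y xs ys.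
  rewrite (big_rem x xs)/= (big_rem y ys)/= -addrA lerDl.
  by rewrite addr_ge0 ?sumr_ge0// => *; rewrite ?sumr_ge0 ?mdist_ge0// => *;
    rewrite mdist_ge0.
exists (B + 2) => x y.
have [a as_ ax] := sP x; have [b bs by_] := sP y.
have := metric_triangle x a y; have := metric_triangle a b y.
by have := BP _ _ as_ bs; move: ax; rewrite (metric_sym a x); lra.
Qed.

Lemma compact_separable M : compact [set: M] ->
  exists2 D : set M, countable D & dense D.
Proof.
move=> cM; have [s sP] := choice (fun n => compact_net cM (rate_gt0 n)).
exists (\bigcup_n [set` s n]).
  by apply: bigcup_countable => // n _; exact: finite_set_countable.
move=> O [x Ox]; rewrite openE => /(_ x Ox).
rewrite /interior => /metricType_numDomainType.nbhs_mdistP[e /= e0 eO].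
have [n /(_ n (leqnn n)) ne] := rate_lt e0.
have [z zs zx] := sP n x; exists z; split; last by exists n.
by apply: eO => /=; rewrite metric_sym (lt_trans zx).
Qed.

End metric_compactness.

Section pseudometric_quotient.
Context {R : realType}.

Definition pseudodist (X : Type) (d : X -> X -> R) : Prop :=
  [/\ forall x, d x x = 0, forall x y, d x y = d y x &
      forall y x z, d x z <= d x y + d y z].

(** Points are equivalence classes seen as predicates, so that [X] may be any type. Having [hd] as
    an argument of the type lets the metric structure be a canonical instance. *)
Definition mquot (X : Type) (d : X -> X -> R) (hd : pseudodist d) : Type :=
  {A : X -> Prop | exists x, A = (fun y => d x y = 0)}.

Variables (X : Type) (d : X -> X -> R) (hd : pseudodist d).

HB.instance Definition _ := gen_eqMixin (mquot hd).
HB.instance Definition _ := gen_choiceMixin (mquot hd).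

Let rep (a : mquot hd) : X := projT1 (cid (proj2_sig a)).
Let cls (x : X) : mquot hd := exist _ (fun y => d x y = 0) (ex_intro _ x erefl).

Let pd_ge0 x y : 0 <= d x y.
Proof. by case: hd => h0 hs ht; have := ht y x x; rewrite h0 (hs y x); lra. Qed.

Let repK x : d (rep (cls x)) x = 0.
Proof.
rewrite /rep; case: cid => z /= Hz.
by have <- := congr1 (fun A => A x) Hz; case: hd.
Qed.

Let dist (a b : mquot hd) : R := d (rep a) (rep b).

Let dist_cls x y : dist (cls x) (cls y) = d x y.
Proof.
case: hd => h0 hs ht; rewrite /dist.
have := repK x; have := repK y.
move: (rep _) (rep _) => a b ax bY.
have := ht x a b; have := ht y x b; have := ht a x y; have := ht b a y.
by rewrite (hs x a) (hs y b); lra.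
Qed.

Let dist0 a b : dist a b = 0 -> a = b.
Proof.
case: hd => h0 hs ht.
rewrite /dist /rep; case: cid => x /= Hx; case: cid => y /= Hy dxy.
suff: proj1_sig a = proj1_sig b.
  by case: a b Hx Hy => [A hA] [B hB] _ _ /= AB; exact: eq_exist.
rewrite Hx Hy; apply/funext => z; apply/propext.
have := ht y x z; have := ht x y z; have := pd_ge0 x z; have := pd_ge0 y z.
by rewrite (hs y x); split; lra.
Qed.

HB.instance Definition _ := @isMetric.Build R (mquot hd) dist
  (fun x => let: And3 h _ _ := hd in h (rep x)) dist0
  (fun x y => let: And3 _ h _ := hd in h (rep x) (rep y))
  (fun y x z => let: And3 _ _ h := hd in h (rep y) (rep x) (rep z)).

Lemma mquot_proj : exists q : X -> mquot hd,
  (forall m, exists x, q x = m) /\ forall x y, mdist (q x) (q y) = d x y.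
Proof.
exists cls; split; last exact: dist_cls.
by move=> a; exists (rep a); apply: dist0; rewrite /dist; exact: repK.
Qed.

End pseudometric_quotient.

(** * Gromov products and R-trees *)

Section gromov_product.
Context {R : realType}.

(* Twice the usual Gromov product. *)
Definition gromov (X : Type) (d : X -> X -> R) (o x y : X) : R :=
  d o x + d o y - d x y.

(** Zero-hyperbolicity at [o]: the product of [x] and [y] is at least the smaller of the other two.
    The minimum is spelled out as a disjunction, the form that linear arithmetic can split on. *)
Definition ultra (X : Type) (d : X -> X -> R) (o : X) : Prop :=
  forall x y z, gromov d o x z <= gromov d o x y \/ gromov d o z y <= gromov d o x y.

(** Distances to [o] cancel, so the claim compares sums of Gromov products. The smaller of the
    products of [a, b] and [c, e] dominates one product with each of the two other points; if these
    share a point, the larger product dominates a missing partner. *)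
Lemma four_point (X : Type) (d : X -> X -> R) (o : X) :
  pseudodist d -> ultra d o -> forall a b c e,
  d a b + d c e <= d a c + d b e \/ d a b + d c e <= d a e + d b c.
Proof.
move=> [_ ds _] ud a b c e.
move: (ud a b c) (ud a b e) (ud c e a) (ud c e b); rewrite /gromov.
rewrite (ds c a) (ds c b) (ds e b).
by case: (leP (d o a + d o b - d a b) (d o c + d o e - d c e)) => ? [] ? [] ? [] ? [] ?;
  try (left; lra); right; lra.
Qed.

Lemma pseudodist_mdist (M : metricType R) : pseudodist (@mdist R M).
Proof.
split; [exact: mdistxx|exact: metric_sym|]; move=> y x z; exact: metric_triangle.
Qed.

(** * Compact spaces with ultrametric Gromov products are R-trees *)

Section criterion.
Variables (M : metricType R) (o : M).
Local Notation d := (@mdist R M).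
Hypothesis cM : compact [set: M].
Hypothesis ud : ultra d o.
Hypothesis geo : forall (x : M) (t e : R), 0 <= t <= d o x -> 0 < e ->
  exists z, d o z <= t + e /\ d z x <= d o x - t + e.

Let fp := four_point (pseudodist_mdist M) ud.

(** A cluster point of approximate solutions with errors [rate n] is an exact one. *)
Let geo0 x (t : R) : 0 <= t <= d o x -> exists z, d o z = t /\ d z x = d o x - t.
Proof.
move=> t0.
have [u uP] : {u : nat -> M & forall n : nat,
    d o (u n) <= t + rate n /\ d (u n) x <= d o x - t + rate n}.
  by apply: (@choice _ _ (fun n z => d o z <= t + rate n /\
    d z x <= d o x - t + rate n)) => n; apply: geo => //; exact: rate_gt0.
have [z zP] := compact_clusterP cM u.
have H (e : R) : 0 < e -> d o z <= t + e /\ d z x <= d o x - t + e.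
  move=> e0; have e2 : 0 < e / 2 by rewrite divr_gt0.
  have [N nN] := @rate_lt R _ e2; have [n Nn zn] := zP _ N e2.
  have ne := nN n Nn.
  have [un1 un2] := uP n.
  have := metric_triangle o (u n) z; have := metric_triangle z (u n) x.
  by rewrite (metric_sym (u n) z); split; lra.
exists z; have := metric_triangle o z x.
have h1 : d o z <= t by apply/ler_addgt0Pr => e /H[].
have h2 : d z x <= d o x - t by apply/ler_addgt0Pr => e /H[].
by split; lra.
Qed.

Let between x y (s : R) : 0 <= s <= d x y -> exists z, d x z = s /\ d z y = d x y - s.
Proof.
move=> /andP[s0 sD].
(* The condition places the point sought on the side of [x] of the branching point, hence on the
   segment from [o] to [x]; otherwise [x] and [y] are exchanged. *)
wlog H : x y s s0 sD / gromov d o x y <= 2 * (d o x - s).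
  move=> W; have [H|H] := leP (gromov d o x y) (2 * (d o x - s)); first exact: W.
  have [|||z [z1 z2]] := W y x (d x y - s) _ _ _.
  - lra.
  - by rewrite (metric_sym y x); lra.
  - by move: H; rewrite /gromov (metric_sym y x); lra.
  exists z; rewrite (metric_sym x z) z2 (metric_sym z y) z1 (metric_sym y x).
  split => //.
  lra.
have dox : 0 <= d o x - s.
  by move: H; rewrite /gromov; have := metric_triangle x o y;
    rewrite (metric_sym x o); lra.
have [|z [z1 z2]] := @geo0 x (d o x - s); first by rewrite dox; lra.
exists z; have := ud z y x; have := metric_triangle x z y.
rewrite (metric_sym x z); move: H; rewrite /gromov z1 z2 => H.
move=> h1 h2; split; first lra.
by case: h2 => ?; lra.
Qed.

Let d0 x : d x x = 0 := mdistxx x.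
Let ds x y : d x y = d y x := metric_sym x y.
Let dt x y z : d x z <= d x y + d y z := metric_triangle x y z.

Let geodesic x y : exists g : R -> M, [/\ g 0 = x, g (d x y) = y,
  {in `[0, d x y] &, forall s t, d (g s) (g t) = `|s - t|} &
  forall s, s \in `[0, d x y] -> d x (g s) = s /\ d (g s) y = d x y - s].
Proof.
have [g gP] : {g : R -> M & forall s, s \in `[0, d x y] ->
    d x (g s) = s /\ d (g s) y = d x y - s}.
  apply: (@choice _ _ (fun s z => s \in `[0, d x y] ->
    d x z = s /\ d z y = d x y - s)) => s.
  have [sI|sI] := boolP (s \in `[0, d x y]); last by exists x.
  by have [|z zP] := @between x y s; [rewrite in_itv in sI|exists z].
have D0 : 0 <= d x y := mdist_ge0 x y.
exists g; split => //.
- apply/esym/mdist_positivity; have [|] := gP 0; last by [].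
  by rewrite in_itv /= lexx D0.
- apply/mdist_positivity; have [|_ ->] := gP (d x y); last by rewrite subrr.
  by rewrite in_itv /= lexx D0.
(* Both points lie between [x] and [y], so the four-point inequality bounds their distance by that
   of the parameters; triangles through [x] give the converse. *)
- move=> s t sI tI; have [s1 s2] := gP s sI; have [t1 t2] := gP t tI.
  have := fp (g s) (g t) x y; have := dt x (g s) (g t); have := dt x (g t) (g s).
  rewrite (ds (g t) (g s)) (ds (g s) x) (ds (g t) x) s1 s2 t1 t2 => h1 h2 h3.
  apply/eqP; rewrite eq_le; apply/andP; split; last by rewrite ler_norml; lra.
  by rewrite ler_normr; case: h3 => ?; apply/orP; [left|right]; lra.
Qed.
Let last_zero (f : R -> R) (s0 : R) :
  (forall s, 0 <= s <= 1 -> forall e : R, 0 < e ->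
    exists2 de : R, 0 < de & forall t, 0 <= t <= 1 -> `|s - t| < de -> `|f s - f t| < e) ->
  0 <= s0 <= 1 -> f 0 = 0 ->
  exists2 a, 0 <= a <= s0 & f a = 0 /\ forall s, a < s -> s <= s0 -> f s <> 0.
Proof.
move=> fc s01 f0; have [s00 s01'] := andP s01.
pose Z := [set s | 0 <= s <= s0 /\ f s = 0].
have Z0 : Z 0 by split => //; rewrite lexx.
have supZ : has_sup Z by split; [exists 0|exists s0 => s [/andP[]]].
have a0 : 0 <= sup Z by apply: ub_le_sup => //; case: supZ.
have as0 : sup Z <= s0 by apply: ge_sup; [exists 0|move=> s [/andP[]]].
exists (sup Z); first by rewrite a0.
split; last first.
  move=> s als ss0 fs; have s0_ := le_trans a0 (ltW als).
  move: als; rewrite ltNge => /negP; apply.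
  apply: ub_le_sup; first by case: supZ.
  by split => //; rewrite s0_.
apply: contrapT => /eqP fa.
have [||de de0 H] := fc (sup Z) _ `|f (sup Z)|.
- by rewrite a0 (le_trans as0).
- by rewrite normr_gt0.
have [t Zt ta] := sup_adherent de0 supZ.
have [/andP[t0 t1] ft] := Zt.
have tS : t <= sup Z by apply: ub_le_sup => //; case: supZ.
have : `|f (sup Z) - f t| < `|f (sup Z)|.
  apply: H; first by rewrite t0 (le_trans t1).
  by rewrite ger0_norm ?subr_ge0//; lra.
by rewrite ft subr0 ltxx.
Qed.

(** Below, [u s] is the projection of [h s] to the geodesic and [e s] its distance to it. If [h]
    left the geodesic, consider the maximal interval around that time on which [e] is positive:
    there the projection is locally constant, hence constant, so [h] returns where it left, against
    injectivity. *)
Let arc x y (g : R -> M) (h : R -> M) :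
  (forall s, s \in `[0, d x y] -> d x (g s) = s /\ d (g s) y = d x y - s) ->
  {within `[0, 1], continuous h} -> {in `[0, 1] &, injective h} ->
  h 0 = x -> h 1 = y ->
  exists u : R -> R,
    [/\ {within `[0, 1], continuous u},
        {in `[0, 1] &, {homo u : s t / s < t}},
        u 0 = 0, u 1 = d x y &
        {in `[0, 1], forall s, h s = g (u s)}].
Proof.
move=> gP /within_continuous_metricP hc hinj h0 h1.
pose u s := (d x y + d x (h s) - d y (h s)) / 2.
pose e s := (d x (h s) + d y (h s) - d x y) / 2.
have us s : u s \in `[0, d x y].
  rewrite in_itv /= /u; have := dt x y (h s); have := dt y x (h s).
  by rewrite (ds y x); lra.
have ex s : d x (h s) = u s + e s by rewrite /u /e; lra.
have ey s : d y (h s) = d x y - u s + e s by rewrite /u /e; lra.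
have e_ge0 s : 0 <= e s.
  by rewrite /e; have := dt x (h s) y; rewrite (ds (h s) y); lra.
have eg s : e s = 0 -> h s = g (u s).
  move=> es0; apply: mdist_positivity; apply/eqP; rewrite eq_le mdist_ge0 andbT.
  have [g1 g2] := gP _ (us s); have := fp (h s) (g (u s)) x y.
  rewrite (ds (h s) x) (ds (h s) y) (ds (g _) x) g1 g2 ex ey es0.
  by case=> ?; lra.
have cu s : 0 <= s <= 1 -> forall e1 : R, 0 < e1 ->
    exists2 de : R, 0 < de & forall t, 0 <= t <= 1 -> `|s - t| < de ->
    `|u s - u t| < e1 /\ `|e s - e t| < e1.
  move=> s01 e1 e10; have [||de de0 H] := hc s _ e1 => //.
  exists de => // t t01 st; have {}H := H t t01 st.
  have := dt x (h s) (h t); have := dt x (h t) (h s).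
  have := dt y (h s) (h t); have := dt y (h t) (h s).
  rewrite (ds (h t) (h s)) !ltr_norml /u /e.
  by move=> ? ? ? ?; split; apply/andP; split; lra.
(* A jump shorter than the two distances to the geodesic cannot change the projection, since passing
   from one projection to another requires coming back to the geodesic. *)
have uloc s t : 0 <= s <= 1 -> 0 <= t <= 1 -> d (h s) (h t) < e s + e t -> u s = u t.
  move=> s01 t01 st; have := fp x (h s) y (h t); have := fp x (h t) y (h s).
  rewrite (ds (h t) y) (ds (h s) y) (ds (h t) (h s)) !ex !ey => h2 h3.
  by case: h2 => ?; case: h3 => ?; lra.
have e0 s : 0 <= s <= 1 -> e s = 0.
  move=> s01; apply: contrapT => /eqP es.
  have es_gt0 : 0 < e s by rewrite lt_neqAle eq_sym es e_ge0.
  have e00 : e 0 = 0 by rewrite /e h0 d0 (ds y x); lra.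
  have e10 : e 1 = 0 by rewrite /e h1 d0; lra.
  have [||a /andP[a0 as_] [ea aP]] := @last_zero e s _ s01.
  - move=> v v01 e1 e1_gt0; have [de de0 H] := cu v v01 e1 e1_gt0.
    by exists de => // t t01 vt; case: (H t t01 vt).
  - by [].
  (* Reversing time turns the last zero into the first zero of [e] after [s], located at [1 - b]. *)
  have [|||b /andP[b0 bs] [eb bP]] := @last_zero (fun v => e (1 - v)) (1 - s).
  - move=> v v01 e1 e1_gt0.
    have [|de de0 H] := cu (1 - v) _ e1 e1_gt0; first by lra.
    exists de => // t t01 vt; have [||_ //] := H (1 - t); first by lra.
    by rewrite -normrN; move: vt; congr (`|_| < _); lra.
  - by lra.
  - by rewrite subr0.
  have aneb : a < 1 - b.
    rewrite lt_neqAle; apply/andP; split; last lra.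
    by apply/eqP => ab; have /eqP := es; apply; rewrite -(_ : a = s)//; lra.
  have eab t : a < t -> t < 1 - b -> 0 < e t.
    move=> at_ tb; rewrite lt_neqAle e_ge0 andbT eq_sym; apply/eqP.
    have [ts|st] := leP t s; first exact: aP.
    have := bP (1 - t); rewrite (_ : 1 - (1 - t) = t); last lra.
    by apply; lra.
  have uab : u a = u (1 - b).
    have [||c _ /eqP] := @MVT_segment R u (fun=> 0) a (1 - b) (ltW aneb).
    - move=> t; rewrite in_itv /= => /andP[at_ tb].
      have t01 : 0 <= t <= 1 by lra.
      have [de de0 H] := hc t t01 (e t) (eab t at_ tb).
      apply: (@near_eq_is_derive _ _ _ (cst (u t))) => //.
      near=> v; rewrite /cst /=.
      have v01 : 0 <= v <= 1.
        have : a < v by near: v; exact: lt_nbhsr.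
        have : v < 1 - b by near: v; exact: lt_nbhsl.
        by lra.
      apply: uloc => //; have : d (h t) (h v) < e t.
        by apply: H => //; near: v; exact: nbhs_ball.
      by move=> hv; apply: (lt_le_trans hv); rewrite lerDl e_ge0.
    - apply/within_continuous_realP => v; rewrite /= in_itv /= => vab e1 e1_gt0.
      have [|de de0 H] := cu v _ e1 e1_gt0; first by lra.
      exists de => // t; rewrite in_itv /= => tab vt.
      by have [||//] := H t; lra.
    by rewrite mul0r subr_eq0 eq_sym => /eqP.
  have := hinj a (1 - b); rewrite !in_itv /= => Hab.
  have /eqP : a = 1 - b.
    by apply: Hab; [lra|lra|rewrite (eg _ ea) (eg _ eb) uab].
  by rewrite lt_eqF.
have hE : {in `[0, 1], forall s, h s = g (u s)}.
  by move=> s; rewrite in_itv /= => s01; apply: eg; exact: e0.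
have uc : {within `[0, 1], continuous u}.
  apply/within_continuous_realP => v; rewrite /= in_itv /= => v01 e1 e1_gt0.
  have [de de0 H] := cu v v01 e1 e1_gt0.
  exists de => // t; rewrite in_itv /= => t01 vt.
  by have [] := H t t01 vt.
have u0 : u 0 = 0 by rewrite /u h0 d0 (ds y x); lra.
have u1 : u 1 = d x y by rewrite /u h1 d0; lra.
have uinj : {in `[0, 1] &, injective u}.
  by move=> s t s01 t01 ust; apply: hinj => //; rewrite !hE// ust.
exists u; split => //.
have u01 : u 0 <= u 1 by rewrite u0 u1 mdist_ge0.
have umono := segment_continuous_inj_le u01 uc uinj.
by move=> s t s01 t01 st; rewrite (leW_mono_in umono).
Unshelve. all: by end_near. Qed.

Lemma Rtree_criterion : is_Rtree M.
Proof.
split; first exact: compact_separable.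
move=> x y; have [g [g0 gD giso gP]] := geodesic x y.
by exists g; split => // h hc hi h0 h1; exact: arc.
Qed.

End criterion.

(** * Branching of geodesics in an R-tree *)

Section converse.
Variables (M : metricType R).
Local Notation d := (@mdist R M).
Hypothesis tM : is_Rtree M.

Let d0 x : d x x = 0 := mdistxx x.
Let ds x y : d x y = d y x := metric_sym x y.
Let dt x y z : d x z <= d x y + d y z := metric_triangle x y z.

Let geod (x y : M) (g : R -> M) := [/\ g 0 = x, g (d x y) = y &
  {in `[0, d x y] &, forall s t, d (g s) (g t) = `|s - t|}].

Let arcs (x y : M) (g : R -> M) := forall h : R -> M,
  {within `[0, 1], continuous h} -> {in `[0, 1] &, injective h} ->
  h 0 = x -> h 1 = y ->
  exists u : R -> R,
    [/\ {within `[0, 1], continuous u},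
        {in `[0, 1] &, {homo u : s t / s < t}},
        u 0 = 0, u 1 = d x y &
        {in `[0, 1], forall s, h s = g (u s)}].

Let GP x : {g : M -> R -> M | forall y, geod x y (g y) /\ arcs x y (g y)}.
Proof.
apply: cid; suff [g gP] : {g : M -> R -> M & forall y, geod x y (g y) /\ arcs x y (g y)}.
  by exists g.
by apply: (@choice _ _ (fun y g => geod x y g /\ arcs x y g)) => y;
  have [_ /(_ x y) [g [g0 gD giso ga]]] := tM; exists g.
Qed.

Let G x y := sval (GP x) y.

Let Ggeod x y : geod x y (G x y). Proof. by have [] := svalP (GP x) y. Qed.
Let Garcs x y : arcs x y (G x y). Proof. by have [] := svalP (GP x) y. Qed.

Let G0 x y : G x y 0 = x. Proof. by case: (Ggeod x y). Qed.

Let Gd x y s : 0 <= s <= d x y -> d x (G x y s) = s.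
Proof.
have [g0 _ gi] := Ggeod x y => /andP[s0 sD].
rewrite -{1}g0 gi ?in_itv/= ?lexx ?mdist_ge0 ?s0//.
by rewrite sub0r normrN ger0_norm.
Qed.

(* A Lipschitz injective path through [c] certifies that [c] lies between its
   endpoints. *)
Let through x y (D1 D : R) (k : R -> M) : 0 <= D1 <= D -> 0 < D ->
  (forall s t, 0 <= s <= D -> 0 <= t <= D -> d (k s) (k t) <= `|s - t|) ->
  (forall s t, 0 <= s <= D -> 0 <= t <= D -> k s = k t -> s = t) ->
  k 0 = x -> k D = y ->
  exists u : R -> R, forall s, 0 <= s <= D ->
    [/\ 0 <= u s <= d x y & k s = G x y (u s)].
Proof.
move=> D1D D0 klip kinj k0 kD.
have Dn0 : D != 0 by rewrite gt_eqF.
have DI s : 0 <= s <= 1 -> 0 <= D * s <= D.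
  by move=> /andP[s0 s1]; have := ltW D0; move=> ?; rewrite mulr_ge0//= ler_piMr.
have [||||u [_ um u0 u1 uE]] := @Garcs x y (fun r => k (D * r)).
- apply/within_continuous_metricP => s; rewrite /= in_itv /= => s01 e e0.
  exists (e / D); first by rewrite divr_gt0.
  move=> t; rewrite in_itv /= => t01; rewrite ltr_pdivlMr// => st.
  apply: le_lt_trans (klip _ _ _ _) _; rewrite ?DI//.
  by rewrite -mulrBr normrM gtr0_norm// mulrC.
- move=> s t; rewrite !in_itv /= => s01 t01 /kinj; rewrite !DI//.
  by move=> /(_ isT isT)/(mulfI Dn0).
- by rewrite mulr0.
- by rewrite mulr1.
exists (fun s => u (s / D)) => s /andP[s0 sD].
have sD0 : 0 <= s / D by rewrite divr_ge0// ltW.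
have sD1 : s / D <= 1 by rewrite ler_pdivrMr// mul1r.
have uw : {in `[0, 1] &, {homo u : a b / a <= b}}.
  move=> a b ai bi; rewrite le_eqVlt => /orP[/eqP ->//|ab].
  by apply: ltW; exact: um.
split; last by rewrite -uE ?in_itv/= ?sD0// mulrC divfK.
by rewrite -{1}u0 -u1; apply/andP; split; apply: uw; rewrite ?in_itv/= ?lexx ?ler01// sD0.
Qed.

(** A geodesic is an injective path, so its points lie on [G x y]; the distance to [x] then fixes
    the parameter. *)
Let geod_uniq x y (g : R -> M) : geod x y g ->
  forall s, 0 <= s <= d x y -> g s = G x y s.
Proof.
move=> [g0 gD gi] s s0D.
have [xy0|D0] := leP (d x y) 0.
  have -> : s = 0 by lra.
  by rewrite g0 G0.
have [|||u uP] := @through x y 0 (d x y) g _ D0 _ _ g0 gD.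
- by rewrite lexx ltW.
- by move=> a b aD bD; rewrite gi ?in_itv.
- move=> a b aD bD gab; have := gi a b; rewrite !in_itv /= gab d0 => /(_ aD bD).
  by move/esym/eqP; rewrite normr_eq0 subr_eq0 => /eqP.
have [us gs] := uP s s0D; rewrite gs; congr (G x y _).
rewrite -(Gd us) -gs -{1}g0 gi ?in_itv/= ?lexx ?mdist_ge0//.
by rewrite sub0r normrN ger0_norm//; case/andP: s0D.
Qed.

Let Gsub w x t s : 0 <= t <= d w x -> 0 <= s <= t -> G w x s = G w (G w x t) s.
Proof.
move=> tD st; have [g0 gD gi] := Ggeod w x.
apply: geod_uniq; last by rewrite Gd.
split; [exact: G0|by rewrite Gd|].
move=> a b; rewrite Gd// !in_itv /= => ai bi.
by rewrite gi// in_itv /=; lra.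
Qed.

(** [m] is the height where the geodesics from [w] to [x] and to [y] part. Joining the pieces beyond
    that point gives an injective path from [x] to [y], which must run along the geodesic; the
    parting point is then between [x] and [y], and this identifies [2 * m] with [gromov]. *)
Let branch w x y : exists m, [/\ 0 <= m <= d w x, m <= d w y,
  2 * m = gromov d w x y,
  (forall t, 0 <= t <= m -> G w x t = G w y t) &
  (forall t, 0 <= t -> t <= d w x -> t <= d w y -> G w x t = G w y t -> t <= m)].
Proof.
pose Z := [set t | [/\ 0 <= t, t <= d w x, t <= d w y & G w x t = G w y t]].
have Z0 : Z 0 by split; rewrite ?mdist_ge0// !G0.
have supZ : has_sup Z by split; [exists 0|exists (d w x) => t []].
have Zub t : Z t -> t <= sup Z by move=> Zt; apply: ub_le_sup => //; case: supZ.
have m0 := Zub 0 Z0.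
have mx : sup Z <= d w x by apply: ge_sup; [exists 0|move=> t []].
have my : sup Z <= d w y by apply: ge_sup; [exists 0|move=> t []].
have [gx0 gxD gxi] := Ggeod w x; have [gy0 gyD gyi] := Ggeod w y.
have mE : G w x (sup Z) = G w y (sup Z).
  apply: mdist_positivity; apply/eqP; rewrite eq_le mdist_ge0 andbT.
  apply/ler_addgt0Pl => e e0; have e2 : 0 < e / 2 by rewrite divr_gt0.
  have [t Zt ta] := sup_adherent e2 supZ; have tS := Zub t Zt.
  have [t0 tx ty tE] := Zt.
  have := dt (G w x (sup Z)) (G w x t) (G w y (sup Z)).
  rewrite {2}tE gxi ?in_itv/= ?m0 ?t0// gyi ?in_itv/= ?m0 ?t0//.
  by rewrite ger0_norm ?subr_ge0// distrC ger0_norm ?subr_ge0//; lra.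
have down t : 0 <= t <= sup Z -> G w x t = G w y t.
  move=> tm; rewrite (@Gsub w x (sup Z)) ?m0// (@Gsub w y (sup Z)) ?m0//.
  by rewrite mE.
exists (sup Z); split; rewrite ?m0 //; last by move=> t t0 tx ty tE; apply: Zub.
pose c := G w x (sup Z).
have xc : d x c = d w x - sup Z.
  rewrite -{1}gxD gxi ?in_itv/= ?mdist_ge0 ?lexx ?m0//.
  by rewrite ger0_norm// subr_ge0.
have yc : d y c = d w y - sup Z.
  rewrite -{1}gyD /c mE gyi ?in_itv/= ?mdist_ge0 ?lexx ?m0//.
  by rewrite ger0_norm// subr_ge0.
suff : d x c + d c y <= d x y.
  by rewrite /gromov (ds c y); have := dt x c y; rewrite (ds c y) xc yc; lra.
have [xm|xm] := leP (d w x) (sup Z).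
  by have -> : x = c; [apply: mdist_positivity; lra|rewrite d0; lra].
have [ym|ym] := leP (d w y) (sup Z).
  by rewrite (_ : y = c) ?d0; [lra|apply: mdist_positivity; lra].
pose D1 := d w x - sup Z; pose D := D1 + (d w y - sup Z).
have D10 : 0 < D1 by rewrite subr_gt0.
have D1D : D1 < D by rewrite ltrDl subr_gt0.
(* From [x] down to the parting point [c], reached at time [D1], then up to [y]. *)
pose k s := if s <= D1 then G w x (d w x - s) else G w y (sup Z + (s - D1)).
have kx s : 0 <= s -> s <= D1 -> [/\ k s = G w x (d w x - s) & 0 <= d w x - s <= d w x].
  by move=> s0 s1; rewrite /k s1; split => //; move: s1; rewrite /D1; lra.
have ky s : D1 <= s -> s <= D ->
    k s = G w y (sup Z + (s - D1)) /\ 0 <= sup Z + (s - D1) <= d w y.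
  move=> s1 sD; split; last by move: sD; rewrite /D; lra.
  rewrite /k; case: (leP s D1) => // s1'.
  have -> : s = D1 by lra.
  by rewrite subrr addr0 -mE /D1; congr (G w x _); lra.
have klip s t : 0 <= s <= D -> 0 <= t <= D -> d (k s) (k t) <= `|s - t|.
  wlog st : s t / s <= t.
    move=> W sD tD; have [st|st] := leP s t; first exact: W.
    by rewrite ds distrC W// ltW.
  move=> /andP[s0 sD] /andP[t0 tD]; rewrite distrC ger0_norm ?subr_ge0//.
  have [t1|t1] := leP t D1.
    have [-> sI] := kx s s0 (le_trans st t1); have [-> tI] := kx t t0 t1.
    by rewrite gxi ?in_itv// ger0_norm; lra.
  have [s1|s1] := leP D1 s.
    have [-> sI] := ky s s1 sD; have [-> tI] := ky t (ltW t1) tD.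
    by rewrite gyi ?in_itv// distrC ger0_norm; lra.
  have [-> sI] := kx s s0 (ltW s1); have [-> tI] := ky t (ltW t1) tD.
  have e1 : d (G w x (d w x - s)) c = D1 - s.
    rewrite gxi ?in_itv/= ?m0// ger0_norm; first by rewrite /D1; lra.
    by move: s1; rewrite /D1; lra.
  have e2 : d c (G w y (sup Z + (t - D1))) = t - D1.
    by rewrite /c mE gyi ?in_itv/= ?m0// distrC ger0_norm; lra.
  by apply: le_trans (dt _ c _) _; rewrite e1 e2; lra.
have kinj s t : 0 <= s <= D -> 0 <= t <= D -> k s = k t -> s = t.
  wlog st : s t / s <= t.
    move=> W sD tD kst; have [st|st] := leP s t; first exact: W.
    by apply/esym; apply: W => //; exact: ltW.
  move=> /andP[s0 sD] /andP[t0 tD].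
  have [t1|t1] := leP t D1.
    have [-> sI] := kx s s0 (le_trans st t1); have [-> tI] := kx t t0 t1.
    by move=> /(congr1 (d w)); rewrite !Gd//; lra.
  have [s1|s1] := leP D1 s.
    have [-> sI] := ky s s1 sD; have [-> tI] := ky t (ltW t1) tD.
    by move=> /(congr1 (d w)); rewrite !Gd//; lra.
  have [-> sI] := kx s s0 (ltW s1); have [-> tI] := ky t (ltW t1) tD.
  move=> E; have /= := congr1 (d w) E; rewrite !Gd// => E'.
  (* A meeting of the two pieces would be a common point of the two geodesics above the supremum of
     such heights. *)
  have : sup Z + (t - D1) <= sup Z.
    apply: Zub; split; [lra|by rewrite -E'; lra|lra|].
    by rewrite -[in LHS]E' E.
  by lra.
have [||||u uP] := @through x y D1 D k _ _ klip kinj.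
- by rewrite !ltW.
- exact: lt_trans D1D.
- by have [-> _] := kx 0 (lexx _) (ltW D10); rewrite subr0.
- have [-> _] := ky D (ltW D1D) (lexx _); rewrite /D -[RHS]gyD; congr (G w y _).
  lra.
have [|uI kE] := uP D1; first by rewrite !ltW.
have kc : k D1 = c.
  have [-> _] := kx D1 (ltW D10) (lexx _); rewrite /c /D1; congr (G w x _).
  lra.
have [_ hD hi] := Ggeod x y; rewrite -kc kE Gd//.
have -> : d (G x y (u D1)) y = `|u D1 - d x y|.
  by rewrite -{2}hD hi ?in_itv/= ?mdist_ge0 ?lexx.
by rewrite distrC ger0_norm; lra.
Qed.

(** Up to the lower of the two branching heights with [z], the geodesics to [x], [z] and [y] all
    agree, so those to [x] and [y] part no earlier. *)
Lemma Rtree_ultra w : ultra d w.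
Proof.
move=> x y z.
have [m1 [/andP[m10 m1x] m1z E1 P1 _]] := branch w x z.
have [m2 [/andP[m20 m2z] m2y E2 P2 _]] := branch w z y.
have [m [/andP[m0 mx] my E _ P]] := branch w x y.
rewrite -E1 -E2 -E !ler_pM2l//.
have [m12|m21] := leP m1 m2; [left|right]; apply: P => //.
- exact: le_trans m2y.
- by rewrite P1 ?m10 ?lexx// P2 ?m10.
- by rewrite (le_trans (ltW m21)).
- by rewrite P1 ?m20 ?ltW// P2 ?m20 ?lexx.
Qed.

Lemma Rtree_geodesic w x t : 0 <= t <= d w x ->
  exists z, d w z = t /\ d z x = d w x - t.
Proof.
move=> tD; exists (G w x t); split; first exact: Gd.
have [_ gD gi] := Ggeod w x; case/andP: tD => t0 tD.
rewrite -{2}gD gi ?in_itv/= ?t0 ?mdist_ge0 ?lexx//.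
by rewrite distrC ger0_norm// subr_ge0.
Qed.

End converse.

End gromov_product.

(** * Correspondences between rooted trees *)

Section correspondences.
Context {R : realType}.

(* A correspondence of distortion [2 * r] that moves distances to the root by at
   most [r]: it glues the two spaces at Hausdorff distance [r] with their roots
   identified. Unlike [dGH], whose optimal gluings separate the roots, the
   induced distance is contracted by grafting without losing a factor two. *)
Definition corr (X Y : Type) (dX : X -> X -> R) (dY : Y -> Y -> R)
    (oX : X) (oY : Y) (r : R) : Prop :=
  exists C : X -> Y -> Prop,
    [/\ forall x, exists y, C x y, forall y, exists x, C x y, C oX oY,
        forall x y x' y', C x y -> C x' y' -> `|dX x x' - dY y y'| <= 2 * r &
        forall x y, C x y -> `|dX oX x - dY oY y| <= r].

Implicit Types X Y Z : Type.

Lemma corr_ge0 X Y (dX : X -> X -> R) (dY : Y -> Y -> R) oX oY r :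
  corr dX dY oX oY r -> 0 <= r.
Proof. by move=> [C [_ _ C0 _ /(_ _ _ C0)]]; apply: le_trans. Qed.

Lemma corr_sym X Y (dX : X -> X -> R) (dY : Y -> Y -> R) oX oY r :
  corr dX dY oX oY r -> corr dY dX oY oX r.
Proof.
move=> [C [C1 C2 C0 Cd Ch]]; exists (fun y x => C x y); split => //.
- by move=> x y x' y' ? ?; rewrite distrC; exact: Cd.
- by move=> x y ?; rewrite distrC; exact: Ch.
Qed.

Lemma corr_trans X Y Z (dX : X -> X -> R) (dY : Y -> Y -> R) (dZ : Z -> Z -> R)
    oX oY oZ r s :
  corr dX dY oX oY r -> corr dY dZ oY oZ s -> corr dX dZ oX oZ (r + s).
Proof.
move=> [C [C1 C2 C0 Cd Ch]] [D [D1 D2 D0 Dd Dh]].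
exists (fun x z => exists2 y, C x y & D y z); split.
- by move=> x; have [y Cy] := C1 x; have [z Dz] := D1 y; exists z, y.
- by move=> z; have [y Dy] := D2 z; have [x Cx] := C2 y; exists x, y.
- by exists oY.
- move=> x z x' z' [y xy yz] [y' xy' yz'].
  have -> : dX x x' - dZ z z' = (dX x x' - dY y y') + (dY y y' - dZ z z') by lra.
  apply: le_trans (ler_normD _ _) _; have := Cd _ _ _ _ xy xy'.
  by have := Dd _ _ _ _ yz yz'; lra.
- move=> x z [y xy yz].
  have -> : dX oX x - dZ oZ z = (dX oX x - dY oY y) + (dY oY y - dZ oZ z) by lra.
  by apply: le_trans (ler_normD _ _) _; exact: lerD (Ch _ _ xy) (Dh _ _ yz).
Qed.

Lemma corr_le X Y (dX : X -> X -> R) (dY : Y -> Y -> R) oX oY r s :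
  r <= s -> corr dX dY oX oY r -> corr dX dY oX oY s.
Proof.
move=> rs [C [C1 C2 C0 Cd Ch]]; exists C; split => //.
- by move=> x y x' y' xy xy'; have := Cd _ _ _ _ xy xy'; lra.
- by move=> x y xy; exact: le_trans (Ch _ _ xy) rs.
Qed.

Lemma corr_surj X Y (dX : X -> X -> R) (dY : Y -> Y -> R) oX oY (q : X -> Y) :
  (forall y, exists x, q x = y) -> (forall x x', dY (q x) (q x') = dX x x') ->
  q oX = oY -> corr dX dY oX oY 0.
Proof.
move=> qs qd qo; exists (fun x y => q x = y); split => //.
- by move=> x; exists (q x).
- by move=> x y x' y' <- <-; rewrite qd subrr normr0 mulr0.
- by move=> x y <-; rewrite -qo qd subrr normr0.
Qed.

Lemma corr_refl X (dX : X -> X -> R) oX : corr dX dX oX oX 0.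
Proof. by apply: (corr_surj (q := id)) => // y; exists y. Qed.

Lemma pseudodist_ge0 X (d : X -> X -> R) : pseudodist d -> forall x y, 0 <= d x y.
Proof. by move=> [d0 ds dt] x y; have := dt y x x; rewrite d0 (ds y x); lra. Qed.

Lemma pseudodist_scale X (d : X -> X -> R) (a : R) : 0 <= a ->
  pseudodist d -> pseudodist (fun x y => a * d x y).
Proof.
move=> a0 [d0 ds dt]; split; first by move=> x; rewrite d0 mulr0.
  by move=> x y; rewrite ds.
by move=> y x z; rewrite -mulrDr ler_wpM2l.
Qed.

Lemma corr_bound X Y (dX : X -> X -> R) (dY : Y -> Y -> R) oX oY r :
  pseudodist dX -> pseudodist dY ->
  (forall x, dX oX x <= r) -> (forall y, dY oY y <= r) -> corr dX dY oX oY r.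
Proof.
move=> pX pY hX hY; have X0 := pseudodist_ge0 pX; have Y0 := pseudodist_ge0 pY.
exists (fun _ _ => True); split => //.
- move=> x y x' y' _ _; rewrite ler_norml.
  case: pX => _ sX tX; case: pY => _ sY tY.
  have := tX oX x x'; have := tY oY y y'; rewrite (sX x oX) (sY y oY).
  have := hX x; have := hX x'; have := hY y; have := hY y'.
  by have := X0 x x'; have := Y0 y y'; lra.
- by move=> x y _; have := hX x; have := hY y; have := X0 oX x; have := Y0 oY y;
    rewrite ler_norml; lra.
Qed.

(** * Gluing two spaces along a correspondence *)

Section gluing.
Variables (X Y : Type) (dX : X -> X -> R) (dY : Y -> Y -> R).
Variables (pX : pseudodist dX) (pY : pseudodist dY) (r : R) (r0 : 0 <= r).
Variables (C : X -> Y -> Prop) (x0 : X) (y0 : Y) (C0 : C x0 y0).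
Hypothesis Cd : forall x y x' y', C x y -> C x' y' ->
  `|dX x x' - dY y y'| <= 2 * r.

(** Shortest passage through a related pair, at cost [r]. Two passages cost [2 * r], which absorbs a
    distortion of [2 * r] in the triangle inequality. Since [r] may be 0, the glued distance is only
    a pseudometric, to be quotiented. *)
Let cross x y := inf [set v : R | exists a b, C a b /\ v = dX x a + r + dY b y].

Let crossP x y : has_inf [set v : R | exists a b, C a b /\ v = dX x a + r + dY b y].
Proof.
split; first by exists (dX x x0 + r + dY y0 y), x0, y0.
exists 0 => v [a [b [_ ->]]].
by have := r0; have := pseudodist_ge0 pX x a; have := pseudodist_ge0 pY b y; lra.
Qed.

Let cross_le x y a b : C a b -> cross x y <= dX x a + r + dY b y.
Proof.
move=> Cab; apply: ge_inf; first by case: (crossP x y).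
by exists a, b.
Qed.

Let le_cross x y (v : R) : (forall a b, C a b -> v <= dX x a + r + dY b y) ->
  v <= cross x y.
Proof.
move=> H; apply: lb_le_inf; first by case: (crossP x y).
by move=> w [a [b [Cab ->]]]; exact: H.
Qed.

Let dist (u v : X + Y) : R :=
  match u, v with
  | inl x, inl x' => dX x x'
  | inr y, inr y' => dY y y'
  | inl x, inr y => cross x y
  | inr y, inl x => cross x y
  end.

Let dist_pseudo : pseudodist dist.
Proof.
have [X0 sX tX] := pX; have [Y0 sY tY] := pY.
have h1 x x' y : cross x y <= dX x x' + cross x' y.
  rewrite -lerBlDl; apply: le_cross => a b /(@cross_le x y).
  by have := tX x' x a; lra.
have h2 x y y' : cross x y <= cross x y' + dY y' y.
  rewrite -lerBlDr; apply: le_cross => a b /(@cross_le x y).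
  by have := tY y' b y; lra.
have h3 x x' y : dX x x' <= cross x y + cross x' y.
  rewrite -lerBlDr; apply: le_cross => a b Cab; rewrite lerBlDr -lerBlDl.
  apply: le_cross => a' b' Cab'; have := Cd Cab Cab'; rewrite ler_norml => /andP[_ H].
  have := tX a x x'; have := tX a' a x'; have := tY y b b'.
  by rewrite (sX x' a') (sY b' y); lra.
have h4 x y y' : dY y y' <= cross x y + cross x y'.
  rewrite -lerBlDr; apply: le_cross => a b Cab; rewrite lerBlDr -lerBlDl.
  apply: le_cross => a' b' Cab'; have := Cd Cab Cab'; rewrite ler_norml => /andP[H _].
  have := tY b y y'; have := tY b' b y'; have := tX x a a'.
  by rewrite (sX a x) (sY y b); lra.
split.
- by move=> [x|y] /=.
- by move=> [x|y] [x'|y'] /=.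
- move=> [m|m] [x|y] [z|w] /=.
  + exact: tX.
  + exact: h1.
  + by rewrite addrC (sX m z); exact: h1.
  + exact: h4.
  + exact: h3.
  + exact: h2.
  + by rewrite addrC (sY y m); exact: h2.
  + exact: tY.
Qed.

Lemma gluing : exists (M : metricType R) (f : X -> M) (g : Y -> M),
  [/\ forall x x', mdist (f x) (f x') = dX x x',
      forall y y', mdist (g y) (g y') = dY y y' &
      forall x y, C x y -> mdist (f x) (g y) <= r].
Proof.
have [q [_ qd]] := mquot_proj dist_pseudo.
exists (mquot dist_pseudo), (q \o inl), (q \o inr); split => [x x'|y y'|x y Cxy]; rewrite /= qd//.
rewrite /dist; have := @cross_le x y x y Cxy; have [-> _ _] := pX; have [-> _ _] := pY.
by lra.
Qed.

End gluing.

Section hausdorff.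
Variables (M : metricType R) (A B : set M) (K : R).
Hypotheses (A0 : A !=set0) (B0 : B !=set0).
Hypothesis AB : forall a b, A a -> B b -> mdist a b <= K.

Let infP a : has_inf [set mdist a b | b in B].
Proof.
split; first by have [b Bb] := B0; exists (mdist a b), b.
by exists 0 => _ [b _ <-]; exact: mdist_ge0.
Qed.

Let inf_le a b : B b -> inf [set mdist a b | b in B] <= mdist a b.
Proof. by move=> Bb; apply: ge_inf; [case: (infP a)|exists b]. Qed.

Lemma one_sided_hausdorff_le (r : R) :
  (forall a, A a -> exists2 b, B b & mdist a b <= r) ->
  sup [set inf [set mdist a b | b in B] | a in A] <= r.
Proof.
move=> H; apply: ge_sup.
  by have [a Aa] := A0; exists (inf [set mdist a b | b in B]), a.
by move=> _ [a Aa <-]; have [b Bb ab] := H a Aa; exact: le_trans (inf_le a Bb) ab.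
Qed.

(** The bound [K] makes the set of infima bounded, without which [sup] need not be an upper
    bound. *)
Lemma one_sided_hausdorff_lt (r : R) :
  sup [set inf [set mdist a b | b in B] | a in A] < r ->
  forall a, A a -> exists2 b, B b & mdist a b < r.
Proof.
move=> H a Aa.
have : inf [set mdist a b | b in B] < r.
  apply: le_lt_trans H; apply: ub_le_sup; last by exists a.
  exists K => _ [a' Aa' <-]; have [b Bb] := B0.
  exact: le_trans (inf_le a' Bb) (AB Aa' Bb).
by move=> /(inf_lt (infP a).1)[_ [b Bb <-] abr]; exists b.
Qed.

End hausdorff.

Implicit Types t : rooted_tree R.

Definition tcorr (a : R) t (b : R) t' (r : R) : Prop :=
  corr (fun x y : t => a * mdist x y) (fun x y : t' => b * mdist x y)
    (root t) (root t') r.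

Lemma rooted_tree_bounded t : exists B : R, forall x y : t, mdist x y <= B.
Proof. exact: (@compact_bounded R (rm_sort t) (@rt_compact R t)). Qed.

Let dGH_set t t' := [set r : R | exists (M : metricType R) (f : t -> M) (f' : t' -> M),
  [/\ isometric f, isometric f' &
      r = Num.max (mdist (f (root t)) (f' (root t')))
                  (hausdorff_dist (range f) (range f'))]].

Let dGH_set_ge0 t t' r : dGH_set t t' r -> 0 <= r.
Proof.
by move=> [M [f [f' [_ _ ->]]]]; rewrite le_max mdist_ge0.
Qed.

(** Gluing along the correspondence puts the roots and the two images within [r]. Nonemptiness is
    recorded because the infimum of the empty set is 0 by convention, and nothing could be extracted
    from a bound on [dGH_trees]. *)
Lemma tcorr_dGH t t' r : tcorr 1 t 1 t' r -> dGH_trees t t' <= r /\ dGH_set t t' !=set0.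
Proof.
move=> tr; have r0 := corr_ge0 tr; have [C [C1 C2 C0 Cd _]] := tr.
(* The carriers are given explicitly: inferring [Metric.sort _] here would raise
   the universe of [mquot] above that of the carriers of trees. *)
have [|M [f [g [fd gd fg]]]] := @gluing (rm_sort t) (rm_sort t')
    (fun x y => mdist x y) (fun x y => mdist x y)
    (pseudodist_mdist _) (pseudodist_mdist _) r r0 C _ _ C0.
  by move=> x y x' y' xy xy'; have := Cd _ _ _ _ xy xy'; rewrite !mul1r.
have S : dGH_set t t' (Num.max (mdist (f (root t)) (g (root t')))
    (hausdorff_dist (range f) (range g))) by exists M, f, g.
split; last by eexists; exact: S.
apply: (@le_trans _ _ (Num.max (mdist (f (root t)) (g (root t')))
    (hausdorff_dist (range f) (range g)))).
  by apply: ge_inf => //; exists 0 => s; exact: dGH_set_ge0.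
rewrite !ge_max fg//=; apply/andP; split.
  apply: one_sided_hausdorff_le.
  - by exists (f (root t)), (root t).
  - by exists (g (root t')), (root t').
  - by move=> _ [x _ <-]; have [y xy] := C1 x; exists (g y); [exists y|exact: fg].
apply: (@le_trans _ _ (sup [set inf [set mdist b a | a in range f] | b in range g])).
  by [].
apply: one_sided_hausdorff_le.
- by exists (g (root t')), (root t').
- by exists (f (root t)), (root t).
- move=> _ [y _ <-]; have [x xy] := C2 y; exists (f x); first by exists x.
  by rewrite metric_sym; exact: fg.
Qed.

Lemma tcorr_ex t t' : exists r, tcorr 1 t 1 t' r.
Proof.
have [B BP] := rooted_tree_bounded t; have [B' BP'] := rooted_tree_bounded t'.
exists (Num.max B B'); apply: corr_bound.
- by apply: pseudodist_scale => //; exact: pseudodist_mdist.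
- by apply: pseudodist_scale => //; exact: pseudodist_mdist.
- by move=> x; rewrite mul1r le_max BP.
- by move=> x; rewrite mul1r le_max BP' orbT.
Qed.

Lemma dGH_trees_ge0 t t' : 0 <= dGH_trees t t'.
Proof.
have [r /tcorr_dGH[_ S0]] := tcorr_ex t t'.
by apply: lb_le_inf => // s; exact: dGH_set_ge0.
Qed.

(** Relate the points less than [r] apart in a common embedding. Distances then move by at most
    [2 * r], but so do distances to the root, because the images of the roots may be almost [r]
    apart: this is where the factor 2 is lost. *)
Lemma dGH_tcorr t t' r : dGH_trees t t' < r -> tcorr 1 t 1 t' (2 * r).
Proof.
have [r1 /tcorr_dGH[_ S0]] := tcorr_ex t t'.
move=> /inf_lt[//|_ [M [f [g [fi gi ->]]]]].
rewrite !gt_max => /andP[ro /andP[h1 h2]].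
have [B BP] := rooted_tree_bounded t; have [B' BP'] := rooted_tree_bounded t'.
have fg a b : range f a -> range g b -> mdist a b <= B + r + B'.
  move=> [x _ <-] [y _ <-].
  have := metric_triangle (f x) (f (root t)) (g y).
  have := metric_triangle (f (root t)) (g (root t')) (g y).
  by rewrite fi gi; have := BP x (root t); have := BP' (root t') y; lra.
have r0 : 0 < r by exact: le_lt_trans (mdist_ge0 _ _) ro.
exists (fun x y => mdist (f x) (g y) < r); split => //.
- move=> x; have [||_ [y _ <-] xy] := one_sided_hausdorff_lt _ fg h1 (a := f x).
  + by exists (g (root t')), (root t').
  + by exists x.
  by exists y.
- have gf a b : range g a -> range f b -> mdist a b <= B + r + B'.
    by move=> ga fb; rewrite metric_sym; exact: fg.
  move=> y; have [||_ [x _ <-] xy] := one_sided_hausdorff_lt _ gf h2 (a := g y).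
  + by exists (f (root t)), (root t).
  + by exists y.
  by exists x; rewrite metric_sym.
- move=> x y x' y' xy xy'; rewrite !mul1r -fi -gi.
  have := metric_triangle (f x) (g y) (f x'); have := metric_triangle (g y) (g y') (f x').
  have := metric_triangle (g y) (f x) (g y'); have := metric_triangle (f x) (f x') (g y').
  rewrite (metric_sym (g y) (f x)) (metric_sym (g y') (f x')) ler_norml => *.
  lra.
- move=> x y xy; rewrite !mul1r -fi -gi.
  have := metric_triangle (f (root t)) (g (root t')) (f x).
  have := metric_triangle (g (root t')) (g y) (f x).
  have := metric_triangle (g (root t')) (f (root t)) (g y).
  have := metric_triangle (f (root t)) (f x) (g y).
  rewrite (metric_sym (g (root t')) (f (root t))) (metric_sym (g y) (f x)) ler_norml => *.
  lra.
Qed.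

Lemma tcorr_isometric t t' : root_isometric t t' -> tcorr 1 t 1 t' 0.
Proof.
move=> [f [fi [g fK gK] fr]]; apply: corr_surj fr => [y|x x']; first by exists (g y).
by rewrite fi.
Qed.

End correspondences.

Section tree_distance.
Context {R : realType}.
Implicit Types a b c : tree_space R.

Definition td a b : R := inf [set r : R | tcorr 1 (repr a) 1 (repr b) r].

Lemma td_has_inf a b : has_inf [set r : R | tcorr 1 (repr a) 1 (repr b) r].
Proof.
split; first exact: tcorr_ex.
by exists 0 => r; exact: corr_ge0.
Qed.

Lemma td_le a b r : tcorr 1 (repr a) 1 (repr b) r -> td a b <= r.
Proof. by move=> ar; apply: ge_inf => //; case: (td_has_inf a b). Qed.

Lemma td_lt a b r : td a b < r -> tcorr 1 (repr a) 1 (repr b) r.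
Proof.
by move=> /(inf_lt (td_has_inf a b).1)[s ts sr]; apply: corr_le ts; exact: ltW.
Qed.

Lemma td_ge0 a b : 0 <= td a b.
Proof. by apply: lb_le_inf; [case: (td_has_inf a b)|move=> r; exact: corr_ge0]. Qed.

Lemma td_sym a b : td a b = td b a.
Proof.
by apply/eqP; rewrite eq_le; apply/andP; split; apply/ler_addgt0Pr => e e0;
  apply/td_le/corr_sym/td_lt; rewrite ltrDl.
Qed.

Lemma tdxx a : td a a = 0.
Proof.
by apply/eqP; rewrite eq_le td_ge0 andbT; apply/td_le/corr_refl.
Qed.

Lemma td_triangle b a c : td a c <= td a b + td b c.
Proof.
apply/ler_addgt0Pr => e e0; rewrite [e]splitr addrACA.
have h x y : tcorr 1 (repr x) 1 (repr y) (td x y + e / 2).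
  by apply: td_lt; rewrite ltrDl divr_gt0.
exact: td_le (corr_trans (h a b) (h b c)).
Qed.

Lemma dGH_le_td a b : dGH a b <= td a b.
Proof.
apply/ler_addgt0Pr => e e0.
by have [] := @tcorr_dGH R (repr a) (repr b) (td a b + e) _;
  [apply: td_lt; rewrite ltrDl|].
Qed.

Lemma td_le_dGH a b : td a b <= 2 * dGH a b.
Proof.
apply/ler_addgt0Pr => e e0; have -> : 2 * dGH a b + e = 2 * (dGH a b + e / 2) by lra.
by apply/td_le/dGH_tcorr; rewrite ltrDl divr_gt0.
Qed.

Lemma dGH_ge0 a b : 0 <= dGH a b. Proof. exact: dGH_trees_ge0. Qed.

Lemma tcorr_repr (t : rooted_tree R) : tcorr 1 t 1 (repr (\pi_(tree_space R) t)) 0.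
Proof.
apply: tcorr_isometric; apply/asboolP.
have : t = repr (\pi_(tree_space R) t) %[mod tree_space R] by rewrite reprK.
by move/eqmodP.
Qed.

Lemma mdist_height a (x : repr a) : mdist (root (repr a)) x <= height a.
Proof.
apply: ub_le_sup; last by exists x.
have [B BP] := rooted_tree_bounded (repr a).
by exists B => _ [y _ <-]; exact: BP.
Qed.

Lemma height_le a (r : R) : (forall x : repr a, mdist (root (repr a)) x <= r) -> height a <= r.
Proof.
move=> H; apply: ge_sup; last by move=> _ [x _ <-].
by exists (mdist (root (repr a)) (root (repr a))), (root (repr a)).
Qed.

Lemma height_ge0 a : 0 <= height a.
Proof. by rewrite -(mdistxx (root (repr a))); exact: mdist_height. Qed.

Lemma height_lip a b : height a <= height b + td a b.
Proof.
apply/ler_addgt0Pr => e e0; apply: height_le => x.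
have [|C [C1 _ _ _ Ch]] := @td_lt a b (td a b + e); first by rewrite ltrDl.
have [y xy] := C1 x; have := Ch x y xy; rewrite !mul1r ler_norml => /andP[_ H].
by have := mdist_height y; lra.
Qed.

Lemma td_height a b : td a b <= Num.max (height a) (height b).
Proof.
apply/td_le/corr_bound.
- by apply: pseudodist_scale => //; exact: pseudodist_mdist.
- by apply: pseudodist_scale => //; exact: pseudodist_mdist.
- by move=> x; rewrite mul1r le_max mdist_height.
- by move=> x; rewrite mul1r le_max mdist_height orbT.
Qed.

End tree_distance.

(** * Completeness and separability of the space of trees *)

Section tree_construction.
Context {R : realType}.

(** Compactness of a pseudometric: every ultrafilter has a limit. This form needs no topology on [X]
    and suits both uses: an ultrafilter on threads converges coordinatewise, and one on a graft
    settles in one branch or leaves each of them. *)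
Definition ultra_compact (X : Type) (d : X -> X -> R) : Prop :=
  forall F : set_system X, ProperFilter F -> (forall A, F A \/ F (~` A)) ->
    exists p, forall e : R, 0 < e -> F [set x | d p x < e].

Lemma ultra_limit (X : Type) (M : metricType R) (f : X -> M) (F : set_system X) :
  compact [set: M] -> ProperFilter F -> (forall A, F A \/ F (~` A)) ->
  exists p, forall e : R, 0 < e -> F [set x | mdist p (f x) < e].
Proof.
move=> cM FF Fu; have [|p [_ pc]] := cM (f @ F) _; first exact: filterT.
exists p => e e0; have [//|Fn] := Fu [set x | mdist p (f x) < e].
have [|z [/= nz pz]] := pc (~` [set y | mdist p y < e]) [set y | mdist p y < e] Fn.
  by apply/metricType_numDomainType.nbhs_mdistP; exists e.
by [].
Qed.

Lemma rooted_tree_of_pseudodist (X : Type) (d : X -> X -> R) (o : X) :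
  pseudodist d -> ultra_compact d -> ultra d o ->
  (forall (x : X) (t e : R), 0 <= t <= d o x -> 0 < e ->
     exists z, d o z <= t + e /\ d z x <= d o x - t + e) ->
  exists (t : rooted_tree R) (q : X -> t),
    [/\ forall y, exists x, q x = y,
        forall x x', mdist (q x) (q x') = d x x' & q o = root t].
Proof.
move=> pd cd ud gd; have [q [qs qd]] := mquot_proj pd.
have cM : compact [set: mquot pd].
  rewrite compact_ultra => F UF _.
  (* A section of the quotient map carries the ultrafilter back to [X]. *)
  have [s sK] := choice qs.
  have [|p pP] := cd (s @ F).
    by move=> A; exact: (in_ultra_setVsetC (s @^-1` A) UF).
  exists (q p); split => //.
  apply/metricType_numDomainType.fcvgrPdist_lt => e e0.
  have := pP e e0; rewrite /fmap /=; apply: filterS => m /=.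
  by rewrite -qd sK.
have tM : is_Rtree (mquot pd).
  apply: (@Rtree_criterion R (mquot pd) (q o)) => //.
  - move=> x y z; have [x' <-] := qs x; have [y' <-] := qs y; have [z' <-] := qs z.
    by rewrite /gromov !qd; exact: ud.
  - move=> x t e; have [x' <-] := qs x; rewrite qd => t0 e0.
    by have [z zP] := gd x' t e t0 e0; exists (q z); rewrite !qd.
exists (@RootedTree R (@RootedMetric R (mquot pd) (Metric.class (mquot pd)) (q o)) cM tM), q.
by split.
Qed.

End tree_construction.

(** Forward by choice, backward because every point has a predecessor; the induction shifts the
    sequence of spaces so that a single backward step remains. *)
Lemma thread_extension (T : nat -> Type) (C : forall n, T n -> T n.+1 -> Prop) :
  (forall n x, exists y, C n x y) -> (forall n y, exists x, C n x y) ->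
  forall n (x : T n), exists z : forall n, T n,
    (forall n, C n (z n) (z n.+1)) /\ z n = x.
Proof.
move=> C1 C2 n; elim: n T C C1 C2 => [|n IH] T C C1 C2 x.
  pose f n (y : T n) := sval (cid (C1 n y)).
  exists (nat_rect T x f); split => // n.
  exact: svalP (cid (C1 n (nat_rect T x f n))).
have [z [zC zx]] := IH (fun n => T n.+1) (fun n => C n.+1) (fun n => C1 n.+1)
  (fun n => C2 n.+1) x.
exists (fun k => if k is k'.+1 then z k' else sval (cid (C2 0%N (z 0%N)))).
by split => // -[|k] //; exact: svalP (cid (C2 0%N (z 0%N))).
Qed.

(** * Limits of Cauchy sequences of trees as spaces of threads *)

Section completeness.
Context {R : realType}.
Variables (T : nat -> rooted_tree R) (r s : nat -> R).
Hypothesis Tr : forall n, tcorr 1 (T n) 1 (T n.+1) (r n).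
Hypothesis rs : forall n, r n + s n.+1 <= s n.
Hypothesis s_ge0 : forall n, 0 <= s n.
Hypothesis s_small : forall e : R, 0 < e -> exists n, s n < e.

Let C n : T n -> T n.+1 -> Prop := sval (cid (Tr n)).

(* The closure of the correspondence, so that threads form a compact space. *)
Let cl n (x : T n) (y : T n.+1) : Prop := forall e : R, 0 < e ->
  exists x' y', [/\ C x' y', mdist x x' < e & mdist y y' < e].

Let C1 n (x : T n) : exists y, C x y.
Proof. by rewrite /C; case: (cid (Tr n)) => D [/= ? ? ? ?]. Qed.

Let C2 n (y : T n.+1) : exists x, C x y.
Proof. by rewrite /C; case: (cid (Tr n)) => D [/= ? ? ? ?]. Qed.

Let C0 n : C (root (T n)) (root (T n.+1)).
Proof. by rewrite /C; case: (cid (Tr n)) => D [/= ? ? ? ?]. Qed.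

Let Cd n (x x' : T n) (y y' : T n.+1) :
  C x y -> C x' y' -> `|mdist x x' - mdist y y'| <= 2 * r n.
Proof.
rewrite /C; case: (cid (Tr n)) => D [/= ? ? ? H ?] xy xy'.
by have := H _ _ _ _ xy xy'; rewrite !mul1r.
Qed.

Let Ch n (x : T n) (y : T n.+1) :
  C x y -> `|mdist (root (T n)) x - mdist (root (T n.+1)) y| <= r n.
Proof.
rewrite /C; case: (cid (Tr n)) => D [/= ? ? ? ? H] xy.
by have := H _ _ xy; rewrite !mul1r.
Qed.

Let C_cl n (x : T n) (y : T n.+1) : C x y -> cl x y.
Proof. by move=> xy e e0; exists x, y; rewrite !mdistxx. Qed.

Let mdist_lip (M : metricType R) (x x' y y' : M) :
  `|mdist x y - mdist x' y'| <= mdist x x' + mdist y y'.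
Proof.
have := metric_triangle x x' y; have := metric_triangle x' y' y.
have := metric_triangle x' x y'; have := metric_triangle x y y'.
by rewrite (metric_sym x' x) (metric_sym y' y) ler_norml; lra.
Qed.

Let cld n (x x' : T n) (y y' : T n.+1) :
  cl x y -> cl x' y' -> `|mdist x x' - mdist y y'| <= 2 * r n.
Proof.
move=> xy xy'; apply/ler_addgt0Pr => e e0.
have e4 : 0 < e / 4 by rewrite divr_gt0.
have [a [b [ab xa yb]]] := xy _ e4; have [a' [b' [ab' xa' yb']]] := xy' _ e4.
have := Cd ab ab'; have := mdist_lip x a x' a'; have := mdist_lip y b y' b'.
by rewrite !ler_norml; lra.
Qed.

Let clh n (x : T n) (y : T n.+1) :
  cl x y -> `|mdist (root (T n)) x - mdist (root (T n.+1)) y| <= r n.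
Proof.
move=> xy; apply/ler_addgt0Pr => e e0.
have e2 : 0 < e / 2 by rewrite divr_gt0.
have [a [b [ab xa yb]]] := xy _ e2.
have := Ch ab; have := mdist_lip (root (T n)) (root (T n)) x a.
have := mdist_lip (root (T n.+1)) (root (T n.+1)) y b.
by rewrite !mdistxx !ler_norml; lra.
Qed.

Let is_thread (x : forall n, T n) : Prop := forall n, cl (x n) (x n.+1).

Let thread : Type := {x | is_thread x}.

Let o : thread := exist is_thread (fun n => root (T n)) (fun n => C_cl (C0 n)).

Let s_anti m n : (m <= n)%N -> s n <= s m.
Proof.
elim: n => [|n IH]; first by rewrite leqn0 => /eqP ->.
rewrite leq_eqVlt => /orP[/eqP ->//|]; rewrite ltnS => /IH; apply: le_trans.
by have := rs n; have := corr_ge0 (Tr n); lra.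
Qed.

Let dn n (x y : thread) : R := mdist (sval x n) (sval y n).

Let dn_far n k (x y : thread) :
  `|dn n x y - dn (n + k)%N x y| <= 2 * (s n - s (n + k)%N).
Proof.
elim: k => [|k IH]; first by rewrite addn0 !subrr normr0 mulr0.
have := cld (svalP x (n + k)%N) (svalP y (n + k)%N); have := rs (n + k)%N.
by move: IH; rewrite addnS -!/(dn _ _ _) !ler_norml; lra.
Qed.

Let dn_near m n (x y : thread) : (n <= m)%N -> `|dn n x y - dn m x y| <= 2 * s n.
Proof.
move=> nm; have := dn_far n (m - n) x y; rewrite subnKC// => H.
by apply: le_trans H _; rewrite ler_pM2l//; have := s_ge0 m; lra.
Qed.

(** The limit of the distances [dn n x y], written as an infimum of upper bounds: by [dn_near] it is
    within [2 * s n] of each of them. *)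
Let D (x y : thread) : R := inf [set v : R | exists n, v = dn n x y + 2 * s n].

Let D_dn n x y : `|D x y - dn n x y| <= 2 * s n.
Proof.
have ne : [set v : R | exists n, v = dn n x y + 2 * s n] !=set0.
  by exists (dn 0 x y + 2 * s 0), 0%N.
have lb : dn n x y - 2 * s n <= D x y.
  apply: lb_le_inf => // _ [m ->].
  have [nm|/ltnW mn] := leqP n m.
    by have := dn_near x y nm; have := s_ge0 m; rewrite ler_norml; lra.
  by have := dn_near x y mn; have := s_ge0 n; rewrite ler_norml; lra.
have ub : D x y <= dn n x y + 2 * s n.
  apply: ge_inf; last by exists n.
  exists 0 => _ [m ->]; have := s_ge0 m.
  by have := mdist_ge0 (sval x m) (sval y m); rewrite /dn; lra.
by rewrite ler_norml; lra.
Qed.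

(** The telescoping is redone from the root condition of the correspondences: [D_dn] alone would
    only give [2 * s n]. *)
Let D_root n x : `|D o x - dn n o x| <= s n.
Proof.
have far k : `|dn n o x - dn (n + k)%N o x| <= s n - s (n + k)%N.
  elim: k => [|k IH]; first by rewrite addn0 !subrr normr0.
  have := clh (svalP x (n + k)%N); have := rs (n + k)%N.
  by move: IH; rewrite addnS /dn /= !ler_norml; lra.
apply/ler_addgt0Pr => e e0; have e3 : 0 < e / 3 by rewrite divr_gt0.
have [m sm] := s_small e3.
have sm' : s (n + m)%N < e / 3 by apply: le_lt_trans (s_anti (leq_addl n m)) sm.
have := D_dn (n + m)%N o x; have := far m; have := s_ge0 (n + m)%N.
by rewrite !ler_norml; lra.
Qed.

Let D_pseudo : pseudodist D.
Proof.
split.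
- move=> x; apply/eqP; rewrite -normr_le0; apply/ler_addgt0Pr => e e0.
  have e2 : 0 < e / 2 by rewrite divr_gt0.
  have [n sn] := s_small e2.
  by have := D_dn n x x; rewrite /dn mdistxx subr0; lra.
- move=> x y; congr inf; apply/seteqP; split => v [n ->]; exists n;
    by rewrite /dn metric_sym.
- move=> y x z; apply/ler_addgt0Pr => e e0.
  have e6 : 0 < e / 6 by rewrite divr_gt0.
  have [n sn] := s_small e6.
  have := D_dn n x z; have := D_dn n x y; have := D_dn n y z.
  have := metric_triangle (sval x n) (sval y n) (sval z n).
  by rewrite -/(dn n x z) -/(dn n x y) -/(dn n y z) !ler_norml; lra.
Qed.

Let D_compact : ultra_compact D.
Proof.
move=> F FF Fu.
have lim n : {p : T n | forall e : R, 0 < e -> F [set x | mdist p (sval x n) < e]}.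
  apply: cid.
  exact: (@ultra_limit R thread (rm_sort (T n)) (fun x => sval x n) F
    (@rt_compact R (T n))).
pose p n := sval (lim n).
have pP n e : 0 < e -> F [set x | mdist (p n) (sval x n) < e] := svalP (lim n) e.
have pcl n : cl (p n) (p n.+1).
  move=> e e0; have e2 : 0 < e / 2 by rewrite divr_gt0.
  have [x [/= h1 h2]] := filter_ex (filterI (pP n _ e2) (pP n.+1 _ e2)).
  have [x' [y' [Cxy xx' yy']]] := svalP x n _ e2.
  exists x', y'; split => //.
    by have := metric_triangle (p n) (sval x n) x'; lra.
  by have := metric_triangle (p n.+1) (sval x n.+1) y'; lra.
exists (exist is_thread p pcl) => e e0; have e3 : 0 < e / 3 by rewrite divr_gt0.
have [n sn] := s_small e3.
apply: filterS (pP n _ e3) => x /= px.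
by have := D_dn n (exist is_thread p pcl) x; rewrite /dn /= ler_norml; lra.
Qed.

Let thread_through n (x : T n) : exists z : thread, sval z n = x.
Proof.
have [z [zc zx]] := thread_extension C1 C2 x.
by exists (exist is_thread z (fun n => C_cl (zc n))).
Qed.

Let D_ultra : ultra D o.
Proof.
move=> x y z; apply: contrapT => /not_orP[/negP + /negP]; rewrite -!ltNge => h1 h2.
pose e := Num.min (gromov D o x z - gromov D o x y) (gromov D o z y - gromov D o x y).
(* [e] is the smaller gap. A product computed at level [n] is off by at most [6 * s n], so 20 leaves
   room for two of them. *)
have e0 : 0 < e / 20 by rewrite divr_gt0// lt_min !subr_gt0 h1 h2.
have [n sn] := s_small e0.
have [e1 e2] : e <= gromov D o x z - gromov D o x y /\ e <= gromov D o z y - gromov D o x y.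
  by rewrite !ge_min !lexx orbT.
have := Rtree_ultra (@rt_Rtree R (T n)) (root (T n)) (sval x n) (sval y n) (sval z n).
have sE u : mdist (root (T n)) (sval u n) = dn n o u by [].
rewrite /gromov !sE -/(dn n x z) -/(dn n x y) -/(dn n z y).
move: (D_dn n x y) (D_dn n x z) (D_dn n z y) (D_dn n o x) (D_dn n o y) (D_dn n o z).
move: e1 e2; rewrite /gromov !ler_norml.
by move=> ? ? ? ? ? ? ? ? [|] ?; lra.
Qed.

Let D_geo (x : thread) (t e : R) : 0 <= t <= D o x -> 0 < e ->
  exists z, D o z <= t + e /\ D z x <= D o x - t + e.
Proof.
move=> /andP[t0 tD] e0; have e8 : 0 < e / 8 by rewrite divr_gt0.
have [n sn] := s_small e8.
have := D_dn n o x; rewrite ler_norml => h1.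
(* The height of [x] in [T n] may be below its limit, hence below [t]; the truncation costs at most
   [2 * s n]. *)
pose t' := Num.min t (dn n o x).
have [|z [z1 z2]] := Rtree_geodesic (@rt_Rtree R (T n))
    (w := root (T n)) (x := sval x n) (t := t').
  by rewrite le_min t0 mdist_ge0 /= ge_min lexx orbT.
have [y yz] := thread_through z; exists y.
have := D_dn n o y; have := D_dn n y x; rewrite /dn yz /= z1 z2 !ler_norml.
have [t1 t2] : t' <= t /\ t - 2 * s n <= t'.
  split; first by rewrite ge_min lexx.
  by rewrite le_min; have := s_ge0 n; lra.
by move: h1; rewrite /dn /=; lra.
Qed.

Lemma rooted_tree_limit : exists t : rooted_tree R, forall n, tcorr 1 (T n) 1 t (s n).
Proof.
have [t [q [qs qd qo]]] := rooted_tree_of_pseudodist D_pseudo D_compact D_ultra D_geo.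
exists t => n; exists (fun x y => exists2 z : thread, sval z n = x & q z = y); split.
- by move=> x; have [z zx] := thread_through x; exists (q z), z.
- by move=> y; have [z zy] := qs y; exists (sval z n), z.
- by exists o.
- move=> x y x' y' [z <- <-] [z' <- <-]; rewrite !mul1r qd distrC.
  exact: D_dn.
- move=> x y [z <- <-]; rewrite !mul1r -qo qd distrC.
  exact: D_root.
Qed.

End completeness.

Section tree_space_topology.
Context {R : realType}.

Lemma td_complete (a : nat -> tree_space R) (r s : nat -> R) :
  (forall n, td (a n) (a n.+1) < r n) -> (forall n, r n + s n.+1 <= s n) ->
  (forall n, 0 <= s n) -> (forall e : R, 0 < e -> exists n, s n < e) ->
  exists b, forall n, td (a n) b <= s n.
Proof.
move=> ar rs s0 s_small.
have [t tP] := @rooted_tree_limit R (fun n => repr (a n)) r s (fun n => td_lt (ar n)) rs s0 s_small.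
exists (\pi_(tree_space R) t) => n; apply: td_le.
by have := corr_trans (tP n) (tcorr_repr t); rewrite addr0.
Qed.

(** The code lists the mutual distances in a finite net, rounded down to multiples of [rate k]; the
    root comes first in the net, so that heights are compared as well. Matching points of equal rank
    costs 1 unit for rounding and 2 for each net, whence 5. The codes form a countable type, which
    gives separability. *)
Lemma tree_code (k : nat) : exists code : tree_space R -> nat,
  forall a b, code a = code b -> td a b <= 5 * rate k.
Proof.
have e0 := @rate_gt0 R k; set e := rate k in e0 *.
have net (a : tree_space R) : {s : seq (repr a) |
    forall y : repr a, exists2 i, (i < size (root (repr a) :: s))%N &
      mdist (nth (root (repr a)) (root (repr a) :: s) i) y < e}.
  apply: cid; have [s sP] := @compact_net R (rm_sort (repr a)) (@rt_compact R (repr a)) e e0.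
  exists s => y; have [x xs xy] := sP y.
  exists (index x s).+1; first by rewrite /= ltnS index_mem.
  by rewrite /= nth_index.
pose p (a : tree_space R) i : repr a := nth (root (repr a)) (root (repr a) :: sval (net a)) i.
pose n (a : tree_space R) := size (root (repr a) :: sval (net a)).
pose w (a : tree_space R) i j := Num.truncn (mdist (p a i) (p a j) / e).
pose code (a : tree_space R) : seq (seq nat) := mkseq (fun i => mkseq (w a i) (n a)) (n a).
exists (fun a => @choice.pickle (seq (seq nat)) (code a)) => a b /(pcan_inj (@choice.pickleK (seq (seq nat)))) ab.
have nab : n a = n b by rewrite -(size_mkseq (fun i => mkseq (w a i) (n a)) (n a)) -/(code a) ab size_mkseq.
have wab i j : (i < n a)%N -> (j < n a)%N -> w a i j = w b i j.
  move=> ia ja; have := congr1 (fun s => nth 0%N (nth [::] s i) j) ab.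
  by rewrite /code !nth_mkseq -?nab.
have dab i j : (i < n a)%N -> (j < n a)%N ->
    `|mdist (p a i) (p a j) - mdist (p b i) (p b j)| <= e.
  move=> ia ja; have := wab i j ia ja; rewrite /w.
  have /truncn_itv : 0 <= mdist (p a i) (p a j) / e by rewrite divr_ge0 ?mdist_ge0 ?ltW.
  have /truncn_itv : 0 <= mdist (p b i) (p b j) / e by rewrite divr_ge0 ?mdist_ge0 ?ltW.
  set u := Num.truncn _; set v := Num.truncn _ => + + vu; rewrite vu.
  rewrite !ler_pdivlMr// !ltr_pdivrMr// -natr1 mulrDl mul1r ler_norml.
  by lra.
apply: td_le; exists (fun x y => exists i, [/\ (i < n a)%N, mdist (p a i) x < e &
  mdist (p b i) y < e]).
have n0 : (0 < n a)%N by [].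
have dist4 (M : metricType R) (x y x' y' : M) : mdist x y < e -> mdist x' y' < e ->
    `|mdist x x' - mdist y y'| <= 2 * e.
  move=> xy xy'; have := metric_triangle x y x'; have := metric_triangle y y' x'.
  have := metric_triangle y x y'; have := metric_triangle x x' y'.
  by rewrite (metric_sym y x) (metric_sym y' x') ler_norml; lra.
split.
- move=> x; have [i ia ix] := svalP (net a) x.
  by exists (p b i), i; rewrite mdistxx.
- move=> x; have [i ia ix] := svalP (net b) x.
  by exists (p a i), i; rewrite mdistxx nab.
- by exists 0%N; rewrite !mdistxx.
- move=> x y x' y' [i [ia ix iy]] [j [ja jx jy]]; rewrite !mul1r.
  have := dab i j ia ja; have := dist4 _ _ _ _ _ ix jx; have := dist4 _ _ _ _ _ iy jy.
  by rewrite !ler_norml; lra.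
- move=> x y [i [ia ix iy]]; rewrite !mul1r.
  have := dab 0%N i n0 ia.
  have := dist4 _ (root (repr a)) (root (repr a)) _ _ _ ix.
  have := dist4 _ (root (repr b)) (root (repr b)) _ _ _ iy.
  by rewrite !mdistxx => /(_ e0) + /(_ e0); rewrite !ler_norml; lra.
Qed.

Lemma tree_space_separable : exists s : nat -> tree_space R,
  forall a (e : R), 0 < e -> exists n, td a (s n) < e.
Proof.
have [code codeP] := choice tree_code.
pose s n : tree_space R := if choice.unpickle n is Some (k, c) then
  if pselect (exists a, code k a = c) is left h then sval (cid h) else point
  else point.
exists s => a e e0; have e5 : 0 < e / 6 by rewrite divr_gt0.
have [k /(_ k (leqnn k)) ke] := rate_lt e5.
exists (choice.pickle (k, code k a)); rewrite /s choice.pickleK.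
case: pselect => [h|[]]; last by exists a.
have := svalP (cid h) => /esym/codeP; have := @rate_gt0 R k.
by lra.
Qed.

End tree_space_topology.

(** * Grafting *)

(** Ultrametricity at [o] reduces a general triangle inequality to triangles through [o], the only
    ones to be checked on a graft. *)
Lemma ultra_pseudodist (R : realType) (X : Type) (d : X -> X -> R) (o : X) :
  (forall x, d x x = 0) -> (forall x y, d x y = d y x) ->
  (forall x y, d o y <= d o x + d x y) -> ultra d o -> pseudodist d.
Proof.
move=> d0 ds dt ud; split => // y x z.
have := ud x z y; have := dt y z; have := dt y x; rewrite /gromov (ds y x).
by move=> ? ? [] ?; lra.
Qed.

Section graft_metric.
Context {R : realType}.
Variables (beta l : R) (x p : nat -> R) (tau : nat -> tree_space R).
Hypotheses (l0 : 0 <= l) (xl : forall i, 0 <= x i <= l) (p0 : forall i, 0 <= p i).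

Local Notation U := (graft_union l tau).
Local Notation d := (@graft_dist R beta l x p tau).
Local Notation a i := (p i `^ beta).
Local Notation br i y := (inr (existT (fun j => rm_sort (repr (tau j))) i y) : U).

Definition graft_pos (u : U) : R :=
  match u with inl b => val b | inr v => x (tag v) end.

Definition graft_height (u : U) : R :=
  match u with inl b => 0 | inr v => branch_height beta p v end.

Definition same_branch (u v : U) : bool :=
  match u, v with inr u', inr v' => tag u' == tag v' | _, _ => false end.

Definition graft_origin : U.
Proof. by left; exists 0; rewrite in_itv /= lexx. Defined.

Let o := graft_origin.

Let a0 i : 0 <= a i. Proof. exact: powR_ge0. Qed.

Let pos_itv u : 0 <= graft_pos u <= l.
Proof. by case: u => [[b /=]|v] /=; [rewrite in_itv|exact: xl]. Qed.

Lemma graft_height_ge0 u : 0 <= graft_height u.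
Proof. by case: u => //= v; rewrite mulr_ge0 ?mdist_ge0. Qed.

Lemma graft_dist_origin u : d o u = graft_pos u + graft_height u.
Proof.
case: u => [b|v] /=.
  by rewrite sub0r normrN addr0 ger0_norm//; have /= /andP[] := pos_itv (inl b).
by rewrite sub0r normrN ger0_norm//; have /= /andP[] := pos_itv (inr v).
Qed.

Lemma graft_dist_diff u v : ~~ same_branch u v ->
  d u v = graft_height u + `|graft_pos u - graft_pos v| + graft_height v.
Proof.
case: u v => [b|u] [c|v] //=; rewrite ?addr0 ?add0r//.
by move=> /negbTE ->.
Qed.

Lemma graft_dist_same i (y z : repr (tau i)) :
  d (br i y) (br i z) = a i * mdist y z.
Proof. by rewrite /= eqxx tagged_asE. Qed.

Lemma same_branchP u v : same_branch u v ->
  exists i (y z : repr (tau i)), u = br i y /\ v = br i z.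
Proof.
case: u v => [b|[i y]] [c|[j z]] //= /eqP ij.
by move: ij z => <- z; exists i, y, z.
Qed.

Lemma same_branch_pos u v : same_branch u v -> graft_pos u = graft_pos v.
Proof. by move=> /same_branchP[i [y [z [-> ->]]]]. Qed.

(** Geodesics from the origin to different branches part on the segment, at the lower attachment
    point. *)
Let gromov_diff u v : ~~ same_branch u v ->
  gromov d o u v = 2 * Num.min (graft_pos u) (graft_pos v).
Proof.
move=> uv; rewrite /gromov !graft_dist_origin graft_dist_diff//.
case: (leP (graft_pos u) (graft_pos v)) => h.
  by rewrite distrC ger0_norm ?subr_ge0//; lra.
by rewrite ger0_norm ?subr_ge0 ?ltW//; lra.
Qed.

Let gromov_same i (y z : repr (tau i)) :
  gromov d o (br i y) (br i z) =
  2 * x i + a i * gromov mdist (root (repr (tau i))) y z.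
Proof.
by rewrite /gromov !graft_dist_origin graft_dist_same /= /branch_height /=; lra.
Qed.

Let d_sym u v : d u v = d v u.
Proof.
have [/same_branchP[i [y [z [-> ->]]]]|uv] := boolP (same_branch u v).
  by rewrite !graft_dist_same metric_sym.
rewrite !graft_dist_diff//; first by rewrite distrC; lra.
by apply: contra uv; case: u v => [b|u] [c|v] //=; rewrite eq_sym.
Qed.

Let d0 u : d u u = 0.
Proof.
case: u => [b|[i y]]; first by rewrite /= subrr normr0.
by rewrite graft_dist_same mdistxx mulr0.
Qed.

(** Between branches the product is twice the lower position, and minima are ultrametric. Inside a
    branch it is the product of the tree, scaled and raised by twice the position, so it is never
    below the products with outside points. *)
Lemma graft_ultra : ultra d o.
Proof.
move=> u v w.
have [uv|uv] := boolP (same_branch u v); last first.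
  have [uw|uw] := boolP (same_branch u w).
    right; have wv : ~~ same_branch w v.
      move/same_branchP : uw uv => [i [y [z [-> ->]]]].
      by case: v => // -[j v] /=.
    by rewrite !gromov_diff// (same_branch_pos uw).
  have [wv|wv] := boolP (same_branch w v).
    by left; rewrite !gromov_diff// (same_branch_pos wv).
  rewrite !gromov_diff// !ler_pM2l//.
  move: (graft_pos u) (graft_pos v) (graft_pos w) => A B C.
  by case: (leP A B) => _; [left|right]; rewrite ge_min lexx ?orbT.
have [uw|uw] := boolP (same_branch u w); last first.
  left; rewrite gromov_diff//.
  have [i [y [z [-> ->]]]] := same_branchP uv.
  rewrite gromov_same /=; apply: (@le_trans _ _ (2 * x i)).
    by rewrite ler_pM2l// ge_min lexx.
  rewrite lerDl mulr_ge0// /gromov subr_ge0.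
  by rewrite (metric_sym (root _) y) metric_triangle.
have [i [y [z [Eu Ev]]]] := same_branchP uv.
have [j [y' [z' [Eu' Ew]]]] := same_branchP uw.
move: Eu' Ew; rewrite Eu => -[ij]; move: ij y' z' => <- y' z' _ Ew.
rewrite Ev Ew !gromov_same !lerD2l.
have [h|h] := Rtree_ultra (@rt_Rtree R (repr (tau i))) (root (repr (tau i))) y z z';
  [left|right]; exact: ler_wpM2l.
Qed.

Lemma graft_pseudodist : pseudodist d.
Proof.
apply: (ultra_pseudodist (o := o)) => //; last exact: graft_ultra.
move=> u v; have [/same_branchP[i [y [z [-> ->]]]]|uv] := boolP (same_branch u v).
  rewrite !graft_dist_origin graft_dist_same /= /branch_height /= -addrA lerD2l.
  by rewrite -mulrDr ler_wpM2l// metric_triangle.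
rewrite !graft_dist_origin graft_dist_diff//.
by have := graft_height_ge0 u; have := ler_norm (graft_pos v - graft_pos u);
  rewrite distrC; lra.
Qed.

Let spine (t : R) : 0 <= t <= l -> exists b : {b : R | b \in `[0, l]}, val b = t.
Proof. by move=> tl; have tI : t \in `[0, l] by []; exists (exist _ t tI). Qed.

Lemma graft_geodesic (u : U) (t e : R) : 0 <= t <= d o u -> 0 < e ->
  exists z, d o z <= t + e /\ d z u <= d o u - t + e.
Proof.
move=> /andP[t0 tu] e0; have [ul1 ul2] := andP (pos_itv u).
have [tp|tp] := leP t (graft_pos u).
  have [|b bt] := @spine t; first by rewrite t0 (le_trans tp).
  exists (inl b); rewrite !graft_dist_origin graft_dist_diff// [graft_pos _]/= [graft_height _]/= bt.
  rewrite distrC ger0_norm ?subr_ge0//; split; lra.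
move: u tu ul1 ul2 tp => [b|[i y]]; rewrite graft_dist_origin //=.
  by move=> *; exfalso; lra.
rewrite /branch_height /= => tu ul1 ul2 tp.
have ai0 : 0 < a i.
  rewrite lt_neqAle eq_sym a0 andbT; apply/eqP => ai; move: tu; rewrite ai mul0r.
  by lra.
have [|z [z1 z2]] := Rtree_geodesic (@rt_Rtree R (repr (tau i)))
    (w := root (repr (tau i))) (x := y) (t := (t - x i) / a i).
  apply/andP; split; last by rewrite ler_pdivrMr// mulrC; lra.
  by apply: divr_ge0; rewrite ?subr_ge0; exact: ltW.
exists (br i z).
have dz : d o (br i z) = x i + a i * mdist (root (repr (tau i))) z.
  exact: graft_dist_origin.
change (d o (br i z) <= t + e /\
  d (br i z) (br i y) <= x i + a i * mdist (root (repr (tau i))) y - t + e).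
rewrite dz graft_dist_same z1 z2.
by rewrite mulrBr mulrCA mulfV ?gt_eqF// mulr1; split; lra.
Qed.

Definition graft_good : Prop := forall e : R, 0 < e ->
  exists N, forall n, (N <= n)%N -> a n * height (tau n) < e.

Let in_branch i : set U := [set u | if u is inr v then tag v == i else false].

Let in_branchP i u : in_branch i u -> exists y : repr (tau i), u = br i y.
Proof.
case: u => [b|[j y]] //= /eqP ji.
by move: ji y => -> y; exists y.
Qed.

Let coord i (u : U) : repr (tau i) :=
  if u is inr v then
    if tag v =P i is ReflectT h then ecast j (repr (tau j)) h (tagged v)
    else root (repr (tau i))
  else root (repr (tau i)).

Let coordE i (y : repr (tau i)) : coord i (br i y) = y.
Proof. by rewrite /coord /=; case: eqP => // h; rewrite eq_axiomK. Qed.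

(** An ultrafilter either contains one branch, and converges in that compact tree, or avoids any
    finite set of branches; in the latter case heights become small, and it converges to the limit
    of the positions on the segment. *)
Lemma graft_compact : graft_good -> ultra_compact d.
Proof.
move=> good F FF Fu.
have [[i Fi]|nF] := pselect (exists i, F (in_branch i)).
  have [q qP] := @ultra_limit R U (rm_sort (repr (tau i))) (coord i) F
    (@rt_compact R (repr (tau i))) FF Fu.
  exists (br i q) => e e0.
  (* The 1 guards against a vanishing scale factor. *)
  have e1 : 0 < e / (a i + 1) by rewrite divr_gt0// ltr_pwDr.
  apply: filterS (filterI Fi (qP _ e1)) => u [/in_branchP[y ->]].
  rewrite /mkset coordE graft_dist_same ltr_pdivlMr ?ltr_pwDr// => qy.
  by have := mdist_ge0 q y; lra.
have nFi N : F [set u | forall i, (i < N)%N -> ~ in_branch i u].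
  elim: N => [|N IH]; first by apply: filterS filterT => u _ i.
  have FN : F (~` in_branch N) by have [h|//] := Fu (in_branch N); case: nF; exists N.
  apply: filterS (filterI IH FN) => u [h1 h2] i.
  by rewrite ltnS leq_eqVlt => /orP[/eqP ->//|/h1].
have [|q [ql qc]] := @segment_compact R 0 l (graft_pos @ F) _.
  have : F (graft_pos @^-1` `[0, l]) by apply: filterS filterT => u _; rewrite /= in_itv; exact: pos_itv.
  by [].
have [b bq] := spine ql.
have qP (e : R) : 0 < e -> F [set u | `|q - graft_pos u| < e].
  move=> e0; have [//|Fn] := Fu [set u | `|q - graft_pos u| < e].
  have [|z [/= nz pz]] := qc (~` [set t : R | `|q - t| < e]) [set t : R | `|q - t| < e] Fn.
    by apply/nbhs_ballP; exists e.
  by [].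
exists (inl b) => e e0; have e2 : 0 < e / 2 by rewrite divr_gt0.
have [N NP] := good _ e2.
apply: filterS (filterI (nFi N) (qP _ e2)) => u [h1 h2].
rewrite /mkset in h2 *; rewrite graft_dist_diff//= add0r bq [e]splitr ltrD//.
case: u h1 {h2} => [c|[i y]] //= h1; rewrite /branch_height /=.
have [iN|Ni] := ltnP i N; first by case: (h1 i iN) => /=.
by apply: le_lt_trans (NP i Ni); rewrite ler_wpM2l//; exact: mdist_height.
Qed.

Lemma is_graft_exists : graft_good -> exists t, is_graft beta l x p tau t.
Proof.
move=> good; have [t [q [qs qd qo]]] := rooted_tree_of_pseudodist graft_pseudodist
  (graft_compact good) graft_ultra graft_geodesic.
exists t, q; split => // b b0; rewrite -qo; apply: mdist_positivity.
by rewrite qd graft_dist_diff//= b0 subrr normr0 !addr0.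
Qed.

(** Otherwise there are points higher than [e / 2] in branches of arbitrarily large index; those of
    distinct branches are more than [e] apart, so they have no cluster point. *)
Lemma is_graft_good t : is_graft beta l x p tau t -> graft_good.
Proof.
move=> [q [_ qd _]]; apply: contrapT => /existsNP[e /not_implyP[e0 bad]].
have {}bad (N : nat) : {u : U & {i : nat | [/\ (N <= i)%N, in_branch i u & e / 2 < graft_height u]}}.
  have [i /not_implyP[Ni /negP]] : {i | ~ ((N <= i)%N -> a i * height (tau i) < e)}.
    by apply: cid; apply/existsNP => H; apply: bad; exists N.
  rewrite -leNgt => ei.
  have ai0 : 0 < a i.
    rewrite lt_neqAle eq_sym a0 andbT; apply/eqP => ai; move: ei; rewrite ai mul0r.
    by lra.
  have [y ey] : {y : repr (tau i) | e / 2 < a i * mdist (root (repr (tau i))) y}.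
    apply: cid; apply: contrapT => /forallNP H.
    have : height (tau i) <= e / 2 / a i.
      apply: height_le => y; rewrite ler_pdivlMr// mulrC leNgt.
      by apply/negP => hy; exact: H hy.
    by rewrite ler_pdivlMr// mulrC; lra.
  by exists (br i y), i; split => //=; rewrite eqxx.
pose u N := projT1 (bad N); pose i N := sval (projT2 (bad N)).
have uP N : [/\ (N <= i N)%N, in_branch (i N) (u N) & e / 2 < graft_height (u N)].
  exact: svalP (projT2 (bad N)).
have [c cP] := @compact_clusterP R (rm_sort t) (@rt_compact R t) (q \o u).
have e2 : 0 < e / 2 by rewrite divr_gt0.
(* Starting the second search at [(i m).+1] forces it into another branch. *)
have [m _ cm] := cP _ 0%N e2; have [k ik ck] := cP _ (i m).+1 e2.
have [_ um hm] := uP m; have [ki uk hk] := uP k.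
have diff : ~~ same_branch (u m) (u k).
  case: (u m) (u k) um uk => [b|v] [c'|w] //= /eqP -> /eqP ->.
  by rewrite neq_ltn (leq_trans ik ki).
have := metric_triangle (q (u m)) c (q (u k)).
rewrite qd graft_dist_diff// (metric_sym _ c).
by have := normr_ge0 (graft_pos (u m) - graft_pos (u k)); move: cm ck => /=; lra.
Qed.

End graft_metric.

Section graft_comparison.
Context {R : realType}.
Variable beta : R.

(** Branches are matched index by index, points of the segments when within [de]. Each end of a pair
    contributes [r] by its height and [de] by its position, which is twice what the distance to the
    root may move. The case [de = 0] serves the contraction, [de > 0] the measurability of the
    graft. *)
Lemma graft_corr (l l' : R) (x x' p p' : nat -> R) (tau tau' : nat -> tree_space R)
    (l0 : 0 <= l) (l0' : 0 <= l') (r de : R) :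
  (forall i, 0 <= x i <= l) -> (forall i, 0 <= x' i <= l') -> 0 <= de -> 0 <= r ->
  `|l - l'| <= de -> (forall i, `|x i - x' i| <= de) ->
  (forall i, tcorr (p i `^ beta) (repr (tau i)) (p' i `^ beta) (repr (tau' i)) r) ->
  corr (@graft_dist R beta l x p tau) (@graft_dist R beta l' x' p' tau')
    (graft_origin tau l0) (graft_origin tau' l0') (r + de).
Proof.
move=> xl xl' de0 r0 ll' xx' tt'.
pose C i := sval (cid (tt' i)).
have CP i := svalP (cid (tt' i)).
have C1 i y : exists z, C i y z by case: (CP i) => h _ _ _ _; exact: h.
have C2 i z : exists y, C i y z by case: (CP i) => _ h _ _ _; exact: h.
have Cd i y z y' z' : C i y z -> C i y' z' ->
    `|p i `^ beta * mdist y y' - p' i `^ beta * mdist z z'| <= 2 * r.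
  by case: (CP i) => _ _ _ h _; exact: h.
have Ch i y z : C i y z ->
    `|p i `^ beta * mdist (root (repr (tau i))) y -
      p' i `^ beta * mdist (root (repr (tau' i))) z| <= r.
  by case: (CP i) => _ _ _ _ h; exact: h.
pose br i (y : repr (tau i)) : graft_union l tau :=
  inr (existT (fun j => rm_sort (repr (tau j))) i y).
pose br' i (y : repr (tau' i)) : graft_union l' tau' :=
  inr (existT (fun j => rm_sort (repr (tau' j))) i y).
pose rel (u : graft_union l tau) (v : graft_union l' tau') : Prop :=
  (exists b b', [/\ u = inl b, v = inl b' & `|val b - val b'| <= de]) \/
  (exists i y z, [/\ u = br i y, v = br' i z & C i y z]).
have relP u v : rel u v -> `|graft_pos x u - graft_pos x' v| <= de /\
    `|graft_height beta p u - graft_height beta p' v| <= r.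
  move=> [[b [b' [-> -> bb']]]|[i [y [z [-> -> yz]]]]] /=.
    by rewrite subrr normr0.
  by split => //; exact: Ch yz.
have rel_same u v u' v' : rel u v -> rel u' v' -> same_branch u u' ->
    same_branch v v' /\ `|graft_dist beta x p u u' - graft_dist beta x' p' v v'| <= 2 * r.
  move=> uv + /same_branchP[i [y [y' [Eu Eu']]]].
  move: uv; rewrite {}Eu {}Eu' => -[[b [b' [//]]]|[j [y1 [z1 [E -> Cyz]]]]].
  have ij : i = j by case: E.
  move: j ij y1 z1 E Cyz => _ <- y1 z1 [] E Cyz.
  have {E} E : y = y1 by exact: existT_inj2 E.
  move=> [[b [b' [//]]]|[j [y2 [z2 [E' -> Cyz']]]]].
  have ij : i = j by case: E'.
  move: j ij y2 z2 E' Cyz' => _ <- y2 z2 [] E' Cyz'.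
  have {E'} E' : y' = y2 by exact: existT_inj2 E'.
  rewrite E E' !graft_dist_same /= eqxx; split => //; exact: Cd.
have rel_diff u v u' v' : rel u v -> rel u' v' -> ~~ same_branch u u' -> ~~ same_branch v v'.
  by move=> [[b [b' [-> -> _]]]|[i [y [z [-> -> _]]]]]
    [[c [c' [-> -> _]]]|[j [y' [z' [-> -> _]]]]].
exists rel; split.
- move=> [b|[i y]]; last by have [z yz] := C1 i y; exists (br' i z); right; exists i, y, z.
  (* Truncation to the other segment moves a point by at most the difference of the lengths. *)
  have b'I : Num.min (val b) l' \in `[0, l'].
    have := valP b; rewrite !in_itv /= ge_min lexx orbT andbT le_min l0' andbT.
    by case/andP.
  exists (inl (exist _ (Num.min (val b) l') b'I)); left; eexists; eexists; split; [by []|by []|].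
  have := valP b; rewrite in_itv /= => /andP[b0 bl].
  move: ll'; rewrite !ler_norml; case: (leP (\val b) l') => /= h; lra.
- move=> [b|[i z]]; last by have [y yz] := C2 i z; exists (br i y); right; exists i, y, z.
  have bI : Num.min (val b) l \in `[0, l].
    have := valP b; rewrite !in_itv /= ge_min lexx orbT andbT le_min l0 andbT.
    by case/andP.
  exists (inl (exist _ (Num.min (val b) l) bI)); left; eexists; eexists; split; [by []|by []|].
  have := valP b; rewrite in_itv /= => /andP[b0 bl].
  move: ll'; rewrite !ler_norml; case: (leP (\val b) l) => /= h; lra.
- by left; eexists; eexists; split; [by []|by []|rewrite /= subrr normr0].
- move=> u v u' v' uv uv'.
  have [same|diff] := boolP (same_branch u u').
    by have [_ h] := rel_same _ _ _ _ uv uv' same; lra.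
  rewrite !graft_dist_diff//; last exact: rel_diff diff.
  have [h1 h2] := relP _ _ uv; have [h3 h4] := relP _ _ uv'.
  move: (graft_pos x u) (graft_pos x' v) (graft_pos x u') (graft_pos x' v') h1 h3.
  move=> A B A' B' h1 h3.
  have h5 : `| `|A - A'| - `|B - B'| | <= 2 * de.
    apply: le_trans (ler_dist_dist _ _) _.
    have -> : A - A' - (B - B') = (A - B) - (A' - B') by lra.
    by apply: le_trans (ler_normB _ _) _; lra.
  by move: h2 h4 h5; rewrite !ler_norml; lra.
- move=> u v /relP[h1 h2]; rewrite !graft_dist_origin//.
  by move: h1 h2; rewrite !ler_norml; lra.
Qed.

Lemma graft_tcorr (l : R) (x p : nat -> R) (tau : nat -> tree_space R) (l0 : 0 <= l) :
  (forall i, 0 <= x i <= l) -> graft_good beta p tau ->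
  corr (@graft_dist R beta l x p tau)
    (fun y z : repr (graft beta l x p tau) => 1 * mdist y z)
    (graft_origin tau l0) (root (repr (graft beta l x p tau))) 0.
Proof.
move=> xl good; rewrite /graft; case: pselect => [h|[]]; last exact: is_graft_exists.
set t := projT1 (cid h).
have [q [qs qd qo]] : is_graft beta l x p tau t := projT2 (cid h).
have c0 : corr (@graft_dist R beta l x p tau) (fun y z : t => 1 * mdist y z)
    (graft_origin tau l0) (root t) 0.
  apply: (corr_surj (q := q)) => // [u v|]; first by rewrite qd mul1r.
  by rewrite qo.
by have := corr_trans c0 (tcorr_repr t); rewrite addr0.
Qed.

Lemma graft_td_le (l l' : R) (x x' p p' : nat -> R) (tau tau' : nat -> tree_space R) (r de : R) :
  0 <= l -> 0 <= l' ->
  (forall i, 0 <= x i <= l) -> (forall i, 0 <= x' i <= l') -> 0 <= de -> 0 <= r ->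
  graft_good beta p tau -> graft_good beta p' tau' ->
  `|l - l'| <= de -> (forall i, `|x i - x' i| <= de) ->
  (forall i, tcorr (p i `^ beta) (repr (tau i)) (p' i `^ beta) (repr (tau' i)) r) ->
  td (graft beta l x p tau) (graft beta l' x' p' tau') <= r + de.
Proof.
move=> l0 l0' xl xl' de0 r0 g g' ll xx tt'; apply: td_le.
have c1 := corr_sym (graft_tcorr l0 xl g).
have c2 := graft_corr l0 l0' xl xl' de0 r0 ll xx tt'.
have c3 := graft_tcorr l0' xl' g'.
by have := corr_trans (corr_trans c1 c2) c3; rewrite add0r addr0.
Qed.

(** A zero factor collapses both trees to a point and forbids dividing by [a], hence the separate
    case. *)
Lemma tcorr_scale (a : R) (s t : tree_space R) (r : R) : 0 <= a ->
  a * td s t < r -> tcorr a (repr s) a (repr t) r.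
Proof.
move=> a0 ar; have [->|an0] := eqVneq a 0.
  apply: corr_bound; do ?[exact: pseudodist_scale (lexx 0) (pseudodist_mdist _)].
  - by move=> x; rewrite mul0r; apply: le_trans (ltW ar); rewrite mulr_ge0// td_ge0.
  - by move=> x; rewrite mul0r; apply: le_trans (ltW ar); rewrite mulr_ge0// td_ge0.
have a_gt0 : 0 < a by rewrite lt_neqAle eq_sym an0.
have [|C [C1 C2 C0 Cd Ch]] := @td_lt R s t (r / a); first by rewrite ltr_pdivlMr// mulrC.
exists C; split => //.
- move=> x y x' y' xy xy'; have := Cd _ _ _ _ xy xy'; rewrite !mul1r -mulrBr normrM.
  by rewrite ger0_norm// mulrA ler_pdivlMr// mulrC.
- move=> x y xy; have := Ch _ _ xy; rewrite !mul1r -mulrBr normrM.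
  by rewrite ger0_norm// ler_pdivlMr// mulrC.
Qed.

Lemma graft_contract (l : R) (x p : nat -> R) (tau tau' : nat -> tree_space R) (r : R) :
  0 <= l -> (forall i, 0 <= x i <= l) ->
  graft_good beta p tau -> graft_good beta p tau' ->
  (forall i, p i `^ beta * td (tau i) (tau' i) <= r) ->
  td (graft beta l x p tau) (graft beta l x p tau') <= r.
Proof.
move=> l0 xl g g' H; apply/ler_addgt0Pr => e e0; rewrite -[r + e]addr0.
have r0 : 0 <= r by apply: le_trans (H 0%N); rewrite mulr_ge0 ?powR_ge0 ?td_ge0.
apply: graft_td_le => //.
- lra.
- by rewrite subrr normr0.
- by move=> i; rewrite subrr normr0.
- move=> i; apply: tcorr_scale; first exact: powR_ge0.
  by have := H i; lra.
Qed.

Lemma height_tcorr (t : rooted_tree R) (r : R) :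
  (forall y : t, mdist (root t) y <= r) -> height (\pi_(tree_space R) t) <= r.
Proof.
move=> H; have [C [_ C2 _ _ Ch]] := tcorr_repr t.
apply: height_le => z; have [y yz] := C2 z; have := Ch _ _ yz; have := H y.
by rewrite !mul1r ler_norml; lra.
Qed.

Lemma graft_bad (l : R) (x p : nat -> R) (tau : nat -> tree_space R) :
  (forall i, 0 <= p i) ->
  ~ graft_good beta p tau ->
  graft beta l x p tau = \pi_(tree_space R) (one_point_tree R).
Proof.
move=> p0 ng; rewrite /graft; case: pselect => // -[t tg].
by case: ng; exact: is_graft_good tg.
Qed.

(** The default one-point tree has height 0, so the bound also covers grafts that are not
    compact. *)
Lemma height_graft (l : R) (x p : nat -> R) (tau : nat -> tree_space R) (r : R) :
  0 <= l -> (forall i, 0 <= x i <= l) -> (forall i, p i `^ beta * height (tau i) <= r) ->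
  height (graft beta l x p tau) <= l + r.
Proof.
move=> l0 xl H.
have r0 : 0 <= r by apply: le_trans (H 0%N); rewrite mulr_ge0 ?powR_ge0 ?height_ge0.
rewrite /graft; case: pselect => [h|_]; apply: height_tcorr => y; last first.
  by rewrite [y](_ : _ = root (one_point_tree R)) ?mdistxx ?addr_ge0//; case: y.
move: y; set t := projT1 (cid h) => y.
have [q [qs qd qo]] : is_graft beta l x p tau t := projT2 (cid h).
have -> : root t = q (graft_origin tau l0) by rewrite qo.
have [u <-] := qs y; rewrite qd graft_dist_origin//.
apply: lerD; first by case: u => [[b /=]|v] /=; [rewrite in_itv => /andP[]|case/andP: (xl (tag v))].
case: u => [b //|[i z]] /=; rewrite /branch_height /=.
by apply: le_trans (H i); rewrite ler_wpM2l ?powR_ge0// mdist_height.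
Qed.

End graft_comparison.

(** * Measurability *)

Section real_measurability.
Context {R : realType} d (T : measurableType d).

Lemma measurable_set_lt (f g : T -> R) : measurable_fun setT f ->
  measurable_fun setT g -> measurable [set t | f t < g t].
Proof.
move=> mf mg; have := measurable_fun_ltr mf mg measurableT (Y := [set true]).
by rewrite setTI; apply.
Qed.

Lemma measurable_fun_set_lt (f : T -> R) :
  (forall r : R, measurable [set t | f t < r]) -> measurable_fun setT f.
Proof.
move=> mf; apply: (measurability (@RGenInftyO.G R)).
  exact: RGenInftyO.measurableE.
move=> _ [_ [r ->] <-]; rewrite setTI.
suff -> : f @^-1` `]-oo, r[ = [set t | f t < r] by exact: mf.
by apply/seteqP; split => t /=; rewrite in_itv.
Qed.

End real_measurability.

Section tree_measurability.
Context {R : realType}.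
Local Notation ts := (tree_space R).

(** [dGH] and [td] being equivalent, these are the sets of [GH_open]; for [td] the triangle
    inequality is at hand. *)
Definition td_open (U : set ts) : Prop :=
  forall a, U a -> exists2 e : R, 0 < e & forall b, td a b < e -> U b.

Lemma measurable_td_open (U : set ts) : td_open U -> measurable U.
Proof.
move=> oU; apply: sub_sigma_algebra => a /oU[e e0 eU].
exists (e / 2); first by rewrite divr_gt0.
by move=> b ab; apply: eU; have := td_le_dGH a b; lra.
Qed.

Lemma GH_open_td (U : set ts) : GH_open U -> td_open U.
Proof.
move=> oU a /oU[e e0 eU]; exists e => // b ab; apply: eU.
exact: le_lt_trans (dGH_le_td a b) ab.
Qed.

Lemma td_open_ball (a : ts) (e : R) : td_open [set b | td a b < e].
Proof.
move=> b /= ab; exists (e - td a b); first by rewrite subr_gt0.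
by move=> c bc; have := td_triangle b a c; lra.
Qed.

Lemma measurable_td_lt (a : ts) (e : R) : measurable [set b | td a b < e].
Proof. by apply: measurable_td_open; exact: td_open_ball. Qed.

Lemma measurable_height : measurable_fun setT (@height R).
Proof.
apply: measurable_fun_set_lt => r; apply: measurable_td_open => a /= ar.
exists (r - height a); first by rewrite subr_gt0.
by move=> b ab; have := height_lip b a; rewrite td_sym; lra.
Qed.

Section functions.
Context d (T : measurableType d).

Lemma measurable_fun_tree (f : T -> ts) :
  (forall U, td_open U -> measurable (f @^-1` U)) -> measurable_fun setT f.
Proof.
move=> H; apply: (@measurability _ _ T ts setT f (@GH_open R)); first exact: erefl.
by move=> _ [U oU <-]; rewrite setTI; apply: H; exact: GH_open_td.
Qed.

Lemma measurable_preimage_td_lt (f : T -> ts) a (e : R) : measurable_fun setT f ->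
  measurable [set t | td a (f t) < e].
Proof.
move=> mf; have := mf measurableT _ (measurable_td_lt a e).
by rewrite setTI.
Qed.

Lemma measurable_tree_limit (f : nat -> T -> ts) (g : T -> ts) :
  (forall n, measurable_fun setT (f n)) ->
  (forall t (e : R), 0 < e -> exists N, forall n, (N <= n)%N -> td (f n t) (g t) < e) ->
  measurable_fun setT g.
Proof.
move=> mf fg; apply: measurable_fun_tree => U oU.
(* Points of an open set may converge to its boundary, so [U] itself cannot be tested along the
   sequence. The closed sets [V k] of points whose ball of radius [rate k] stays in [U] exhaust it
   and leave the room needed. *)
pose V k : set ts := [set a | forall b, td a b < rate k -> U b].
have mV k : measurable (V k).
  rewrite -[V k]setCK; apply: measurableC; apply: measurable_td_open => a /=.
  move=> /existsNP[b /not_implyP[ab Ub]]; exists (rate k - td a b).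
    by rewrite subr_gt0.
  move=> c ac Vc; apply: Ub; apply: Vc.
  by have := td_triangle a c b; rewrite (td_sym c a); lra.
have -> : g @^-1` U = \bigcup_k \bigcup_N \bigcap_(n in [set n | (N <= n)%N]) (f n @^-1` V k).
  apply/seteqP; split => t /=.
    move=> Ug; have [e e0 eU] := oU _ Ug; have e2 : 0 < e / 2 by rewrite divr_gt0.
    have [k /(_ k (leqnn k)) ke] := rate_lt e2; have [N NP] := fg t _ e2.
    exists k => //; exists N => // n /= Nn b fb; apply: eU.
    by have := NP n Nn; have := td_triangle (f n t) (g t) b; rewrite (td_sym (g t) (f n t)); lra.
  move=> [k _ [N _ H]]; have [N' N'P] := fg t _ (@rate_gt0 R k).
  apply: (H (maxn N N')) => /=; first exact: leq_maxl.
  by apply: N'P; exact: leq_maxr.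
apply: bigcup_measurable => k _; apply: bigcup_measurable => N _.
apply: bigcap_measurableType => n _; rewrite -[_ @^-1` _]setTI.
exact: mf.
Qed.

(** A countable measurable partition, indexed by [u], on whose pieces any two points are related. It
    turns a uniform estimate on pairs, insensitive to the choice of representatives, into
    measurability by [csplit_measurable]. *)
Definition csplit (E : T -> T -> Prop) : Prop := exists u : T -> nat,
  (forall k, measurable (u @^-1` [set k])) /\ forall t t', u t = u t' -> E t t'.

Lemma csplit_impl (E E' : T -> T -> Prop) : (forall t t', E t t' -> E' t t') ->
  csplit E -> csplit E'.
Proof. by move=> EE' [u [mu uE]]; exists u; split => // t t' /uE/EE'. Qed.

Lemma csplit_cover (A : nat -> set T) (E : nat -> T -> T -> Prop) :
  (forall n, measurable (A n)) -> (forall t, exists n, A n t) ->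
  (forall n, csplit (E n)) ->
  csplit (fun t t' => exists n, [/\ A n t, A n t' & E n t t']).
Proof.
move=> mA cA cE; have [u uP] := choice cE.
have Ab t : exists n, `[< A n t >] by have [n An] := cA t; exists n; exact/asboolP.
(* The least index makes the cover disjoint; the final label pairs it with the label of the
   partition attached to that index. *)
pose m t := ex_minn (Ab t).
have mP t n : m t = n <-> A n t /\ forall k, (k < n)%N -> ~ A k t.
  rewrite /m; case: ex_minnP => j /asboolP Aj jmin; split.
    move=> <-; split => // k kj Ak; have := jmin k; rewrite leqNgt kj.
    by move=> /(_ (asboolT Ak)).
  move=> [An nmin]; apply/eqP; rewrite eqn_leq jmin /=; last exact/asboolP.
  by rewrite leqNgt; apply/negP => jn; exact: nmin jn Aj.
have mm n : measurable (m @^-1` [set n]).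
  have -> : m @^-1` [set n] = A n `&` \bigcap_(k in [set k | (k < n)%N]) ~` A k.
    apply/seteqP; split => t /=; first by move/mP => [An H]; split => // k /= /H.
    by move=> [An H]; apply/mP; split => // k kn; exact: H.
  by apply: measurableI => //; apply: bigcap_measurableType => k _; exact: measurableC.
exists (fun t => choice.pickle (m t, u (m t) t)); split.
  move=> k; case kE : (choice.unpickle k : option (nat * nat)) => [[a b]|].
    have -> : (fun t => choice.pickle (m t, u (m t) t)) @^-1` [set k] =
        if choice.pickle (a, b) == k then (m @^-1` [set a]) `&` (u a @^-1` [set b]) else set0.
      apply/seteqP; split => t /=.
        move=> E1; have : Some (m t, u (m t) t) = Some (a, b).
          by rewrite -kE -E1 choice.pickleK.
        by case=> ma ub; rewrite -ma in ub *; rewrite -ub E1 eqxx.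
      by case: eqP => // <- [/= <- <-].
    by case: eqP => // _; apply: measurableI => //; have [] := uP a.
  rewrite (_ : _ @^-1` _ = set0)//; apply/seteqP; split => // t /= E1.
  by move: kE; rewrite -E1 choice.pickleK.
move=> t t' /(pcan_inj choice.pickleK)[mm' uu]; exists (m t).
have [At _] := (mP t (m t)).1 erefl; have [At' _] := (mP t' (m t)).1 (esym mm').
by split => //; have [_] := uP (m t); apply; rewrite {2}mm'.
Qed.

Lemma csplit_true (E : T -> T -> Prop) : (forall t t', E t t') -> csplit E.
Proof.
move=> ET; exists (fun=> 0%N); split => // k.
have [->|k0] := eqVneq k 0%N.
  by rewrite (_ : _ @^-1` _ = setT)//; apply/seteqP; split.
rewrite (_ : _ @^-1` _ = set0)//; apply/seteqP; split => // t /= E0.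
by rewrite -E0 eqxx in k0.
Qed.

Lemma csplit_and (E E' : T -> T -> Prop) : csplit E -> csplit E' ->
  csplit (fun t t' => E t t' /\ E' t t').
Proof.
move=> [u [mu uE]] cE'.
have := @csplit_cover (fun n => u @^-1` [set n]) (fun=> E') mu _ (fun=> cE').
move=> /(_ (fun t => ex_intro _ (u t) erefl)); apply: csplit_impl.
by move=> t t' [n [/= ut ut' Et]]; split => //; apply: uE; rewrite ut.
Qed.

Lemma csplit_forall (E : nat -> T -> T -> Prop) n : (forall i, csplit (E i)) ->
  csplit (fun t t' => forall i, (i < n)%N -> E i t t').
Proof.
move=> cE; elim: n => [|n IH]; first exact: csplit_true.
apply: csplit_impl (csplit_and IH (cE n)) => t t' [H En] i.
by rewrite ltnS leq_eqVlt => /orP[/eqP ->//|/H].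
Qed.

Lemma csplit_real (g : T -> R) (e : R) : 0 < e -> measurable_fun setT g ->
  csplit (fun t t' => `|g t - g t'| <= e).
Proof.
move=> e0 mg; have e2 : 0 < e / 2 by rewrite divr_gt0.
pose c n : R := if choice.unpickle n is Some q then ratr (q : rat) else 0.
have := @csplit_cover (fun n => [set t | c n - e / 2 < g t] `&` [set t | g t < c n + e / 2])
  (fun _ _ _ => True) _ _ (fun=> csplit_true (fun _ _ => I)).
move=> H; apply: csplit_impl (H _ _).
- move=> t t' [n [[/= h1 h2] [h3 h4] _]]; rewrite ler_norml; lra.
- move=> n; apply: measurableI; exact: measurable_set_lt.
- move=> t; have tt' : g t - e / 2 < g t + e / 2 by lra.
  have [q] := rat_in_itvoo tt'; rewrite in_itv /= => /andP[q1 q2].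
  by exists (choice.pickle q); rewrite /c choice.pickleK; split => /=; lra.
Qed.

Lemma csplit_tree (f : T -> ts) (e : R) : 0 < e -> measurable_fun setT f ->
  csplit (fun t t' => td (f t) (f t') < e).
Proof.
move=> e0 mf; have e2 : 0 < e / 2 by rewrite divr_gt0.
have [s sP] := @tree_space_separable R.
have := @csplit_cover (fun n => [set t | td (s n) (f t) < e / 2])
  (fun _ _ _ => True) _ _ (fun=> csplit_true (fun _ _ => I)).
move=> H; apply: csplit_impl (H _ _).
- move=> t t' [n [/= h1 h2 _]]; have := td_triangle (s n) (f t) (f t').
  by rewrite (td_sym (f t) (s n)); lra.
- by move=> n; exact: measurable_preimage_td_lt.
- by move=> t; have [n] := sP (f t) _ e2; exists n => /=; rewrite td_sym.
Qed.

(** Replacing [f] on each piece by its value at one chosen point gives countably valued measurable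
    functions that converge uniformly to [f]. *)
Lemma csplit_measurable (f : T -> ts) :
  (forall e : R, 0 < e -> csplit (fun t t' => td (f t) (f t') < e)) ->
  measurable_fun setT f.
Proof.
move=> H; have [u uP] := choice (fun n => H _ (@rate_gt0 R n)).
pose h n k := if pselect (exists t, u n t = k) is left E then f (sval (cid E)) else point.
apply: (@measurable_tree_limit (fun n t => h n (u n t))).
  move=> n _ A mA; rewrite setTI.
  have -> : (fun t => h n (u n t)) @^-1` A =
      \bigcup_(k in [set k | A (h n k)]) (u n @^-1` [set k]).
    by apply/seteqP; split => t /=; [exists (u n t)|move=> [k /= hk ->]].
  by apply: bigcup_measurable => k _; have [] := uP n.
move=> t e e0; have [N NP] := rate_lt e0; exists N => n Nn.
apply: lt_trans (NP n Nn); rewrite /h; case: pselect => [E|[]]; last by exists t.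
by have [_] := uP n; apply; rewrite (svalP (cid E)).
Qed.

(** Scaling is uniformly continuous only where the factor and the height stay bounded: on the piece
    where both are below [n.+1], the mesh [w n] keeps each of the two error terms on heights under
    [e / 2]. *)
Lemma csplit_tcorr (a : T -> R) (f : T -> ts) (e : R) : 0 < e ->
  (forall t, 0 <= a t) -> measurable_fun setT a -> measurable_fun setT f ->
  csplit (fun t t' => tcorr (a t) (repr (f t)) (a t') (repr (f t')) e).
Proof.
move=> e0 a0 ma mf.
have e2 : 0 < e / 2 by rewrite divr_gt0.
have n0 n : 0 < n.+1%:R :> R by [].
pose w n : R := e / 2 / n.+1%:R.
have w0 n : 0 < w n by rewrite /w divr_gt0.
have := @csplit_cover (fun n => [set t | a t < n.+1%:R] `&` [set t | height (f t) < n.+1%:R])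
  (fun n t t' => td (f t) (f t') < w n /\ `|a t - a t'| <= w n).
move=> H; apply: csplit_impl (H _ _ _); last first.
- by move=> n; apply: csplit_and; [exact: csplit_tree|exact: csplit_real].
- move=> t; exists (Num.truncn (Num.max (a t) (height (f t)))).
  by split => /=; apply: le_lt_trans (truncnS_gt _); rewrite le_max lexx ?orbT.
- move=> n; apply: measurableI; apply: measurable_set_lt => //.
  by apply: measurableT_comp => //; exact: measurable_height.
move=> t t' [n [[/= at_ ht] [at' ht'] [/td_lt[C [C1 C2 C0 Cd Ch]] aa]]].
have wE : w n * n.+1%:R = e / 2 by rewrite /w divfK// gt_eqF.
move: (n.+1%:R : R) (n0 n) wE at_ ht at' ht' => N N0 wE at_ ht at' ht'.
have b1 : a t * w n <= e / 2 by rewrite -wE mulrC ler_wpM2l// ltW.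
have b2 (y : repr (f t')) : `|a t - a t'| * mdist (root (repr (f t'))) y <= e / 2.
  rewrite -wE; apply: ler_pM => //; first exact: mdist_ge0.
  by apply: le_trans (ltW ht'); exact: mdist_height.
exists C; split => //.
- move=> x y x' y' xy xy'; have := Cd _ _ _ _ xy xy'; rewrite !mul1r => h.
  have -> : a t * mdist x x' - a t' * mdist y y' =
    a t * (mdist x x' - mdist y y') + (a t - a t') * mdist y y' by lra.
  apply: le_trans (ler_normD _ _) _; rewrite !normrM (ger0_norm (a0 t)).
  rewrite (ger0_norm (mdist_ge0 _ _)).
  have h1 : a t * `|mdist x x' - mdist y y'| <= a t * (2 * w n) by exact: ler_wpM2l.
  have h2 : `|a t - a t'| * mdist y y' <= `|a t - a t'| *
     (mdist (root (repr (f t'))) y + mdist (root (repr (f t'))) y').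
    apply: ler_wpM2l => //; apply: le_trans (metric_triangle _ (root (repr (f t'))) _) _.
    by rewrite (metric_sym y).
  by have := b2 y; have := b2 y'; lra.
- move=> x y xy; have := Ch _ _ xy; rewrite !mul1r => h.
  set u := mdist _ x in h *; set v := mdist _ y in h *.
  have -> : a t * u - a t' * v = a t * (u - v) + (a t - a t') * v by lra.
  apply: le_trans (ler_normD _ _) _; rewrite !normrM (ger0_norm (a0 t)).
  rewrite (ger0_norm (mdist_ge0 _ _)).
  have h1 : a t * `|u - v| <= a t * w n by exact: ler_wpM2l.
  by have := b2 y; rewrite -/v; lra.
Qed.

End functions.
End tree_measurability.

(** * Truncation of a graft to finitely many branches *)

Section prune.
Context {R : realType}.
Variables (beta l : R) (x p : nat -> R) (tau : nat -> tree_space R) (N : nat).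
Hypotheses (beta_gt0 : 0 < beta) (l0 : 0 <= l) (xl : forall i, 0 <= x i <= l).

(** A weight 0 collapses a branch to its attachment point since [beta] is positive, so grafts of
    pruned data can be compared through their first [N] branches only. *)
Definition prune (y : nat -> R) (i : nat) : R := if (i < N)%N then y i else 0.

Let x' := prune x.
Let p' := prune p.

Lemma prune_itv i : 0 <= x' i <= l.
Proof. by rewrite /x' /prune; case: ifP => // _; rewrite lexx l0. Qed.

Lemma prune_good : graft_good beta p' tau.
Proof.
move=> e e0; exists N => n Nn; rewrite /p' /prune ltnNge Nn /=.
by rewrite powR0 ?gt_eqF// mul0r.
Qed.

(** Points of the segment and of the branches from [N] on are related to all such points with the
    same position, at the cost [e] of their heights; points of the first [N] branches are related to
    themselves. *)
Lemma prune_corr (e : R) : 0 <= e ->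
  (forall i, (N <= i)%N -> p i `^ beta * height (tau i) <= e) ->
  corr (@graft_dist R beta l x p tau) (@graft_dist R beta l x' p' tau)
    (graft_origin tau l0) (graft_origin tau l0) e.
Proof.
move=> e0 small_e.
pose small (u : graft_union l tau) := if u is inr v then (N <= tag v)%N else true.
pose rel u v := (small u /\ small v /\ graft_pos x u = graft_pos x' v) \/ (~~ small u /\ u = v).
have hs u : small u -> 0 <= graft_height beta p u <= e.
  move=> su; rewrite graft_height_ge0/=; case: u su => [b|[i y]] //= Ni.
  apply: le_trans (small_e i Ni); rewrite /branch_height /=.
  by rewrite ler_wpM2l ?powR_ge0// mdist_height.
have hs' u : small u -> graft_height beta p' u = 0.
  case: u => [b|[i y]] //= Ni; rewrite /branch_height /= /p' /prune ltnNge Ni /=.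
  by rewrite powR0 ?gt_eqF// mul0r.
have hb u : ~~ small u -> graft_height beta p' u = graft_height beta p u /\
    graft_pos x' u = graft_pos x u.
  case: u => [b|[i y]] //=; rewrite -ltnNge => iN.
  by rewrite /branch_height /= /x' /p' /prune iN.
have d_small u w : small u -> small w ->
    `|graft_dist beta x p u w - `|graft_pos x u - graft_pos x w| | <= 2 * e.
  move=> su sw; have [same|diff] := boolP (same_branch u w).
    rewrite (same_branch_pos _ same) subrr normr0 subr0.
    have [i [y [z [Eu Ew]]]] := same_branchP same.
    have := hs u su; have := hs w sw; rewrite Eu Ew graft_dist_same.
    rewrite /= /branch_height /= => /andP[_ h1] /andP[_ h2].
    rewrite ger0_norm ?mulr_ge0 ?powR_ge0 ?mdist_ge0//.
    have : p i `^ beta * mdist y z <= p i `^ beta * (mdist (root (repr (tau i))) y +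
        mdist (root (repr (tau i))) z).
      apply: ler_wpM2l; first exact: powR_ge0.
      apply: le_trans (metric_triangle _ (root (repr (tau i))) _) _.
      by rewrite (metric_sym y).
    by lra.
  rewrite graft_dist_diff//; have := hs u su; have := hs w sw.
  by rewrite ler_norml; lra.
have d_small' u w : small u -> small w ->
    graft_dist beta x' p' u w = `|graft_pos x' u - graft_pos x' w|.
  move=> su sw; have [same|diff] := boolP (same_branch u w).
    rewrite (same_branch_pos _ same) subrr normr0.
    have [i [y [z [Eu Ew]]]] := same_branchP same; rewrite Eu Ew graft_dist_same.
    move: su; rewrite Eu /= /p' /prune ltnNge => -> /=.
    by rewrite powR0 ?gt_eqF// mul0r.
  by rewrite graft_dist_diff// !hs'// add0r addr0.
have diff_small u w : ~~ small u -> small w -> ~~ same_branch u w.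
  move=> su sw; apply/negP => /same_branchP[i [y [z [Eu Ew]]]].
  by move: su sw; rewrite Eu Ew /= => /negbTE ->.
have same_sym (u w : graft_union l tau) : same_branch u w = same_branch w u.
  by case: u w => [?|?] [?|?] //=; rewrite eq_sym.
exists rel; split.
- move=> u; have [su|su] := boolP (small u); last by exists u; right.
  have uI : graft_pos x u \in `[0, l].
    rewrite in_itv /=; case: u su => [[b bI]|v] _ /=; last exact: xl.
    by rewrite in_itv in bI.
  by exists (inl (exist _ (graft_pos x u) uI)); left.
- move=> u; have [su|su] := boolP (small u); last by exists u; right.
  have uI : graft_pos x' u \in `[0, l].
    rewrite in_itv /=; case: u su => [[b bI]|v] _ /=; last exact: prune_itv.
    by rewrite in_itv in bI.
  by exists (inl (exist _ (graft_pos x' u) uI)); left.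
- by left.
- move=> u v w z [[su [sv puv]]|[bu <-]] [[sw [sz pwz]]|[bw <-]].
  + by rewrite d_small'// -puv -pwz; exact: d_small.
  + rewrite !graft_dist_diff; try by rewrite same_sym diff_small.
    have [-> ->] := hb w bw; rewrite (hs' v sv) puv.
    by have := hs u su; rewrite ler_norml; lra.
  + rewrite !graft_dist_diff ?diff_small//.
    have [-> ->] := hb u bu; rewrite (hs' z sz) pwz.
    by have := hs w sw; rewrite ler_norml; lra.
  + have [same|diff] := boolP (same_branch u w).
      have [i [y [y' [Eu Ew]]]] := same_branchP same.
      rewrite Eu Ew !graft_dist_same; move: bu; rewrite Eu /= -ltnNge => iN.
      by rewrite /p' /prune iN subrr normr0; lra.
    rewrite !graft_dist_diff//; have [-> ->] := hb u bu; have [-> ->] := hb w bw.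
    by rewrite subrr normr0; lra.
- move=> u v uv; rewrite !graft_dist_origin//; last exact: prune_itv.
  case: uv => [[su [sv ->]]|[bu <-]].
    by have := hs u su; rewrite (hs' v sv) ler_norml; lra.
  by have [-> ->] := hb u bu; rewrite subrr normr0.
Qed.

Lemma td_prune (e : R) : (forall i, 0 <= p i) -> graft_good beta p tau -> 0 <= e ->
  (forall i, (N <= i)%N -> p i `^ beta * height (tau i) <= e) ->
  td (graft beta l x' p' tau) (graft beta l x p tau) <= e.
Proof.
move=> p0 good e0 small_e; apply: td_le.
have c1 := corr_sym (graft_tcorr l0 prune_itv prune_good).
have c3 := graft_tcorr l0 xl good.
have := corr_trans (corr_trans c1 (corr_sym (prune_corr e0 small_e))) c3.
by rewrite add0r addr0.
Qed.

End prune.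

Section measurable_graft.
Context {R : realType} d (T : measurableType d).
Local Notation ts := (tree_space R).

Lemma measurable_td (f g : T -> ts) : measurable_fun setT f -> measurable_fun setT g ->
  measurable_fun setT (fun t => td (f t) (g t)).
Proof.
move=> mf mg; have [s sP] := @tree_space_separable R.
have ms (h : T -> ts) k : measurable_fun setT h -> measurable_fun setT (fun t => td (s k) (h t)).
  by move=> mh; apply: measurable_fun_set_lt => r; exact: measurable_preimage_td_lt.
apply: measurable_fun_set_lt => r.
have -> : [set t | td (f t) (g t) < r] =
    \bigcup_k [set t | td (s k) (f t) + td (s k) (g t) < r].
  apply/seteqP; split => t /=; last first.
    move=> [k _ /=]; have := td_triangle (s k) (f t) (g t).
    by rewrite (td_sym (f t) (s k)); lra.
  move=> tr; have e0 : 0 < (r - td (f t) (g t)) / 2 by rewrite divr_gt0// subr_gt0.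
  have [k fk] := sP (f t) _ e0; exists k => //=; rewrite (td_sym _ (f t)).
  by have := td_triangle (f t) (s k) (g t); rewrite (td_sym (s k) (f t)); lra.
apply: bigcup_measurable => k _; apply: measurable_set_lt => //.
by apply: measurable_funD; exact: ms.
Qed.

Variables (beta : R) (L : T -> R) (X P : nat -> T -> R) (tau : nat -> T -> ts).
Hypotheses (beta_gt0 : 0 < beta) (L0 : forall t, 0 <= L t).
Hypotheses (XL : forall i t, 0 <= X i t <= L t) (P0 : forall i t, 0 <= P i t).
Hypotheses (mL : measurable_fun setT L) (mX : forall i, measurable_fun setT (X i)).
Hypotheses (mP : forall i, measurable_fun setT (P i)).
Hypotheses (mtau : forall i, measurable_fun setT (tau i)).

Let good t := graft_good beta (P^~ t) (tau^~ t).

Lemma measurable_scaled_height i :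
  measurable_fun setT (fun t => P i t `^ beta * height (tau i t)).
Proof.
apply: measurable_funM.
  by apply: (measurableT_comp (measurable_powR _)).
by apply: measurableT_comp => //; exact: measurable_height.
Qed.

Lemma measurable_graft_good : measurable [set t | good t].
Proof.
have -> : [set t | good t] = \bigcap_k \bigcup_N \bigcap_(n in [set n | (N <= n)%N])
    [set t | P n t `^ beta * height (tau n t) < rate k].
  apply/seteqP; split => t /=.
    by move=> g k _; have [N NP] := g _ (@rate_gt0 R k); exists N.
  move=> H e e0; have [k /(_ k (leqnn k)) ke] := rate_lt e0.
  have [N _ NP] := H k Logic.I; exists N => n Nn.
  exact: lt_trans (NP n Nn) ke.
apply: bigcapT_measurable => k; apply: bigcup_measurable => N _.
apply: bigcap_measurableType => n _; apply: measurable_set_lt => //.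
exact: measurable_scaled_height.
Qed.

Let F N t := graft beta (L t) (prune N (X^~ t)) (prune N (P^~ t)) (tau^~ t).

(** With finitely many branches, splitting the length, the positions and the scaled trees to
    precision [e / 3] makes two grafts differ by at most two thirds of [e]. *)
Let mF N : measurable_fun setT (F N).
Proof.
apply: csplit_measurable => e e0.
have e3 : 0 < e / 3 by rewrite divr_gt0.
apply: csplit_impl (csplit_and (csplit_real e3 mL) (csplit_and
  (csplit_forall N (fun i => csplit_real e3 (mX i)))
  (csplit_forall N (fun i => csplit_tcorr e3 (fun t => powR_ge0 (P i t) beta)
    (measurableT_comp (measurable_powR beta) (mP i)) (mtau i))))).
move=> t t' [hL [hX hT]].
apply: (@le_lt_trans _ _ (e / 3 + e / 3)); last lra.
apply: graft_td_le => //; try exact: ltW.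
- by move=> i; exact: prune_itv.
- by move=> i; exact: prune_itv.
- exact: prune_good.
- exact: prune_good.
- by move=> i; rewrite /prune; case: ifP => [/hX//|_]; rewrite subrr normr0 ltW.
- move=> i; rewrite /prune; case: ifP => [/hT//|_]; rewrite powR0 ?gt_eqF//.
  by apply: corr_bound; do ?[exact: pseudodist_scale (lexx 0) (pseudodist_mdist _)];
    move=> y; rewrite mul0r ltW.
Qed.

Lemma measurable_graft : measurable_fun setT
  (fun t => graft beta (L t) (X^~ t) (P^~ t) (tau^~ t)).
Proof.
pose pt := \pi_(tree_space R) (one_point_tree R).
(* Off the good event the graft is the default tree; on it, pruning converges because the heights of
   the removed branches tend to 0. *)
apply: (@measurable_tree_limit R _ T (fun N t => if t \in [set t | good t] then F N t else pt)).
  move=> N; apply: measurable_fun_ifT => //.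
  apply: (measurable_fun_bool true); rewrite setTI.
  rewrite (_ : _ @^-1` _ = [set t | good t]); first exact: measurable_graft_good.
  by apply/seteqP; split => t; [move=> /set_mem|move=> /mem_set].
move=> t e e0; have e2 : 0 < e / 2 by rewrite divr_gt0.
have [gt|ngt] := pselect (good t); last first.
  exists 0%N => n _; rewrite memNset//= /pt graft_bad//.
  by rewrite tdxx.
have [N NP] := gt _ e2; exists N => n Nn; rewrite mem_set//.
apply: (@le_lt_trans _ _ (e / 2)); last lra.
apply: td_prune => //; first exact: ltW.
by move=> i ni; apply/ltW/NP; exact: leq_trans ni.
Qed.

End measurable_graft.

(** * Infinite products of probability spaces *)

Lemma nneseries_ge_term (R : realType) (u : nat -> \bar R) k :
  (forall i, 0 <= u i)%E -> (u k <= \sum_(i <oo) u i)%E.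
Proof.
move=> u0; rewrite (nneseriesD1 (n := k))//.
by rewrite leeDl// nneseries_ge0.
Qed.

Definition seqspace (E : Type) : Type := nat -> E.

HB.instance Definition _ (E : Type) := gen_eqMixin (seqspace E).
HB.instance Definition _ (E : Type) := gen_choiceMixin (seqspace E).
HB.instance Definition _ (E : pointedType) :=
  isPointed.Build (seqspace E) (fun=> point).

Definition cylinders d (E : measurableType d) : set (set (seqspace E)) :=
  [set A | exists i B, measurable B /\ A = [set x | B (x i)]].

HB.instance Definition _ d (E : measurableType d) :=
  Measurable.copy (seqspace E) (g_sigma_algebraType (@cylinders d E)).

(* The same sequences with every set measurable, so that covers by arbitrary
   sets can be fed to [mu_ext]. *)
Definition discrete_seqspace (E : Type) : Type := nat -> E.

HB.instance Definition _ (E : Type) := gen_eqMixin (discrete_seqspace E).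
HB.instance Definition _ (E : Type) := gen_choiceMixin (discrete_seqspace E).
HB.instance Definition _ (E : pointedType) :=
  isPointed.Build (discrete_seqspace E) (fun=> point).
HB.instance Definition _ (E : pointedType) := @isMeasurable.Build default_measure_display
  (discrete_seqspace E) discrete_measurable discrete_measurable0
  discrete_measurableC discrete_measurableU.

Section infinite_product.
Context d (E : measurableType d) (R : realType) (P : probability E R).
Local Open Scope ereal_scope.

Let p (B : set E) : R := fine (P B).

Let pE B : measurable B -> P B = (p B)%:E.
Proof. by move=> mB; rewrite /p fineK// fin_num_measure. Qed.

Let p_ge0 B : (0 <= p B)%R. Proof. by rewrite fine_ge0// measure_ge0. Qed.

Let pT : p setT = 1%R. Proof. by rewrite /p probability_setT. Qed.

Record box := Box {
  box_dim : nat;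
  box_side :> nat -> set E;
  box_measurable : forall i, measurable (box_side i);
  box_setT : forall i, (box_dim <= i)%N -> box_side i = setT }.

Definition box_set (b : box) : set (nat -> E) := [set x | forall i, b i (x i)].

Definition box_volume (b : box) : R := (\prod_(i < box_dim b) p (b i))%R.

Lemma box_volumeE (b : box) m : (box_dim b <= m)%N ->
  box_volume b = (\prod_(i < m) p (b i))%R.
Proof.
move=> bm; rewrite /box_volume -!(big_mkord xpredT (fun i => p (b i))).
rewrite [RHS](@big_cat_nat _ _ _ (box_dim b))//= [X in (_ * X)%R]big1_seq ?mulr1// => i.
by rewrite mem_index_iota => /andP[_ /andP[bi _]]; rewrite box_setT.
Qed.

Let update (x : nat -> E) n y : nat -> E := fun i => if i == n then y else x i.

(* The conditional volume of a box given the first [n] coordinates of [x]. *)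
Let cond (b : box) n (x : nat -> E) : R :=
  (\prod_(i < box_dim b) if (i < n)%N then \1_(b i) (x i) else p (b i))%R.

Let cond_ge0 b n x : (0 <= cond b n x)%R.
Proof. by apply: prodr_ge0 => i _; case: ifP => _ //; exact: p_ge0. Qed.

(** [c] collects the other coordinates. The formula gives measurability in the coordinate [n] and
    the martingale identity: averaging the next conditional volume over it gives the current one. *)
Let cond_update b n x : exists2 c : R, (0 <= c)%R &
  (forall y, cond b n.+1 (update x n y) = c * \1_(b n) y)%R /\
  (cond b n x = c * p (b n))%R.
Proof.
have [nb|bn] := ltnP n (box_dim b); last first.
  exists (cond b n x); first exact: cond_ge0.
  rewrite (box_setT bn) pT mulr1; split => // y; rewrite indicT mulr1.
  apply: eq_bigr => i _; have ib := leq_trans (ltn_ord i) bn.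
  by rewrite ltnS ltnW// ib /update ltn_eqF.
pose j := Ordinal nb.
exists (\prod_(i < box_dim b | i != j) if (i < n)%N then \1_(b i) (x i) else p (b i))%R.
  by apply: prodr_ge0 => i _; case: ifP => _ //; exact: p_ge0.
split=> [y|]; rewrite /cond (bigD1 j)//= mulrC; last by rewrite ltnn.
rewrite ltnSn /update eqxx; congr (_ * _)%R; apply: eq_bigr => i ij.
have ni : nat_of_ord i != n by [].
by rewrite (negbTE ni) ltnS leq_eqVlt (negbTE ni).
Qed.

Let cond_eq b n x y : (forall i, (i < n)%N -> x i = y i) -> cond b n x = cond b n y.
Proof. by move=> xy; apply: eq_bigr => i _; case: ifP => // /xy ->. Qed.

Let cond_full b n x : (box_dim b <= n)%N -> cond b n x = \1_(box_set b) x.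
Proof.
move=> bn; rewrite /cond indicE.
have -> : (\prod_(i < box_dim b) (if (i < n)%N then \1_(b i) (x i) else p (b i)) =
    \prod_(i < box_dim b) \1_(b i) (x i) :> R)%R.
  by apply: eq_bigr => i _; rewrite (leq_trans (ltn_ord i) bn).
have [xb|/negP xb] := boolP (x \in box_set b).
  by rewrite big1// => i _; rewrite indicE mem_set//; move: xb; rewrite inE; apply.
have [i bi] : exists i, ~ b i (x i).
  by apply/existsNP => H; apply: xb; rewrite inE.
have ib : (i < box_dim b)%N.
  by rewrite ltnNge; apply/negP => /box_setT bT; apply: bi; rewrite bT.
by rewrite (bigD1 (Ordinal ib))//= indicE memNset// mul0r.
Qed.

(** Suppose the cover had total volume less than that of [b]. Averaging conditional volumes over the
    next coordinate keeps the strict inequality, so some value of that coordinate keeps it too. The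
    sequence built in this way lies in [b] but in no [c k]. *)
Lemma box_cover (b : box) (c : nat -> box) :
  box_set b `<=` \bigcup_k box_set (c k) ->
  (box_volume b)%:E <= \sum_(k <oo) (box_volume (c k))%:E.
Proof.
move=> bc; rewrite leNgt; apply/negP => lt0.
pose W n x := \sum_(k <oo) (cond (c k) n x)%:E.
have mc b' n x : measurable_fun setT (fun y => (cond b' n.+1 (update x n y))%:E).
  have [w w0 [wE _]] := cond_update b' n x.
  rewrite (_ : (fun y => _) = (fun y => (w * \1_(b' n) y)%:E)); last first.
    by apply/funext => y; rewrite wE.
  apply/measurable_EFinP; apply: measurable_funM => //.
  by apply: measurable_indic; exact: box_measurable.
have ic b' n x : \int[P]_y (cond b' n.+1 (update x n y))%:E = (cond b' n x)%:E.
  have [w w0 [wE ->]] := cond_update b' n x.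
  under eq_integral do rewrite wE EFinM.
  rewrite ge0_integralZl_EFin//; last first.
    by apply/measurable_EFinP; apply: measurable_indic; exact: box_measurable.
  rewrite integral_indic//; last exact: box_measurable.
  by rewrite setIT EFinM; congr (_ * _); apply: pE; exact: box_measurable.
have iW n x : \int[P]_y W n.+1 (update x n y) = W n x.
  rewrite integral_nneseries//; last first.
    by move=> k y _; rewrite lee_fin; exact: cond_ge0.
  by apply: eq_eseriesr => k _; exact: ic.
have mW n x : measurable_fun setT (fun y => W n.+1 (update x n y)).
  by apply: ge0_emeasurable_sum => // k y _ _; rewrite lee_fin; exact: cond_ge0.
have step n x : W n x < (cond b n x)%:E ->
    {y | W n.+1 (update x n y) < (cond b n.+1 (update x n y))%:E}.
  move=> Wx; apply: cid; apply: contrapT => /forallNP H.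
  move: Wx; rewrite -iW -ic ltNge => /negP; apply.
  apply: ge0_le_integral => //.
  - by move=> y _; rewrite lee_fin; exact: cond_ge0.
  - by move=> y _; rewrite leNgt; apply/negP; exact: H.
pose S n := {x | W n x < (cond b n x)%:E}.
have S0 : S 0%N.
  exists point; have c0 b' : cond b' 0 point = box_volume b' by [].
  rewrite c0 /W; rewrite (_ : (fun n => _) = (fun n => \sum_(0 <= i < n) (box_volume (c i))%:E))//.
pose next n (x : S n) : S n.+1 :=
  exist _ (update (sval x) n (sval (step n (sval x) (svalP x))))
          (svalP (step n (sval x) (svalP x))).
pose X := nat_rect S S0 next.
pose x i := sval (X i.+1) i.
have Xx n i : (i < n)%N -> sval (X n) i = x i.
  elim: n => // n IH; rewrite ltnS leq_eqVlt => /orP[/eqP ->//|ni].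
  by rewrite -IH//= /update ltn_eqF.
have Wx n : W n x < (cond b n x)%:E.
  have := svalP (X n); rewrite /= (cond_eq b (Xx n)) /W.
  by under eq_eseriesr do rewrite (cond_eq _ (Xx n)).
have Wge n k : (cond (c k) n x)%:E <= W n x.
  by apply: (nneseries_ge_term (u := fun k => _%:E)) => i; rewrite lee_fin; exact: cond_ge0.
have bx : box_set b x.
  apply: contrapT => nbx; have := Wx (box_dim b).
  rewrite cond_full// indicE memNset// ltNge => /negP; apply.
  by apply: nneseries_ge0 => i _ _; rewrite lee_fin; exact: cond_ge0.
have [k _ ckx] := bc _ bx.
(* Past both dimensions the two conditional volumes are indicators equal to 1, against the strict
   inequality. *)
have := Wx (maxn (box_dim b) (box_dim (c k))); rewrite ltNge => /negP; apply.
apply: le_trans (Wge _ k); rewrite !cond_full ?leq_maxl ?leq_maxr//.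
by rewrite !indicE !mem_set.
Qed.

(** Infinite outside boxes, so that only covers by boxes matter in the outer measure. *)
Let volume (A : set (discrete_seqspace E)) : \bar R :=
  if pselect (exists b, A = box_set b) is left h then (box_volume (sval (cid h)))%:E
  else +oo.

Lemma box_volume_ge0 b : (0 <= box_volume b)%R.
Proof. by apply: prodr_ge0 => i _; exact: p_ge0. Qed.

Let empty_side (i : nat) : set E := if i == 0%N then set0 else setT.

Let empty_measurable i : measurable (empty_side i).
Proof. by rewrite /empty_side; case: ifP. Qed.

Let empty_setT i : (1 <= i)%N -> empty_side i = setT.
Proof. by case: i. Qed.

Let empty_box := Box empty_measurable empty_setT.

Let empty_volume : box_volume empty_box = 0%R.
Proof. by rewrite /box_volume big_ord1 /= /empty_side /= /p measure0. Qed.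

Let empty_set : box_set empty_box = set0.
Proof. by apply/seteqP; split => // x /(_ 0%N). Qed.

Lemma le_box_volume (b c : box) : box_set b `<=` box_set c ->
  (box_volume b <= box_volume c)%R.
Proof.
move=> bc; rewrite -lee_fin.
have := @box_cover b (fun k => if k is 0%N then c else empty_box).
rewrite (nneseriesD1 (n := 0%N))//=; last by move=> k _; rewrite lee_fin box_volume_ge0.
rewrite eseries0 ?adde0; last by move=> [|k] //= _ _; rewrite empty_volume.
by apply; move=> x /bc cx; exists 0%N.
Qed.

Let volumeE (b : box) : volume (box_set b) = (box_volume b)%:E.
Proof.
rewrite /volume; case: pselect => [h|[]]; last by exists b.
have /esym E1 := svalP (cid h); congr (_%:E); apply/eqP.
by rewrite eq_le !le_box_volume//; rewrite E1.
Qed.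

Let volume0 : volume set0 = 0.
Proof. by rewrite -empty_set volumeE empty_volume. Qed.

Let volume_ge0 A : 0 <= volume A.
Proof.
by rewrite /volume; case: pselect => // h; rewrite lee_fin box_volume_ge0.
Qed.

Definition outer_product (A : set (seqspace E)) : \bar R :=
  mu_ext (T := discrete_seqspace E) volume A.

HB.instance Definition _ := isOuterMeasure.Build R (seqspace E) outer_product
  (mu_ext0 volume0 volume_ge0) (mu_ext_ge0 volume_ge0) (le_mu_ext volume)
  (mu_ext_sigma_subadditive volume_ge0).

Let outer_le_boxes (A : set (seqspace E)) (c : nat -> box) :
  A `<=` \bigcup_k box_set (c k) -> outer_product A <= \sum_(k <oo) (box_volume (c k))%:E.
Proof.
move=> Ac; apply: ereal_inf_lbound; exists (fun k => box_set (c k)) => //.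
by apply: eq_eseriesr => k _; exact: volumeE.
Qed.

Let le_outer (A : set (seqspace E)) (v : \bar R) :
  (forall c : nat -> box, A `<=` \bigcup_k box_set (c k) ->
     v <= \sum_(k <oo) (box_volume (c k))%:E) -> v <= outer_product A.
Proof.
move=> H; apply: le_ereal_inf_tmp => _ [B [_ AB] <-].
have [[k Bk]|allbox] := pselect (exists k, ~ exists b, B k = box_set b).
  rewrite (_ : (\sum_(_ <oo) _) = +oo) ?leey//.
  apply/eqP; rewrite -leye_eq; apply: le_trans (nneseries_ge_term k (fun i => volume_ge0 (B i))).
  by rewrite /volume; case: pselect.
have /choice[c cB] : forall k, exists b, B k = box_set b.
  by move=> k; apply: contrapT => nb; apply: allbox; exists k.
have := H c; rewrite (eq_eseriesr (g := volume \o B)); last first.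
  by move=> k _ /=; rewrite cB volumeE.
by apply; move=> x /AB[k _]; rewrite cB => ?; exists k.
Qed.

Lemma outer_product_box (b : box) : outer_product (box_set b) = (box_volume b)%:E.
Proof.
apply/eqP; rewrite eq_le; apply/andP; split; last first.
  by apply: le_outer => c; exact: box_cover.
have bc : box_set b `<=` \bigcup_k box_set (if k is 0%N then b else empty_box).
  by move=> x bx; exists 0%N.
apply: le_trans (outer_le_boxes bc) _.
rewrite (nneseriesD1 (n := 0%N))//=; last by move=> k _; rewrite lee_fin box_volume_ge0.
by rewrite eseries0 ?adde0// => -[|k] //= _ _; rewrite empty_volume.
Qed.

Section cut.
Variables (b : box) (j : nat) (B : set E) (mB : measurable B).

Let cut_side i := if i == j then b i `&` B else b i.

Let cut_measurable i : measurable (cut_side i).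
Proof.
rewrite /cut_side; case: ifP => _; last exact: box_measurable.
by apply: measurableI => //; exact: box_measurable.
Qed.

Let cut_setT i : (maxn (box_dim b) j.+1 <= i)%N -> cut_side i = setT.
Proof. by rewrite geq_max => /andP[bi ji]; rewrite /cut_side gtn_eqF// box_setT. Qed.

Definition cut := Box cut_measurable cut_setT.

Lemma cut_set : box_set cut = box_set b `&` [set x | B (x j)].
Proof.
apply/seteqP; split => x.
  move=> H; split => [i|].
    by have := H i; rewrite /= /cut_side; case: ifP => // _ [].
  by have := H j; rewrite /= /cut_side eqxx => -[].
by move=> [H1 H2] i; rewrite /= /cut_side; case: eqP => // ->; split.
Qed.

Lemma cut_volume : box_volume cut =
  (p (b j `&` B) * \prod_(i < maxn (box_dim b) j.+1 | i != j :> nat) p (b i))%R.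
Proof.
have jm : (j < maxn (box_dim b) j.+1)%N by rewrite leq_max ltnSn orbT.
rewrite /box_volume (bigD1 (Ordinal jm))//= /cut_side eqxx; congr (_ * _)%R.
apply: eq_big => // i ij; have {}ij : nat_of_ord i != j := ij.
by rewrite (negbTE ij).
Qed.

End cut.

Lemma cut_split (b : box) j (B : set E) (mB : measurable B) :
  (box_volume (cut b j mB) + box_volume (cut b j (measurableC mB)) = box_volume b)%R.
Proof.
rewrite !cut_volume -mulrDl.
have -> : (p (b j `&` B) + p (b j `&` ~` B) = p (b j))%R.
  have mb := box_measurable b j.
  have m1 : measurable (b j `&` B) by exact: measurableI.
  have m2 : measurable (b j `&` ~` B) by apply: measurableI => //; exact: measurableC.
  apply: EFin_inj; rewrite EFinD -!pE// -measureU//.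
    by rewrite -setIUr setUv setIT.
  by rewrite setIACA setICr setI0.
have jm : (j < maxn (box_dim b) j.+1)%N by rewrite leq_max ltnSn orbT.
rewrite (box_volumeE (m := maxn (box_dim b) j.+1)) ?leq_maxl//.
by rewrite [RHS](bigD1 (Ordinal jm)).
Qed.

(** Cutting every box of a cover along the cylinder preserves the total volume, so the outer measure
    of any set splits along it. *)
Lemma cylinder_caratheodory (A : set (seqspace E)) : cylinders A ->
  outer_product.-caratheodory A.
Proof.
move=> [j [B [mB ->]]]; apply: le_caratheodory_measurable => X.
apply: le_outer => c Xc.
have h1 : outer_product (X `&` [set x | B (x j)]) <=
    \sum_(k <oo) (box_volume (cut (c k) j mB))%:E.
  by apply: outer_le_boxes => x [/Xc[k _ ck] Bx]; exists k => //; rewrite cut_set.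
have h2 : outer_product (X `&` ~` [set x | B (x j)]) <=
    \sum_(k <oo) (box_volume (cut (c k) j (measurableC mB)))%:E.
  by apply: outer_le_boxes => x [/Xc[k _ ck] Bx]; exists k => //; rewrite cut_set.
apply: le_trans (leeD h1 h2) _; rewrite -nneseriesD.
- by apply: lee_nneseries => k *; rewrite -EFinD lee_fin ?addr_ge0 ?box_volume_ge0// cut_split.
- by move=> k _ _; rewrite lee_fin box_volume_ge0.
- by move=> k _ _; rewrite lee_fin box_volume_ge0.
Qed.

Let sub_caratheodory : (measurable : set (set (seqspace E))) `<=`
  (measurable : set (set (caratheodory_type outer_product))).
Proof.
apply: smallest_sub; last by move=> A; exact: cylinder_caratheodory.
split; first exact: caratheodory_measurable_set0.
  by move=> A mA; rewrite setTD; exact: caratheodory_measurable_setC.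
by move=> F mF; exact: caratheodory_measurable_bigcup.
Qed.

Definition seq_measure (A : set (seqspace E)) : \bar R := outer_product A.

Let seq_measure0 : seq_measure set0 = 0. Proof. exact: outer_measure0. Qed.

Let seq_measure_ge0 A : 0 <= seq_measure A. Proof. exact: outer_measure_ge0. Qed.

Let seq_measure_sigma : semi_sigma_additive seq_measure.
Proof.
move=> F mF tF mUF; apply: caratheodory_measure_sigma_additive => //.
  by move=> i; exact: sub_caratheodory (mF i).
exact: sub_caratheodory mUF.
Qed.

HB.instance Definition _ := isMeasure.Build _ _ _ seq_measure
  seq_measure0 seq_measure_ge0 seq_measure_sigma.

Let full_box := @Box 0 (fun=> setT) (fun=> measurableT) (fun _ _ => erefl).

Let seq_measureT : seq_measure setT = 1.
Proof.
have -> : setT = box_set full_box :> set (seqspace E) by apply/seteqP; split.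
by rewrite /seq_measure outer_product_box /box_volume big_ord0.
Qed.

HB.instance Definition _ := Measure_isProbability.Build _ _ _ seq_measure seq_measureT.

Definition seq_prob : probability (seqspace E) R := seq_measure.

Lemma seq_prob_box (b : box) : seq_prob (box_set b) = (box_volume b)%:E.
Proof. exact: outer_product_box. Qed.

End infinite_product.

(** * Laws of random sequences *)

Section laws.
Context {R : realType}.
Local Open Scope ereal_scope.

Definition has_law d1 d2 (S : measurableType d1) (E : measurableType d2)
    (Q : probability S R) (f : S -> E) (nu : probability E R) : Prop :=
  measurable_fun setT f /\ forall A, measurable A -> Q (f @^-1` A) = nu A.

Lemma measurable_preimage d1 d2 (S : measurableType d1) (E : measurableType d2)
    (f : S -> E) A :
  measurable_fun setT f -> measurable A -> measurable (f @^-1` A).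
Proof. by move=> mf mA; rewrite -[_ @^-1` _]setTI; exact: mf. Qed.

Section basic.
Context d1 d2 d3 (S : measurableType d1) (E : measurableType d2) (F : measurableType d3).
Variables (Q : probability S R) (nu : probability E R).

Lemma law_exists (f : S -> E) : measurable_fun setT f ->
  exists nu' : probability E R, has_law Q f nu'.
Proof.
move=> mf; pose f' : {mfun S >-> E} := mfun_Sub (mem_set mf).
by exists (distribution Q f'); split.
Qed.

Lemma law_comp (f : S -> E) (g : E -> F) (rho : probability F R) :
  has_law Q f nu -> has_law nu g rho -> has_law Q (g \o f) rho.
Proof.
move=> [mf Qf] [mg Qg]; split; first exact: measurableT_comp.
by move=> A mA; rewrite comp_preimage Qf ?Qg//; exact: measurable_preimage.
Qed.

Lemma law_uncomp (f : S -> E) (g : E -> F) (rho : probability F R) :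
  has_law Q f nu -> measurable_fun setT g -> has_law Q (g \o f) rho -> has_law nu g rho.
Proof.
move=> [mf Qf] mg [_ Qg]; split=> // A mA.
by rewrite -Qg// comp_preimage Qf//; exact: measurable_preimage.
Qed.

Lemma law_integral (f : S -> E) (h : E -> \bar R) : has_law Q f nu ->
  measurable_fun setT h -> (forall x, 0 <= h x) ->
  \int[Q]_s h (f s) = \int[nu]_x h x.
Proof.
move=> [mf Qf] mh h0.
pose f' : {mfun S >-> E} := mfun_Sub (mem_set mf).
transitivity (\int[distribution Q f']_x h x).
  by rewrite ge0_integral_distribution.
by apply: eq_measure_integral => A mA _; exact: Qf.
Qed.

Lemma law_id : has_law Q id Q. Proof. by split => //; exact: measurable_id. Qed.

End basic.

Section product.
Context d1 d2 d3 (S : measurableType d1) (E : measurableType d2) (F : measurableType d3).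
Variables (P : probability S R) (Q : probability E R) (nu : probability F R).

Lemma law_fst : has_law (P \x Q) fst P.
Proof.
split; first exact: measurable_fst.
move=> A mA; rewrite (_ : fst @^-1` A = A `*` setT); last first.
  by apply/seteqP; split => [[x y]//|[x y] []].
apply: etrans (product_measure1E P Q mA measurableT) _.
exact: etrans (congr1 (mule (P A)) (probability_setT Q)) (mule1 _).
Qed.

Lemma law_snd : has_law (P \x Q) snd Q.
Proof.
split; first exact: measurable_snd.
move=> A mA; rewrite (_ : snd @^-1` A = setT `*` A); last first.
  by apply/seteqP; split => [[x y]//|[x y] []].
apply: etrans (product_measure1E P Q measurableT mA) _.
exact: etrans (congr1 (mule^~ (Q A)) (probability_setT P)) (mul1e _).
Qed.

Lemma law_prod (f : E -> F) : has_law Q f nu ->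
  has_law (P \x Q) (fun z => (z.1, f z.2)) (P \x nu).
Proof.
move=> [mf Qf]; split.
  by apply/measurable_fun_pairP; split; [exact: measurable_fst|
     apply: (measurableT_comp mf); exact: measurable_snd].
move=> C mC; rewrite /product_measure1; apply: eq_integral => x _ /=.
rewrite -Qf; last exact: measurable_xsection.
by congr (Q _); apply/seteqP; split => y /=; rewrite /xsection /= !inE.
Qed.

End product.

End laws.

Definition seq_map E F (h : E -> F) (x : seqspace E) : seqspace F := fun i => h (x i).

Definition seq_fun S E (tau : nat -> S -> E) (s : S) : seqspace E := fun i => tau i s.

Section sequence_laws.
Context {R : realType}.
Local Open Scope ereal_scope.

Lemma measurable_coord d (E : measurableType d) i :
  measurable_fun setT (fun x : seqspace E => x i).
Proof.
by move=> _ B mB; rewrite setTI; apply: sub_sigma_algebra; exists i, B.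
Qed.

Lemma measurable_seqspace d1 d2 (S : measurableType d1) (E : measurableType d2)
    (f : S -> seqspace E) :
  (forall i, measurable_fun setT (fun s => f s i)) -> measurable_fun setT f.
Proof.
move=> mf; apply: (@measurability _ _ S (seqspace E) setT f (@cylinders _ E)).
  exact: erefl.
move=> _ [_ [i [B [mB ->]]] <-]; exact: (mf i).
Qed.

Lemma box_setE d (E : measurableType d) (b : box E) :
  box_set b = \bigcap_(i in `I_(box_dim b)) [set x | b i (x i)] :> set (seqspace E).
Proof.
apply/seteqP; split => [x bx i _|x bx i]; first exact: bx.
have [ib|bi] := ltnP i (box_dim b); first exact: bx.
by rewrite box_setT.
Qed.

Lemma measurable_box d (E : measurableType d) (b : box E) :
  measurable (box_set b : set (seqspace E)).
Proof.
rewrite box_setE; apply: bigcap_measurableType => i _.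
apply: (measurable_preimage (@measurable_coord _ E i)); exact: box_measurable.
Qed.

Section unique.
Context d (E : measurableType d).

Let boxI_measurable (b c : box E) i : measurable (b i `&` c i).
Proof. by apply: measurableI; exact: box_measurable. Qed.

Let boxI_setT (b c : box E) i : (maxn (box_dim b) (box_dim c) <= i)%N -> b i `&` c i = setT.
Proof. by rewrite geq_max => /andP[bi ci]; rewrite !box_setT// setTI. Qed.

Let boxI b c := Box (boxI_measurable b c) (@boxI_setT b c).

Let full_box := @Box _ E 0 (fun=> setT) (fun=> measurableT) (fun _ _ => erefl).

Let cylinder_side (i : nat) (B : set E) j : set E := if j == i then B else setT.

Let cylinder_measurable i B (mB : measurable B) j : measurable (cylinder_side i B j).
Proof. by rewrite /cylinder_side; case: ifP. Qed.

Let cylinder_setT i B j : (i.+1 <= j)%N -> cylinder_side i B j = setT.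
Proof. by move=> ij; rewrite /cylinder_side gtn_eqF. Qed.

Lemma seqspace_measure_unique (m1 m2 : probability (seqspace E) R) :
  (forall b : box E, m1 (box_set b) = m2 (box_set b)) ->
  forall A, measurable A -> m1 A = m2 A.
Proof.
move=> m12; pose G : set (set (seqspace E)) := [set A | exists b : box E, A = box_set b].
have full : setT = box_set full_box :> set (seqspace E) by apply/seteqP; split.
apply: (@measure_unique _ R (seqspace E) G (fun=> setT)).
- apply/seteqP; split; last first.
    apply: smallest_sub; first exact: sigma_algebra_measurable.
    by move=> _ [b ->]; exact: measurable_box.
  apply: smallest_sub; first exact: smallest_sigma_algebra.
  move=> _ [i [B [mB ->]]]; apply: sub_sigma_algebra.
  exists (Box (cylinder_measurable i mB) (@cylinder_setT i B)).
  apply/seteqP; split => x /=; last by move=> /(_ i); rewrite /= /cylinder_side eqxx.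
  by move=> Bx j /=; rewrite /cylinder_side; case: eqP => [->|].
- move=> _ _ [b ->] [c ->]; exists (boxI b c); apply/seteqP; split => x.
    by move=> [bx cx] i; split.
  by move=> H; split => i; have [] := H i.
- by move=> _; exists full_box.
- by apply/seteqP; split => // x _; exists 0%N.
- by move=> _ [b ->]; exact: m12.
- by move=> _; apply: le_lt_trans (ltry 1); exact: probability_le1.
Qed.

End unique.

Section iid_laws.
Context d1 d2 (S : measurableType d1) (E : measurableType d2).
Variables (Q : probability S R) (P : probability E R).

Lemma seq_prob_bigcap n (B : nat -> set E) : (forall i, measurable (B i)) ->
  seq_prob P (\bigcap_(i in `I_n) [set x | B i (x i)]) = \prod_(i < n) P (B i).
Proof.
move=> mB; pose B' i := if (i < n)%N then B i else setT.
have mB' i : measurable (B' i) by rewrite /B'; case: ifP.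
have B'T i : (n <= i)%N -> B' i = setT by rewrite /B' leqNgt => /negbTE ->.
have -> : \bigcap_(i in `I_n) [set x : seqspace E | B i (x i)] = box_set (Box mB' B'T).
  rewrite box_setE; apply: eq_bigcapr => i /= ni; by rewrite /B' ni.
rewrite seq_prob_box /box_volume /=.
have -> : \prod_(i < n) P (B i) = \prod_(i < n) (fine (P (B' i)))%:E.
  apply: eq_bigr => i _; rewrite /B' ltn_ord fineK//; exact: fin_num_measure.
by rewrite prodEFin.
Qed.

Lemma law_seq (f : S -> seqspace E) :
  (forall i, measurable_fun setT (fun s => f s i)) ->
  (forall n (B : nat -> set E), (forall i, measurable (B i)) ->
    Q (\bigcap_(i in `I_n) [set s | B i (f s i)]) = \prod_(i < n) P (B i)) ->
  has_law Q f (seq_prob P).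
Proof.
move=> /measurable_seqspace mf Qf.
have [nu [_ Qnu]] := law_exists Q mf.
split=> // A mA; rewrite Qnu//; move: A mA; apply: seqspace_measure_unique => b.
rewrite -Qnu; last exact: measurable_box.
rewrite box_setE seq_prob_bigcap; last exact: box_measurable.
rewrite -Qf//; exact: box_measurable.
Qed.

Lemma law_coord i : has_law (seq_prob P) (fun x => x i) P.
Proof.
split; first exact: measurable_coord.
move=> A mA; pose B j := if j == i then A else setT.
have mB j : measurable (B j) by rewrite /B; case: ifP.
have BA : B i = A by rewrite /B eqxx.
have := seq_prob_bigcap i.+1 mB.
rewrite big_ord_recr /= BA big1 ?mul1e; last first.
  by move=> j _; rewrite /B ltn_eqF// probability_setT.
move=> <-; congr (seq_prob P _); apply/seteqP; split => x /=.
  by move=> Ax j _; rewrite /B; case: eqP => [->|].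
by move=> /(_ i); rewrite /= BA; apply.
Qed.

End iid_laws.

Lemma law_map d1 d2 (E : measurableType d1) (F : measurableType d2)
    (P : probability E R) (nu : probability F R) (h : E -> F) :
  has_law P h nu -> has_law (seq_prob P) (seq_map h) (seq_prob nu).
Proof.
move=> [mh Ph]; apply: law_seq => [i|n B mB].
  exact: measurableT_comp mh (measurable_coord _).
have mhB i : measurable (h @^-1` B i) by exact: measurable_preimage.
apply: etrans (seq_prob_bigcap P n mhB) _.
by apply: eq_bigr => i _; exact: Ph.
Qed.

Section iid.
Context d (S : measurableType d) (Q : probability S R).
Variable tau : nat -> {RV Q >-> tree_space R}.
Variable eta : probability (tree_space R) R.

Lemma iid_law : iid tau eta -> has_law Q (seq_fun tau) (seq_prob eta).
Proof.
move=> [tau1 tau2]; apply: law_seq => [i|n B mB]; first exact: measurable_funPT.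
have := tau2 [fset i in iota 0 n]%fset B mB.
rewrite (_ : [set` _] = `I_n); last first.
  by apply/seteqP; split => i /=; rewrite !inE /= mem_iota.
move=> ->.
rewrite -(big_mkord xpredT (fun i => eta (B i))) /index_iota subn0.
rewrite (perm_big (iota 0 n)); last first.
  apply: uniq_perm; [exact: fset_uniq|exact: iota_uniq|].
  by move=> i; rewrite !inE.
by apply: eq_bigr => i _; exact: (tau1 i _ (mB i)).
Qed.

Lemma law_iid : has_law Q (seq_fun tau) (seq_prob eta) -> iid tau eta.
Proof.
move=> [mt Qt].
have lt i : has_law Q (tau i) eta := law_comp (conj mt Qt) (law_coord eta i).
split=> [i A|J B mB]; first by case: (lt i) => _; exact.
pose n := (\max_(i <- J) i).+1.
(* Trivial conditions complete the family [J] to an initial segment of indices. *)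
pose C i := if i \in J then B i else setT.
have mC i : measurable (C i) by rewrite /C; case: ifP.
have Jn i : i \in J -> (i < n)%N by move=> iJ; rewrite ltnS leq_bigmax_seq.
have JC : \bigcap_(i in [set` J]) (tau i @^-1` B i) =
    seq_fun tau @^-1` (\bigcap_(i in `I_n) [set x : seqspace _ | C i (x i)]).
  apply/seteqP; split => s H i /=; first by move=> _; rewrite /C; case: ifP => // /H.
  by move=> iJ; have := H i (Jn i iJ); rewrite /= /C iJ.
rewrite JC Qt; last first.
  apply: bigcap_measurableType => i _.
  exact: measurable_preimage (measurable_coord _) _.
rewrite seq_prob_bigcap// -(big_mkord xpredT (fun i => eta (C i))).
rewrite (eq_bigr (fun i => if i \in J then Q (tau i @^-1` B i) else 1)); last first.
  move=> i _; rewrite /C; case: ifP => _; last exact: probability_setT.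
  by case: (lt i) => _ ->.
rewrite -big_mkcond -big_filter; apply: perm_big; apply: uniq_perm.
- by rewrite filter_uniq// iota_uniq.
- exact: fset_uniq.
- move=> i; rewrite mem_filter mem_index_iota /=.
  by case iJ : (i \in J) => //=; rewrite Jn.
Qed.

End iid.

End sequence_laws.

(** * Moments and contraction *)

Section moments.
Context {R : realType}.
Variables (beta p : R) (d : measure_display) (Omega : measurableType d).
Variable P : probability Omega R.
Variables (L : Omega -> R) (X Pm : nat -> Omega -> R).
Hypothesis beta_gt0 : 0 < beta.
Hypothesis p_ge1 : 1 <= p.
Hypothesis L_ge0 : forall w, 0 <= L w.
Hypothesis X_itv : forall i w, 0 <= X i w <= L w.
Hypothesis Pm_ge0 : forall i w, 0 <= Pm i w.
Hypothesis mL : measurable_fun setT L.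
Hypothesis mX : forall i, measurable_fun setT (X i).
Hypothesis mP : forall i, measurable_fun setT (Pm i).
Local Notation ts := (tree_space R).
Local Open Scope ereal_scope.

Let p_gt0 : (0 < p)%R. Proof. exact: lt_le_trans ltr01 p_ge1. Qed.
Let p_ge0 : (0 <= p)%R. Proof. exact: ltW. Qed.

Definition xi_graft (w : Omega) (tau : nat -> ts) : ts :=
  graft beta (L w) (X^~ w) (Pm^~ w) tau.

Lemma measurable_xi_graft d' (T : measurableType d') (u : T -> Omega) (f : nat -> T -> ts) :
  measurable_fun setT u -> (forall i, measurable_fun setT (f i)) ->
  measurable_fun setT (fun t => xi_graft (u t) (f^~ t)).
Proof.
move=> mu mf; apply: (@measurable_graft R _ T beta (L \o u) (fun i => X i \o u)
  (fun i => Pm i \o u) f) => //= *; exact: measurableT_comp.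
Qed.

Definition branch_moment : \bar R := \int[P]_w (\sum_(0 <= j <oo) ((Pm j w) `^ (p * beta))%:E).

Section product.
Context d' (S : measurableType d') (Q : probability S R).

Lemma measurable_powR_fun d2 (T : measurableType d2) (g : T -> R) q :
  measurable_fun setT g -> measurable_fun setT (fun t => (g t `^ q)%:E).
Proof.
by move=> mg; apply/measurable_EFinP; exact: measurableT_comp (measurable_powR q) mg.
Qed.

(** The [p]-th power of the [l^p] norm of the rescaled family: it dominates the [p]-th power of
    every term, and its mean factorises by independence. *)
Definition branch_sum (g : nat -> S -> R) (z : Omega * S) : \bar R :=
  \sum_(0 <= i <oo) ((Pm i z.1 `^ beta * g i z.2) `^ p)%:E.

Lemma branch_sum_ge0 g z : 0 <= branch_sum g z.
Proof. by apply: nneseries_ge0 => i _ _; rewrite lee_fin powR_ge0. Qed.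

Lemma branch_sum_term g z i : ((Pm i z.1 `^ beta * g i z.2) `^ p)%:E <= branch_sum g z.
Proof.
apply: (@nneseries_ge_term R (fun i => ((Pm i z.1 `^ beta * g i z.2) `^ p)%:E)) => j.
by rewrite lee_fin powR_ge0.
Qed.

Lemma measurable_branch_sum (g : nat -> S -> R) : (forall i, measurable_fun setT (g i)) ->
  measurable_fun setT (branch_sum g).
Proof.
move=> mg; apply: ge0_emeasurable_sum => [k z _ _|k _]; first by rewrite lee_fin powR_ge0.
apply: measurable_powR_fun; apply: measurable_funM.
  apply: measurableT_comp (measurable_powR beta) _.
  exact: measurableT_comp (mP k) measurable_fst.
exact: measurableT_comp (mg k) measurable_snd.
Qed.

Lemma branch_sum_moment (g : nat -> S -> R) (M : R) : (forall i, measurable_fun setT (g i)) ->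
  (forall i s, (0 <= g i s)%R) -> (0 <= M)%R ->
  (forall i, \int[Q]_s ((g i s) `^ p)%:E <= M%:E) ->
  \int[P \x Q]_z branch_sum g z <= branch_moment * M%:E.
Proof.
move=> mg g0 M0 gM.
have mPp i : measurable_fun setT (fun w => (Pm i w `^ (p * beta))%:E).
  exact: measurable_powR_fun.
have s0 w : 0 <= \sum_(0 <= j <oo) (Pm j w `^ (p * beta))%:E.
  by apply: nneseries_ge0 => *; rewrite lee_fin powR_ge0.
have ms : measurable_fun setT (fun w => \sum_(0 <= j <oo) (Pm j w `^ (p * beta))%:E).
  by apply: ge0_emeasurable_sum => // *; rewrite lee_fin powR_ge0.
have mB := measurable_branch_sum mg.
rewrite fubini_tonelli1//; last by move=> z; exact: branch_sum_ge0.
rewrite /branch_moment -ge0_integralZr//.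
apply: ge0_le_integral => //.
- by move=> w _; apply: integral_ge0 => s _; exact: branch_sum_ge0.
- exact: (measurable_fun_fubini_tonelli_F _ mB (branch_sum_ge0 g)).
- by apply: emeasurable_funM.
move=> w _; rewrite /fubini_F /branch_sum /=.
rewrite integral_nneseries//; first last.
- by move=> *; rewrite lee_fin powR_ge0.
- by move=> i; apply: measurable_powR_fun; exact: measurable_funM.
rewrite muleC -nneseriesZl//; last by move=> *; rewrite lee_fin powR_ge0.
apply: lee_nneseries => [i _ _|i _].
  by apply: integral_ge0 => *; rewrite lee_fin powR_ge0.
under eq_integral => s _ do rewrite powRM ?powR_ge0// -powRrM (mulrC beta) EFinM.
rewrite ge0_integralZl_EFin ?powR_ge0//; first last.
- exact: measurable_powR_fun.
- by move=> *; rewrite lee_fin powR_ge0.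
by rewrite muleC lee_wpmul2r// lee_fin powR_ge0.
Qed.

Lemma powR_le_root (a b : R) : (0 <= a)%R -> (0 <= b)%R -> (a `^ p <= b)%R ->
  (a <= b `^ p^-1)%R.
Proof.
move=> a0 b0 ab; rewrite -[leLHS](powRr1 a0) -(mulfV (lt0r_neq0 p_gt0)) powRrM.
by apply: ge0_ler_powR => //; rewrite ?invr_ge0// nnegrE powR_ge0.
Qed.

Lemma branch_sum_root (g : nat -> S -> R) z : (forall i s, (0 <= g i s)%R) ->
  branch_sum g z < +oo ->
  exists r : R, [/\ (0 <= r)%R, (r `^ p)%:E = branch_sum g z &
    forall i, (Pm i z.1 `^ beta * g i z.2 <= r)%R].
Proof.
move=> g0 Boo; have Bfin : branch_sum g z \is a fin_num.
  by rewrite ge0_fin_numE// branch_sum_ge0.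
have B0 : (0 <= fine (branch_sum g z))%R by rewrite fine_ge0// branch_sum_ge0.
exists (fine (branch_sum g z) `^ p^-1)%R; split; first exact: powR_ge0.
  by rewrite -powRrM mulVf ?lt0r_neq0// powRr1// fineK.
move=> i; apply: powR_le_root => //; first by rewrite mulr_ge0// powR_ge0.
by rewrite -lee_fin fineK// branch_sum_term.
Qed.

Lemma branch_sum_good (f : nat -> S -> ts) z :
  branch_sum (fun i s => height (f i s)) z < +oo ->
  graft_good beta (Pm^~ z.1) (f^~ z.2).
Proof.
move=> Boo e e0.
pose u k := ((Pm k z.1 `^ beta * height (f k z.2)) `^ p)%:E.
have u0 k : 0 <= u k by rewrite lee_fin powR_ge0.
have := @nneseries_tail_cvg R u xpredT Boo (fun k _ => u0 k).
have ep : (0 < e `^ p)%R by rewrite powR_gt0.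
move=> /(_ [set y | y < (e `^ p)%:E]); case.
  by apply: open_nbhs_nbhs; split; [exact: open_ereal_lt_ereal|rewrite /= lte_fin].
move=> N _ HN; exists N => n Nn.
have : u n < (e `^ p)%:E.
  apply: le_lt_trans (HN n Nn); have := @nneseries_lim_ge R u xpredT n n.+1 (fun k _ _ => u0 k).
  by rewrite big_nat1.
rewrite lte_fin; apply: contraTT; rewrite -!leNgt => en.
apply: ge0_ler_powR => //; rewrite nnegrE; first exact: ltW.
by rewrite mulr_ge0 ?powR_ge0 ?height_ge0.
Qed.

(** The moment bound makes the sum over the heights finite almost everywhere, so its terms, and with
    them the heights of the rescaled branches, tend to 0. *)
Lemma ae_good (f : nat -> S -> ts) (H : R) : branch_moment < +oo ->
  (forall i, measurable_fun setT (f i)) ->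
  (forall i, \int[Q]_s (height (f i s) `^ p)%:E <= H%:E) ->
  {ae P \x Q, forall z, graft_good beta (Pm^~ z.1) (f^~ z.2)}.
Proof.
move=> Coo mf fH.
have H0 : (0 <= H)%R.
  rewrite -lee_fin; apply: le_trans (fH 0%N).
  by apply: integral_ge0 => *; rewrite lee_fin powR_ge0.
have mh i : measurable_fun setT (fun s => height (f i s)).
  exact: measurableT_comp measurable_height (mf i).
have mB := measurable_branch_sum mh.
have iB : (P \x Q).-integrable setT (branch_sum (fun i s => height (f i s))).
  apply/integrableP; split => //.
  rewrite (eq_integral (branch_sum (fun i s => height (f i s)))); last first.
    by move=> z _; rewrite gee0_abs// branch_sum_ge0.
  apply: le_lt_trans (branch_sum_moment mh (fun i s => height_ge0 (f i s)) H0 fH) _.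
  by rewrite muleC lte_mul_pinfty.
apply: filterS (integrable_ae measurableT iB) => z /(_ I).
rewrite ge0_fin_numE ?branch_sum_ge0//; exact: branch_sum_good.
Qed.

(** If just one of the two grafts is compact, the other is the default tree and the branches no
    longer control the distance. The bounds on heights make both compact almost everywhere; their
    value [H] does not enter the result. *)
Lemma graft_contract_moment (f f' : nat -> S -> ts) (H M : R) : branch_moment < +oo ->
  (forall i, measurable_fun setT (f i)) -> (forall i, measurable_fun setT (f' i)) ->
  (forall i, \int[Q]_s (height (f i s) `^ p)%:E <= H%:E) ->
  (forall i, \int[Q]_s (height (f' i s) `^ p)%:E <= H%:E) ->
  (forall i, \int[Q]_s (td (f i s) (f' i s) `^ p)%:E <= M%:E) ->
  \int[P \x Q]_z (td (xi_graft z.1 (f^~ z.2)) (xi_graft z.1 (f'^~ z.2)) `^ p)%:E <=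
    branch_moment * M%:E.
Proof.
move=> Coo mf mf' fH fH' fM.
have M0 : (0 <= M)%R.
  rewrite -lee_fin; apply: le_trans (fM 0%N).
  by apply: integral_ge0 => *; rewrite lee_fin powR_ge0.
have mt i : measurable_fun setT (fun s => td (f i s) (f' i s)) by exact: measurable_td.
apply: le_trans (branch_sum_moment mt (fun i s => td_ge0 (f i s) (f' i s)) M0 fM).
have mg (h : nat -> S -> ts) : (forall i, measurable_fun setT (h i)) ->
    measurable_fun setT (fun z : Omega * S => xi_graft z.1 (h^~ z.2)).
  move=> mh; apply: (measurable_xi_graft (f := fun i z => h i z.2)) => // i.
  exact: measurableT_comp (mh i) measurable_snd.
apply: ae_ge0_le_integral => //.
- by move=> z _; rewrite lee_fin powR_ge0.
- by apply: measurable_powR_fun; apply: measurable_td; exact: mg.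
- by move=> z _; exact: branch_sum_ge0.
- exact: measurable_branch_sum.
apply: filterS2 (ae_good Coo mf fH) (ae_good Coo mf' fH') => z gz gz' _.
have [Boo|] := ltP (branch_sum (fun i s => td (f i s) (f' i s)) z) +oo; last first.
  by apply: le_trans; rewrite leey.
have [r [r0 <- zr]] := @branch_sum_root (fun i s => td (f i s) (f' i s)) z
  (fun i s => td_ge0 (f i s) (f' i s)) Boo.
rewrite lee_fin; apply: ge0_ler_powR => //; rewrite ?nnegrE ?td_ge0//.
by apply: graft_contract => // i; exact: X_itv.
Qed.

(** Crude, through twice the maximum; the constant only multiplies quantities that are finite or
    tend to 0. *)
Lemma powRD_le (a b : R) : (0 <= a)%R -> (0 <= b)%R ->
  ((a + b) `^ p <= 2 `^ p * (a `^ p + b `^ p))%R.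
Proof.
move=> a0 b0; have m0 : (0 <= Num.max a b)%R by rewrite le_max a0.
apply: (@le_trans _ _ ((2 * Num.max a b) `^ p)%R).
  apply: ge0_ler_powR => //; rewrite ?nnegrE ?addr_ge0 ?mulr_ge0//.
  have : (a <= Num.max a b)%R by rewrite le_max lexx.
  have : (b <= Num.max a b)%R by rewrite le_max lexx orbT.
  by lra.
rewrite powRM// ler_wpM2l ?powR_ge0//.
by case: (leP a b) => _; rewrite ?lerDl ?lerDr powR_ge0.
Qed.

Lemma graft_height_moment (f : nat -> S -> ts) (H : R) : branch_moment < +oo ->
  \int[P]_w (L w `^ p)%:E < +oo ->
  (forall i, measurable_fun setT (f i)) ->
  (forall i, \int[Q]_s (height (f i s) `^ p)%:E <= H%:E) ->
  \int[P \x Q]_z (height (xi_graft z.1 (f^~ z.2)) `^ p)%:E < +oo.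
Proof.
move=> Coo Loo mf fH.
have H0 : (0 <= H)%R.
  rewrite -lee_fin; apply: le_trans (fH 0%N).
  by apply: integral_ge0 => *; rewrite lee_fin powR_ge0.
have mh i : measurable_fun setT (fun s => height (f i s)).
  exact: measurableT_comp measurable_height (mf i).
have mB := measurable_branch_sum mh.
have mLz : measurable_fun setT (fun z : Omega * S => (L z.1 `^ p)%:E).
  by apply: measurable_powR_fun; exact: measurableT_comp mL measurable_fst.
pose B := branch_sum (fun i s => height (f i s)).
apply: (@le_lt_trans _ _ (\int[P \x Q]_z ((2 `^ p)%:E * ((L z.1 `^ p)%:E + B z)))).
  apply: ge0_le_integral => //.
  - by move=> z _; rewrite lee_fin powR_ge0.
  - apply: measurable_powR_fun; apply: measurableT_comp measurable_height _.
    apply: (measurable_xi_graft (f := fun i z => f i z.2)) => // i.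
    exact: measurableT_comp (mf i) measurable_snd.
  - by apply: emeasurable_funM => //; exact: emeasurable_funD.
  move=> z _; have [Boo|] := ltP (B z) +oo; last first.
    rewrite leye_eq => /eqP ->; rewrite addey// gt0_muley ?leey// lte_fin powR_gt0.
  have [r [r0 rz zr]] := @branch_sum_root (fun i s => height (f i s)) z
    (fun i s => height_ge0 (f i s)) Boo.
  rewrite /B -rz -EFinD -EFinM lee_fin; apply: le_trans (powRD_le _ r0) => //.
  apply: ge0_ler_powR => //; rewrite ?nnegrE ?height_ge0 ?addr_ge0//.
  by apply: height_graft => // i; exact: X_itv.
rewrite ge0_integralZl_EFin ?powR_ge0//; first last.
- by apply: emeasurable_funD.
- by move=> z _; rewrite adde_ge0 ?branch_sum_ge0// lee_fin powR_ge0.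
rewrite lte_mul_pinfty ?lee_fin ?powR_ge0// ge0_integralD//; first last.
- by move=> z _; exact: branch_sum_ge0.
- by move=> z _; rewrite lee_fin powR_ge0.
rewrite lte_add_pinfty//.
  rewrite (law_integral (law_fst P Q) (h := fun w => (L w `^ p)%:E))//.
  - exact: measurable_powR_fun.
  - by move=> w; rewrite lee_fin powR_ge0.
apply: le_lt_trans (branch_sum_moment mh (fun i s => height_ge0 (f i s)) H0 fH) _.
by rewrite muleC lte_mul_pinfty.
Qed.

End product.
End moments.

(** * Independent copies along the infinite tree *)

Section branching.
Context {R : realType} {d : measure_display} {Omega : measurableType d}.
Variable P : probability Omega R.
Local Open Scope ereal_scope.

(* A family of labels indexed by the nodes of the infinite tree (words over
   [nat]) is encoded as a sequence through the bijection [CodeSeq.code]. *)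
Definition child (i m : nat) : nat := CodeSeq.code (i :: CodeSeq.decode m).

Definition subtree (z : seqspace Omega) (i : nat) : seqspace Omega :=
  fun m => z (child i m).

(** Rebuilds a labelled tree from the label of its root, whose code is 0, and its subtrees. *)
Definition branch_join (x : Omega * seqspace (seqspace Omega)) : seqspace Omega :=
  fun k => if CodeSeq.decode k is i :: u then x.2 i (CodeSeq.code u) else x.1.

Lemma branch_join0 x : branch_join x 0%N = x.1.
Proof. by []. Qed.

Lemma branch_join_child x i m : branch_join x (child i m) = x.2 i m.
Proof. by rewrite /branch_join /child CodeSeq.codeK CodeSeq.decodeK. Qed.

Lemma subtree_join x i : subtree (branch_join x) i = x.2 i.
Proof. by apply/funext => m; exact: branch_join_child. Qed.

(** Both indices being smaller than the node, conditions on the nodes below [n] only concern the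
    root and the first [n] coordinates of the first [n] subtrees. *)
Lemma childP k : (0 < k)%N -> exists i m, [/\ k = child i m, (i < k)%N & (m < k)%N].
Proof.
move=> k0; have := CodeSeq.decodeK k; case E: (CodeSeq.decode k) => [|i u] ku.
  by rewrite -ku in k0.
exists i, (CodeSeq.code u); rewrite /child CodeSeq.codeK; split => //.
  by have := CodeSeq.ltn_code (i :: u); rewrite ku => /= /andP[].
rewrite -ku -[X in (X < _)%N]/(CodeSeq.code u) -[X in (_ < X)%N]/(2 ^ i * (CodeSeq.code u).*2.+1)%N.
apply: (@leq_trans (CodeSeq.code u).*2.+1); first by rewrite ltnS -addnn leq_addr.
by rewrite -[leqLHS]mul1n leq_mul// expn_gt0.
Qed.

Lemma child_inj i m i' m' : child i m = child i' m' -> i = i' /\ m = m'.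
Proof.
by move=> /(can_inj CodeSeq.codeK)[-> /(can_inj CodeSeq.decodeK) ->].
Qed.

(** The nodes [child i m] with [i] and [m] below [n] include all nonzero nodes below [n]; the
    surplus ones have factor 1. *)
Lemma prod_child (f : nat -> \bar R) n : (forall k, (n <= k)%N -> f k = 1) ->
  \prod_(k < n) f k = f 0%N * \prod_(i < n) \prod_(m < n) f (child i m).
Proof.
move=> f1; pose s := 0%N :: [seq child i m | i <- iota 0 n, m <- iota 0 n].
have us : uniq s.
  rewrite /= allpairs_uniq ?iota_uniq//; last first.
    by move=> [i m] [i' m'] _ _ /= /child_inj[-> ->].
  rewrite andbT; apply/negP => /allpairsP[[i m] [_ _ /= /esym/eqP]].
  by rewrite muln_eq0 expn_eq0.
rewrite -(big_mkord xpredT f) /index_iota subn0.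
transitivity (\prod_(k <- s) f k).
  rewrite [RHS](bigID (fun k => (k < n)%N))/= [X in _ * X]big1 ?mule1; last first.
    by move=> k; rewrite -leqNgt => /f1.
  rewrite -[RHS]big_filter; apply: perm_big; apply: uniq_perm.
  - exact: iota_uniq.
  - exact: filter_uniq.
  move=> k; rewrite mem_filter mem_iota /= add0n; case: (ltnP k n) => //= kn.
  rewrite inE; case: posnP => //= k0; apply/esym/allpairsP.
  have [i [m [km ik mk]]] := childP k0; exists (i, m); split => //=.
    by rewrite mem_iota add0n (ltn_trans ik kn).
  by rewrite mem_iota add0n (ltn_trans mk kn).
rewrite big_cons big_allpairs_dep.
rewrite -(big_mkord xpredT (fun i => \prod_(m < n) f (child i m))) /index_iota subn0.
by congr (_ * _); apply: eq_bigr => i _; rewrite -(big_mkord xpredT (fun m => f (child i m))) /index_iota subn0.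
Qed.

(** A renumbering of independent labels: a finite box becomes a product of boxes over the root and
    the subtrees, with the same factors. *)
Lemma law_branch_join :
  has_law (P \x seq_prob (seq_prob P)) branch_join (seq_prob P).
Proof.
apply: law_seq => [k|n B mB].
  rewrite /branch_join; case: (CodeSeq.decode k) => [|i u]; first exact: measurable_fst.
  have mi : measurable_fun setT (fun x : Omega * seqspace (seqspace Omega) => x.2 i).
    exact: measurableT_comp (measurable_coord i) measurable_snd.
  exact: measurableT_comp (measurable_coord (CodeSeq.code u)) mi.
pose B' k := if (k < n)%N then B k else setT.
have mB' k : measurable (B' k) by rewrite /B'; case: ifP.
pose D i : set (seqspace Omega) := \bigcap_(m in `I_n) [set y | B' (child i m) (y m)].
have mD i : measurable (D i).
  apply: bigcap_measurableType => m _; exact: measurable_preimage (measurable_coord m) _.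
pose C : set (seqspace (seqspace Omega)) := \bigcap_(i in `I_n) [set x | D i (x i)].
have mC : measurable C.
  apply: bigcap_measurableType => i _; exact: measurable_preimage (measurable_coord i) _.
transitivity ((P \x seq_prob (seq_prob P)) (B' 0%N `*` C)).
  congr (_ _); apply/seteqP; split => [z Bz|z [B0 Cz] k /= kn].
    split=> [|i _ m _] /=.
      by rewrite /B'; case: ifP => // n0; exact: (Bz 0%N n0).
    rewrite /B'; case: ifP => // cn; have := Bz _ cn.
    by rewrite /= branch_join_child.
  have BB : B' k = B k by rewrite /B' kn.
  have [k0|k0] := posnP k; first by move: B0; rewrite -BB k0.
  have [i [m [km ik mk]]] := childP k0; rewrite km branch_join_child.
  have := Cz i (ltn_trans ik kn) m (ltn_trans mk kn).
  by rewrite /= -km BB.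
apply: etrans (product_measure1E P (seq_prob (seq_prob P)) (mB' 0%N) mC) _.
have -> : \prod_(k < n) P (B k) = \prod_(k < n) P (B' k).
  by apply: eq_bigr => k _; rewrite /B' ltn_ord.
rewrite (@prod_child (fun k => P (B' k))); last first.
  by move=> k nk; rewrite /B' ltnNge nk; exact: probability_setT.
congr (_ * _); apply: etrans (seq_prob_bigcap _ n mD) _; apply: eq_bigr => i _.
exact: (seq_prob_bigcap _ n (fun m => mB' (child i m))).
Qed.

End branching.

Local Open Scope ereal_scope.

(** * Transport cost *)

(** Meant for integrands with [dGH], whose measurability is not established: the integral of a
    nonnegative function is a supremum over the simple functions below it, hence monotone in any
    case. *)
Lemma le_integral_nonneg d (T : measurableType d) (R : realType)
    (mu : {measure set T -> \bar R}) (f g : T -> \bar R) :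
  (forall x, 0 <= f x) -> (forall x, f x <= g x) -> \int[mu]_x f x <= \int[mu]_x g x.
Proof.
move=> f0 fg; have g0 x : 0 <= g x by apply: le_trans (fg x).
rewrite !ge0_integralTE//; apply: ge_ereal_sup => _ [h hf <-].
by apply: ereal_sup_ubound; exists h => // x; apply: le_trans (fg x); exact: hf.
Qed.

Section wasserstein_bound.
Context {R : realType}.
Variable p : R.
Hypothesis p_ge1 : (1 <= p)%R.
Local Notation ts := (tree_space R).
Implicit Types eta : probability ts R.

Let p_gt0 : (0 < p)%R. Proof. exact: lt_le_trans ltr01 p_ge1. Qed.
Let p_ge0 : (0 <= p)%R. Proof. exact: ltW. Qed.

(** A bound on the [p]-th power of the transport distance for [td], witnessed by a coupling:
    grafting acts on the witness, and no optimal coupling has to exist. *)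
Definition transport_le eta eta' (M : R) : Prop :=
  exists2 pi : probability (ts * ts)%type R, has_law pi fst eta /\ has_law pi snd eta' &
    \int[pi]_z (td z.1 z.2 `^ p)%:E <= M%:E.

Lemma measurable_td_powR d (T : measurableType d) (f f' : T -> ts) :
  measurable_fun setT f -> measurable_fun setT f' ->
  measurable_fun setT (fun t => (td (f t) (f' t) `^ p)%:E).
Proof. by move=> mf mf'; apply: measurable_powR_fun; exact: measurable_td. Qed.

Lemma td_triangle_moment d (T : measurableType d) (Q : probability T R) (f f' f'' : T -> ts) :
  measurable_fun setT f -> measurable_fun setT f' -> measurable_fun setT f'' ->
  \int[Q]_t (td (f t) (f'' t) `^ p)%:E <=
  (2 `^ p)%:E * (\int[Q]_t (td (f t) (f' t) `^ p)%:E + \int[Q]_t (td (f' t) (f'' t) `^ p)%:E).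
Proof.
move=> mf mf' mf''; have m1 := measurable_td_powR mf mf'; have m2 := measurable_td_powR mf' mf''.
have pos (a b : ts) : 0 <= (td a b `^ p)%:E by rewrite lee_fin powR_ge0.
rewrite -ge0_integralD// -ge0_integralZl_EFin ?powR_ge0//; first last.
- exact: emeasurable_funD m1 m2.
- by move=> t _; exact: adde_ge0.
apply: le_integral_nonneg => t //.
rewrite -EFinD -EFinM lee_fin.
apply: le_trans (powRD_le p_ge1 (td_ge0 _ _) (td_ge0 _ _)).
by apply: ge0_ler_powR; rewrite ?nnegrE ?addr_ge0 ?td_ge0 ?td_triangle// ltW.
Qed.

Lemma transport_le_intro d (S : measurableType d) (Q : probability S R) (f f' : S -> ts)
    eta eta' M : has_law Q f eta -> has_law Q f' eta' ->
  \int[Q]_s (td (f s) (f' s) `^ p)%:E <= M%:E -> transport_le eta eta' M.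
Proof.
move=> lf lf' fM.
have mff : measurable_fun setT (fun s => (f s, f' s)).
  by apply/measurable_fun_pairP; split; [case: lf|case: lf'].
have [pi lpi] := law_exists Q mff.
exists pi; first by split; apply: law_uncomp lpi _ _.
rewrite -(law_integral lpi (h := fun z => (td z.1 z.2 `^ p)%:E))//.
  by apply: measurable_td_powR.
by move=> z; rewrite lee_fin powR_ge0.
Qed.

Lemma td_powR_le (a b : ts) : (td a b `^ p <= height a `^ p + height b `^ p)%R.
Proof.
apply: (@le_trans _ _ (Num.max (height a) (height b) `^ p)%R).
  apply: ge0_ler_powR; rewrite ?nnegrE ?td_ge0//; last exact: td_height.
  by rewrite le_max height_ge0.
by case: (leP (height a) (height b)) => _; rewrite ?lerDl ?lerDr powR_ge0.
Qed.

(** The independent coupling has finite cost, since [td] is at most the larger height. *)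
Lemma transport_le_fin eta eta' : Pp p eta -> Pp p eta' ->
  exists M, transport_le eta eta' M.
Proof.
move=> Pe Pe'; pose h (a : ts) := (height a `^ p)%:E.
have mh : measurable_fun setT h by apply: measurable_powR_fun; exact: measurable_height.
have h0 a : 0 <= h a by rewrite lee_fin powR_ge0.
have l1 := law_fst eta eta'; have l2 := law_snd eta eta'.
have fin : \int[eta]_a h a + \int[eta']_a h a \is a fin_num.
  rewrite ge0_fin_numE; first exact: lte_add_pinfty.
  by apply: adde_ge0; exact: integral_ge0.
exists (fine (\int[eta]_a h a + \int[eta']_a h a)).
apply: (transport_le_intro l1 l2); rewrite fineK//.
rewrite -(law_integral l1 mh h0) -(law_integral l2 mh h0) -ge0_integralD//; first last.
- exact: measurableT_comp mh measurable_snd.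
- exact: measurableT_comp mh measurable_fst.
apply: le_integral_nonneg => z; first by rewrite lee_fin powR_ge0.
by rewrite /h -EFinD lee_fin td_powR_le.
Qed.

Lemma transport_le_law eta eta' nu nu' M : same_law eta nu -> same_law eta' nu' ->
  transport_le eta eta' M -> transport_le nu nu' M.
Proof.
move=> en en' [pi [[m1 l1] [m2 l2]] piM]; exists pi => //.
by split; split => // A mA; rewrite ?l1 ?l2 ?en ?en'.
Qed.

Lemma transport_le_sym eta eta' M : transport_le eta eta' M -> transport_le eta' eta M.
Proof.
move=> [pi [l1 l2] piM]; apply: (transport_le_intro l2 l1).
by under eq_integral do rewrite td_sym.
Qed.

Lemma GH_openI (U V : set ts) : GH_open U -> GH_open V -> GH_open (U `&` V).
Proof.
move=> oU oV a [/oU[e e0 eU] /oV[e' e'0 eV]]; exists (Num.min e e').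
  by rewrite lt_min e0.
by move=> b; rewrite lt_min => /andP[be be']; split; [exact: eU|exact: eV].
Qed.

(** Let [V k] be the points whose ball of radius [rate k] lies in [U]. A coupled pair starting in
    [V k] ends in [U] unless its points are at least [rate k] apart, which by the Markov inequality
    has probability at most [e]; let [e] tend to 0, and [k] to infinity. *)
Lemma transport_le0_open eta eta' (U : set ts) : (forall e : R, (0 < e)%R -> transport_le eta eta' e) ->
  GH_open U -> eta U <= eta' U.
Proof.
move=> H oU; have mU : measurable U by apply: measurable_td_open; exact: GH_open_td.
pose V k := [set a : ts | forall b, (td a b < rate k)%R -> U b].
have mV k : measurable (V k).
  rewrite -[V k]setCK; apply: measurableC; apply: measurable_td_open => a /= /existsNP[b].
  move=> /not_implyP[ab nb]; exists (rate k - td a b)%R; first by rewrite subr_gt0.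
  move=> a' aa'; apply/existsNP; exists b; apply/not_implyP; split => //.
  apply: le_lt_trans (td_triangle a a' b) _.
  by rewrite td_sym -ltrBrDr.
have VU : \bigcup_k V k = U.
  apply/seteqP; split => [a [k _ Vk]|a Ua]; first by apply: Vk; rewrite tdxx rate_gt0.
  have [e e0 eU] := GH_open_td oU Ua; have [k /(_ k (leqnn k)) ke] := rate_lt e0.
  by exists k => // b ab; apply: eU; exact: lt_trans ke.
have cvV : eta (V k) @[k --> \oo] --> eta U.
  rewrite -VU; apply: nondecreasing_cvg_mu => //; first by rewrite VU.
  move=> n m nm; apply/subsetPset => a Va b ab; apply: Va; apply: lt_le_trans ab _.
  by rewrite /rate lef_pV2 ?posrE// ler_nat ltnS.
rewrite -(cvg_lim _ cvV)//; apply: lime_le; first by apply/cvg_ex; exists (eta U).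
apply: nearW => k; apply/lee_addgt0Pr => e e0.
have rp : (0 < rate k `^ p)%R by rewrite powR_gt0 ?rate_gt0.
have [pi [[m1 l1] [m2 l2]] piM] := H (e * rate k `^ p)%R (mulr_gt0 e0 rp).
pose W := [set z : ts * ts | (rate k <= td z.1 z.2)%R].
have mW : measurable W.
  rewrite -[W]setCK; apply: measurableC.
  rewrite (_ : ~` W = [set z | (td z.1 z.2 < rate k)%R]); last first.
    by apply/seteqP; split => z /=; rewrite ltNge => /negP.
  apply: measurable_set_lt => //; exact: (measurable_td measurable_fst measurable_snd).
rewrite -l1// -l2//; apply: (@le_trans _ _ (pi (snd @^-1` U `|` W))).
  apply: le_measure; rewrite ?inE.
  - exact: measurable_preimage.
  - by apply: measurableU => //; exact: measurable_preimage.
  by move=> [a b] /= Va; have [/Va|] := ltP (td a b) (rate k); [left|right].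
apply: le_trans (measureU2 _ _ _) _ => //; first exact: measurable_preimage.
rewrite leeD2l//.
have : (rate k `^ p)%:E * pi W <= (e * rate k `^ p)%:E.
  apply: le_trans piM.
  have -> : pi W = \int[pi]_z (\1_W z)%:E by rewrite integral_indic// setIT.
  rewrite -ge0_integralZl_EFin//; first last.
  - exact: ltW.
  - by apply/measurable_EFinP; exact: measurable_indic.
  apply: le_integral_nonneg => z; first by rewrite -EFinM lee_fin mulr_ge0// ltW.
  rewrite -EFinM lee_fin indicE; case: (boolP (z \in W)) => [|_]; last by rewrite mulr0 powR_ge0.
  by rewrite inE mulr1 => zW; apply: ge0_ler_powR; rewrite ?nnegrE ?td_ge0// ltW// rate_gt0.
by rewrite muleC EFinM lee_pmul2r.
Qed.

Lemma transport_le0 eta eta' : (forall e : R, (0 < e)%R -> transport_le eta eta' e) ->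
  same_law eta eta'.
Proof.
move=> H A mA.
have H' (e : R) : (0 < e)%R -> transport_le eta' eta e by move=> /H/transport_le_sym.
apply: (@measure_unique _ R ts GH_open (fun=> setT)) => //.
- by move=> U V; exact: GH_openI.
- by move=> _ a _; exists 1%R.
- by apply/seteqP; split => // a _; exists 0%N.
- move=> U oU; apply/eqP; rewrite eq_le; apply/andP.
  by split; exact: transport_le0_open.
- by move=> _; apply: le_lt_trans (ltry 1); exact: probability_le1.
Qed.

Lemma Wp_ge0 eta eta' : 0 <= Wp p eta eta'.
Proof. exact: poweR_ge0. Qed.

Lemma Wp_le eta eta' M : (0 <= M)%R -> transport_le eta eta' M ->
  Wp p eta eta' <= (M `^ p^-1)%:E.
Proof.
move=> M0 [pi [[m1 l1] [m2 l2]] piM].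
rewrite -poweR_EFin; apply: gt0_ler_poweR.
- by rewrite invr_ge0.
- by rewrite in_itv /= leey andbT; apply: le_ereal_inf_tmp => _ [pi' _ <-]; apply: integral_ge0 => z _;
    rewrite lee_fin powR_ge0.
- by rewrite in_itv /= leey andbT lee_fin.
apply: le_trans piM; apply: (@le_trans _ _ (\int[pi]_z (dGH z.1 z.2 `^ p)%:E)).
  apply: ereal_inf_lbound; exists pi => // A mA; rewrite -l1// -l2//; split; congr (pi _).
    by apply/seteqP; split => [[a b] []|[a b]].
  by apply/seteqP; split => [[a b] []|[a b]].
apply: le_integral_nonneg => z; first by rewrite lee_fin powR_ge0.
by rewrite lee_fin; apply: ge0_ler_powR; rewrite ?nnegrE ?td_ge0 ?dGH_ge0// dGH_le_td.
Qed.

End wasserstein_bound.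

(** * The grafting operator and its fixed point *)

Section operator.
Context {R : realType}.
Variables (beta p : R) (d : measure_display) (Omega : measurableType d).
Variable P : probability Omega R.
Variables (L : {RV P >-> R}) (X Pm : nat -> {RV P >-> R}).
Hypothesis beta_gt0 : (0 < beta)%R.
Hypothesis p_ge1 : (1 <= p)%R.
Hypothesis L_gt0 : forall w, (0 < L w)%R.
Hypothesis X_itv : forall i w, (0 <= X i w <= L w)%R.
Hypothesis Pm_ge0 : forall i w, (0 <= Pm i w)%R.
Hypothesis L_moment : \int[P]_w ((L w) `^ p)%:E < +oo.
Hypothesis Pm_moment :
  \int[P]_w (\sum_(0 <= j <oo) ((Pm j w) `^ (p * beta))%:E) < 1.
Local Notation ts := (tree_space R).
Local Notation Phi := (Phi beta L X Pm).
Implicit Types eta nu : probability ts R.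

Let L_ge0 w : (0 <= L w)%R. Proof. exact: ltW. Qed.
Let mL : measurable_fun setT (L : Omega -> R). Proof. exact: measurable_funPT. Qed.
Let mX i : measurable_fun setT (X i : Omega -> R). Proof. exact: measurable_funPT. Qed.
Let mP i : measurable_fun setT (Pm i : Omega -> R). Proof. exact: measurable_funPT. Qed.

Local Notation xg := (xi_graft beta L X Pm).

Let mxg d' (T : measurableType d') (u : T -> Omega) (f : nat -> T -> ts) :
  measurable_fun setT u -> (forall i, measurable_fun setT (f i)) ->
  measurable_fun setT (fun t => xg (u t) (f^~ t)).
Proof. exact: measurable_xi_graft. Qed.

Definition canonical_graft (z : Omega * seqspace ts) : ts := xg z.1 z.2.

Lemma measurable_canonical_graft : measurable_fun setT canonical_graft.
Proof.
apply: (@mxg _ (Omega * seqspace ts)%type fst (fun i z => z.2 i)) => [|i].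
  exact: measurable_fst.
exact: measurableT_comp (measurable_coord i) measurable_snd.
Qed.

Lemma law_canonical_graft d' (S : measurableType d') (Q : probability S R)
    (f : nat -> S -> ts) eta nu :
  has_law Q (seq_fun f) (seq_prob eta) ->
  has_law (P \x seq_prob eta) canonical_graft nu ->
  has_law (P \x Q) (fun z => xg z.1 (f^~ z.2)) nu.
Proof. by move=> lf; exact: law_comp (law_prod P lf). Qed.

(** Every i.i.d. source of trees has joint law [seq_prob eta], so the law of the graft does not
    depend on the source and can be computed on the canonical space of sequences. *)
Lemma graft_lawP eta nu : graft_law beta L X Pm eta nu <->
  has_law (P \x seq_prob eta) canonical_graft nu.
Proof.
split=> [[d' [S [Q [tau [/iid_law lt mF nuF]]]]]|[mG lG]].
  apply: law_uncomp (law_prod P lt) measurable_canonical_graft _.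
  by split => // A mA; rewrite nuF.
pose tau i : {RV (seq_prob eta) >-> ts} :=
  mfun_Sub (mem_set (measurable_coord i)).
exists _, (seqspace ts), (seq_prob eta), tau; split => //.
  by apply: law_iid; exact: law_id.
by move=> A mA; rewrite -lG.
Qed.

(** The canonical graft is measurable and so has a law: [Phi] never takes its default value. *)
Lemma Phi_graft_law eta : graft_law beta L X Pm eta (Phi eta).
Proof.
rewrite /Defs.Phi; case: pselect => [h|[]]; first by case: (cid h).
have [nu lnu] := law_exists (P \x seq_prob eta) measurable_canonical_graft.
by exists nu; apply/graft_lawP.
Qed.

Lemma law_Phi d' (S : measurableType d') (Q : probability S R)
    (f : nat -> S -> ts) eta :
  has_law Q (seq_fun f) (seq_prob eta) ->
  has_law (P \x Q) (fun z => xg z.1 (f^~ z.2)) (Phi eta).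
Proof.
move=> lf; apply: law_canonical_graft lf _; apply/graft_lawP; exact: Phi_graft_law.
Qed.

Let bm := branch_moment beta p P Pm.

Lemma branch_moment_ge0 : 0 <= bm.
Proof.
apply: integral_ge0 => w _; apply: nneseries_ge0 => i _ _; by rewrite lee_fin powR_ge0.
Qed.

Let bm_fin : bm < +oo. Proof. exact: lt_trans Pm_moment (ltry 1). Qed.

Definition contraction : R := fine bm.

Lemma contraction_ge0 : (0 <= contraction)%R.
Proof. by rewrite fine_ge0// branch_moment_ge0. Qed.

Lemma contractionE : bm = contraction%:E.
Proof. by rewrite fineK// ge0_fin_numE ?branch_moment_ge0. Qed.

Lemma contraction_lt1 : (contraction < 1)%R.
Proof. by rewrite -lte_fin -contractionE. Qed.

Let h (a : ts) := (height a `^ p)%:E.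
Let mh : measurable_fun setT h.
Proof. by apply: measurable_powR_fun; exact: measurable_height. Qed.
Let h0 a : 0 <= h a. Proof. by rewrite lee_fin powR_ge0. Qed.

Lemma PpP eta : Pp p eta -> exists H : R, \int[eta]_a h a <= H%:E.
Proof.
move=> Pe; exists (fine (\int[eta]_a h a)).
by rewrite fineK// ge0_fin_numE// integral_ge0.
Qed.

Lemma Pp_Phi eta : Pp p eta -> Pp p (Phi eta).
Proof.
move=> /PpP[H eH].
have l := law_Phi (f := fun i (x : seqspace ts) => x i) (law_id (seq_prob eta)).
rewrite /Pp /= -(law_integral l mh h0).
apply: (graft_height_moment beta_gt0 p_ge1 L_ge0 X_itv Pm_ge0 mL mX mP
  (f := fun i (x : seqspace ts) => x i) (H := H)) => //.
  by move=> i; exact: measurable_coord.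
by move=> i; rewrite (law_integral (law_coord eta i) mh h0).
Qed.

(** Graft independent copies of a coupled pair onto the same [xi]: the two grafts form a coupling of
    the images. *)
Lemma transport_le_Phi eta eta' M : Pp p eta -> Pp p eta' ->
  transport_le p eta eta' M -> transport_le p (Phi eta) (Phi eta') (contraction * M).
Proof.
move=> /PpP[H eH] /PpP[H' eH'] [pi [l1 l2] piM].
have L1 := law_Phi (f := fun i (z : seqspace (ts * ts)) => (z i).1) (law_map l1).
have L2 := law_Phi (f := fun i (z : seqspace (ts * ts)) => (z i).2) (law_map l2).
have c1 i := law_comp (law_coord pi i) l1.
have c2 i := law_comp (law_coord pi i) l2.
apply: (transport_le_intro L1 L2).
rewrite EFinM -contractionE.
apply: (graft_contract_moment beta_gt0 p_ge1 L_ge0 X_itv Pm_ge0 mL mX mP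
  (f := fun i (z : seqspace (ts * ts)) => (z i).1) (f' := fun i (z : seqspace (ts * ts)) => (z i).2)
  (H := Num.max H H')) => // i.
- by case: (c1 i).
- by case: (c2 i).
- rewrite (law_integral (c1 i) mh h0); apply: le_trans eH _.
  by rewrite lee_fin le_max lexx.
- rewrite (law_integral (c2 i) mh h0); apply: le_trans eH' _.
  by rewrite lee_fin le_max lexx orbT.
rewrite (law_integral (law_coord pi i) (h := fun z => (td z.1 z.2 `^ p)%:E))//.
  by apply: measurable_td_powR.
by move=> z; rewrite lee_fin powR_ge0.
Qed.

Lemma Pp_iter n eta : Pp p eta -> Pp p (iter n Phi eta).
Proof. by move=> Pe; elim: n => //= n; exact: Pp_Phi. Qed.

Lemma transport_le_iter n eta nu M : Pp p eta -> Pp p nu -> same_law (Phi nu) nu ->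
  transport_le p eta nu M -> transport_le p (iter n Phi eta) nu (contraction ^+ n * M).
Proof.
move=> Pe Pn nuE eM; elim: n => [|n IH]; first by rewrite expr0 mul1r.
rewrite exprS -mulrA /=; apply: transport_le_law (transport_le_Phi _ Pn IH) => //.
exact: Pp_iter.
Qed.

Lemma contraction_expr_cvg (M : R) : (contraction ^+ n * M)%R @[n --> \oo] --> (0 : R)%R.
Proof.
rewrite -[X in _ --> X](mul0r M); apply: cvgM; last exact: cvg_cst.
by apply: cvg_expr; rewrite ger0_norm ?contraction_ge0// contraction_lt1.
Qed.

Lemma Phi_fixpoint_unique eta nu : Pp p eta -> Pp p nu ->
  same_law (Phi eta) eta -> same_law (Phi nu) nu -> same_law eta nu.
Proof.
move=> Pe Pn eE nE; apply: (transport_le0 p_ge1) => e e0.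
have [M eM] := transport_le_fin p_ge1 Pe Pn.
have enM n : transport_le p eta nu (contraction ^+ n * M).
  elim: n => [|n IH]; first by rewrite expr0 mul1r.
  by rewrite exprS -mulrA; apply: transport_le_law (transport_le_Phi _ _ IH).
have /cvgrPdist_lt/(_ e e0)[N _ /(_ N (leqnn N))] := contraction_expr_cvg M.
rewrite /= sub0r normrN => Ne; have [pi l piM] := enM N.
by exists pi => //; apply: le_trans piM _; rewrite lee_fin (le_trans (ler_norm _))// ltW.
Qed.

Lemma Phi_attractive eta nu : Pp p eta -> Pp p nu -> same_law (Phi nu) nu ->
  Wp p (iter n Phi eta) nu @[n --> \oo] --> 0.
Proof.
move=> Pe Pn nE; have [M eM] := transport_le_fin p_ge1 Pe Pn.
have M0 : (0 <= M)%R.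
  case: eM => pi _; rewrite -lee_fin; apply: le_trans.
  by apply: integral_ge0 => z _; rewrite lee_fin powR_ge0.
have p0 : (0 < p)%R by exact: lt_le_trans ltr01 p_ge1.
apply: (@squeeze_cvge _ _ _ _ (fun=> 0) _ (fun n => ((contraction ^+ n * M) `^ p^-1)%:E)).
- near=> n; rewrite Wp_ge0 /=; apply: Wp_le => //.
    by rewrite mulr_ge0// exprn_ge0// contraction_ge0.
  exact: transport_le_iter.
- exact: cvg_cst.
apply: cvg_EFin; first exact: nearW.
apply/cvgrPdist_lt => e e0.
have ep : (0 < e `^ p)%R by rewrite powR_gt0.
have /cvgrPdist_lt/(_ _ ep) := contraction_expr_cvg M.
apply: filterS => n /=; rewrite !sub0r !normrN => ne.
have c0 : (0 <= contraction ^+ n * M)%R by rewrite mulr_ge0// exprn_ge0// contraction_ge0.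
rewrite ger0_norm ?powR_ge0//; rewrite ger0_norm// in ne.
rewrite -[ltRHS](powRr1 (ltW e0)) -(mulfV (lt0r_neq0 p0)) powRrM.
by apply: gt0_ltr_powR; rewrite ?invr_gt0// nnegrE ?powR_ge0.
Unshelve. all: by end_near. Qed.

(** * Pathwise construction of the fixpoint *)

Local Notation mu := (seq_prob P).

Fixpoint approx (n : nat) (z : seqspace Omega) : ts :=
  if n is n.+1 then xg (z 0%N) (fun i => approx n (subtree z i))
  else \pi_(tree_space R)%qT (one_point_tree R).

Lemma measurable_subtree i : measurable_fun setT (fun z : seqspace Omega => subtree z i).
Proof. by apply: measurable_seqspace => m; exact: measurable_coord. Qed.

Lemma measurable_approx n : measurable_fun setT (approx n).
Proof.
elim: n => [|n IH]; first exact: measurable_cst.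
apply: (mxg (f := fun i z => approx n (subtree z i))); first exact: measurable_coord.
by move=> i; exact: measurableT_comp IH (measurable_subtree i).
Qed.

Lemma approx_join n x : approx n.+1 (branch_join x) = xg x.1 (fun i => approx n (x.2 i)).
Proof.
rewrite /= branch_join0; congr (xg _ _); apply/funext => i.
by rewrite subtree_join.
Qed.

Let L_J := law_branch_join P.

(** The bound may depend on [n]: only its finiteness is used, chiefly to make grafts compact almost
    everywhere. *)
Lemma approx_height n : exists H : R, \int[mu]_z h (approx n z) <= H%:E.
Proof.
have fin (v : \bar R) : 0 <= v -> v < +oo -> exists H : R, v <= H%:E.
  by move=> v0 vo; exists (fine v); rewrite fineK// ge0_fin_numE.
elim: n => [|n [H IH]]; apply: fin; try by apply: integral_ge0.
  rewrite -[X in X < _]/(\int[mu]_z cst (h (approx 0 point)) z) integral_cst//.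
  by rewrite [X in _ * X]probability_setT mule1 ltry.
rewrite -(law_integral L_J (h := fun z => h (approx n.+1 z)))//; last first.
  exact: measurableT_comp mh (measurable_approx n.+1).
under eq_integral do rewrite approx_join.
apply: (graft_height_moment beta_gt0 p_ge1 L_ge0 X_itv Pm_ge0 mL mX mP
  (f := fun i (x : seqspace (seqspace Omega)) => approx n (x i)) (H := H)) => // i.
  exact: measurableT_comp (measurable_approx n) (measurable_coord i).
rewrite (law_integral (law_coord mu i) (h := fun z => h (approx n z)))//.
exact: measurableT_comp mh (measurable_approx n).
Qed.

Let dist n z := (td (approx n z) (approx n.+1 z) `^ p)%:E.

Let mdist n : measurable_fun setT (dist n).
Proof. by apply: measurable_td_powR; exact: measurable_approx. Qed.

Let dist0 n z : 0 <= dist n z. Proof. by rewrite lee_fin powR_ge0. Qed.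

(** By [law_branch_join], the next two approximations are grafts, on a common root label, of
    independent copies of the previous two; this gains one factor [contraction]. *)
Lemma approx_dist : exists2 M : R, (0 <= M)%R &
  forall n, \int[mu]_z dist n z <= (contraction ^+ n * M)%:E.
Proof.
have [H0 aH0] := approx_height 0; have [H1 aH1] := approx_height 1.
have [M d0M] : exists M : R, \int[mu]_z dist 0 z <= M%:E.
  exists (H0 + H1)%R; rewrite EFinD; apply: le_trans (leeD aH0 aH1).
  have mha k : measurable_fun setT (fun z => h (approx k z)).
    exact: measurableT_comp mh (measurable_approx k).
  rewrite -ge0_integralD//; apply: le_integral_nonneg => z //.
  by rewrite -EFinD lee_fin td_powR_le.
exists M; first by rewrite -lee_fin; apply: le_trans d0M; exact: integral_ge0.
elim=> [|n IH]; first by rewrite expr0 mul1r.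
rewrite -(law_integral L_J (@mdist n.+1) (dist0 n.+1)) exprS -mulrA EFinM -contractionE.
have [H aH] := approx_height n; have [H' aH'] := approx_height n.+1.
under eq_integral do rewrite /dist !approx_join.
have mhn k : measurable_fun setT (fun z => h (approx k z)).
  exact: measurableT_comp mh (measurable_approx k).
apply: (graft_contract_moment beta_gt0 p_ge1 L_ge0 X_itv Pm_ge0 mL mX mP
  (f := fun i (x : seqspace (seqspace Omega)) => approx n (x i))
  (f' := fun i (x : seqspace (seqspace Omega)) => approx n.+1 (x i))
  (H := Num.max H H')) => // i.
- exact: measurableT_comp (measurable_approx n) (measurable_coord i).
- exact: measurableT_comp (measurable_approx n.+1) (measurable_coord i).
- rewrite (law_integral (law_coord mu i) (mhn n))//.
  by apply: le_trans aH _; rewrite lee_fin le_max lexx.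
- rewrite (law_integral (law_coord mu i) (mhn n.+1))//.
  by apply: le_trans aH' _; rewrite lee_fin le_max lexx orbT.
by rewrite (law_integral (law_coord mu i) (@mdist n)).
Qed.

Let ratio : R := ((1 + contraction) / 2)%R.
Let ratio_gt0 : (0 < ratio)%R.
Proof. have := contraction_ge0; rewrite /ratio; lra. Qed.
Let ratio_lt1 : (ratio < 1)%R.
Proof. have := contraction_lt1; rewrite /ratio; lra. Qed.
Let contraction_ratio : (contraction < ratio)%R.
Proof. have := contraction_lt1; rewrite /ratio; lra. Qed.

(** The pathwise rate: [p]-th powers of order [ratio ^+ n] mean distances of order [q ^+ n]. *)
Let q : R := (ratio `^ p^-1)%R.
Let p_gt0 : (0 < p)%R. Proof. exact: lt_le_trans ltr01 p_ge1. Qed.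
Let q_gt0 : (0 < q)%R. Proof. exact: powR_gt0. Qed.
Let q_lt1 : (q < 1)%R.
Proof.
suff : (ratio `^ p^-1 < 1 `^ p^-1)%R by rewrite powR1.
by apply: gt0_ltr_powR; rewrite ?invr_gt0// nnegrE// ltW.
Qed.
Let qp n : ((q ^+ n) `^ p = ratio ^+ n)%R.
Proof.
have -> : ratio = (q `^ p)%R by rewrite -powRrM mulVf ?lt0r_neq0// powRr1// ltW.
rewrite -(powR_mulrn n (ltW q_gt0)) -(powR_mulrn n (powR_ge0 q p)).
by rewrite -[LHS]powRrM -[RHS]powRrM mulrC.
Qed.

(** Where it is finite, [dist n z] is at most [weighted z] times [ratio ^+ n]; its mean is bounded
    by a geometric series of ratio [contraction / ratio]. *)
Let weighted z : \bar R := \sum_(0 <= n <oo) ((ratio ^- n)%:E * dist n z).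

Let weighted_ge0 z : 0 <= weighted z.
Proof.
apply: nneseries_ge0 => n _ _; apply: mule_ge0 => //.
by rewrite lee_fin invr_ge0 exprn_ge0// ltW.
Qed.

Let measurable_weighted : measurable_fun setT weighted.
Proof.
apply: ge0_emeasurable_sum => [n z _ _|n _].
  by apply: mule_ge0 => //; rewrite lee_fin invr_ge0 exprn_ge0// ltW.
by apply: emeasurable_funM.
Qed.

Let weighted_fin : \int[mu]_z weighted z < +oo.
Proof.
have [M M0 dM] := approx_dist.
have rn0 n : (0 <= ratio ^- n)%R by rewrite invr_ge0 exprn_ge0// ltW.
have rnE n : 0 <= (ratio ^- n)%:E by rewrite lee_fin.
rewrite /weighted integral_nneseries//; first last.
- by move=> n z _; rewrite mule_ge0.
- by move=> n; apply: emeasurable_funM.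
pose t := (contraction / ratio)%R.
have t0 : (0 <= t)%R by rewrite divr_ge0 ?contraction_ge0// ltW.
have t1 : (t < 1)%R by rewrite ltr_pdivrMr// mul1r.
apply: (@le_lt_trans _ _ (M / (1 - t))%:E); last exact: ltry.
apply: lime_le.
  by apply: is_cvg_nneseries => n _ _; apply: integral_ge0 => z _; rewrite mule_ge0.
apply: nearW => N; apply: (@le_trans _ _ (\sum_(0 <= n < N) (M * t ^+ n)%:E)).
  apply: lee_sum => n _; rewrite ge0_integralZl_EFin//.
  have -> : (M * t ^+ n = ratio ^- n * (contraction ^+ n * M))%R.
    by rewrite expr_div_n mulrC -mulrA mulrCA.
  by rewrite EFinM lee_wpmul2l.
rewrite sumEFin lee_fin.
(* The bound on geometric sums asks for a positive ratio, while [t] vanishes when [contraction]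
   does. *)
have [t00|tpos] := eqVneq t 0%R; last first.
  by apply: (@geometric_le_lim _ N M t) => //; [rewrite lt_def tpos|rewrite ger0_norm].
rewrite t00 subr0 divr1; case: N => [|N]; first by rewrite big_geq.
rewrite big_nat_recl//= expr0 mulr1 big1 ?addr0// => i _.
by rewrite exprS mul0r mulr0.
Qed.

(** Comes from [m = (m0 + 1) / (1 - q)] and [powRD_le], the [p]-th power of [m0] being
    [weighted z]. *)
Let K : R := (2 `^ p * (1 - q)^-1 `^ p)%R.

Lemma approx_cvg z : weighted z < +oo -> exists (b : ts) (m : R), [/\ (0 <= m)%R,
  forall n, (td (approx n z) b <= m * q ^+ n)%R &
  (m `^ p)%:E <= K%:E * (weighted z + 1)].
Proof.
move=> wz; have wfin : weighted z \is a fin_num by rewrite ge0_fin_numE.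
pose m0 := (fine (weighted z) `^ p^-1)%R.
have m00 : (0 <= m0)%R by exact: powR_ge0.
have w0 : (0 <= fine (weighted z))%R by rewrite fine_ge0.
have q1 : (0 < 1 - q)%R by rewrite subr_gt0.
(* The 1 added to [m0] gives the strict inequality that [td_complete] requires, [td] being an
   infimum that need not be attained. *)
have dz n : (td (approx n z) (approx n.+1 z) < (m0 + 1) * q ^+ n)%R.
  apply: (@le_lt_trans _ _ (m0 * q ^+ n)%R); last first.
    by rewrite ltr_pM2r ?exprn_gt0// ltrDl.
  rewrite -ler_pdivrMr ?exprn_gt0//; apply: (powR_le_root p_ge1) => //.
    by rewrite divr_ge0 ?td_ge0// exprn_ge0// ltW.
  rewrite powRM ?td_ge0 ?invr_ge0 ?exprn_ge0//; [|exact: ltW..].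
  rewrite -powR_inv1; last by rewrite exprn_ge0// ltW.
  rewrite powRAC qp powR_inv1; last by rewrite exprn_ge0// ltW.
  rewrite -lee_fin fineK// mulrC EFinM.
  apply: (@nneseries_ge_term R (fun n => (ratio ^- n)%:E * dist n z)) => k.
  by apply: mule_ge0 => //; rewrite lee_fin invr_ge0 exprn_ge0// ltW.
pose m := ((m0 + 1) / (1 - q))%R.
have m_ge0 : (0 <= m)%R by apply: divr_ge0; [exact: addr_ge0|exact: ltW].
have [b bz] : exists b, forall n, (td (approx n z) b <= m * q ^+ n)%R.
  apply: (td_complete dz) => [n|n|e e0].
  - rewrite exprS; have : ((m0 + 1) = m * (1 - q))%R by rewrite /m divfK// lt0r_neq0.
    have E (u v w : R) : (v * (1 - w) * u + v * (w * u) = v * u)%R by lra.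
    by move=> ->; rewrite E.
  - by rewrite mulr_ge0// exprn_ge0// ltW.
  have : (m * q ^+ n)%R @[n --> \oo] --> 0%R.
    rewrite -[X in _ --> X](mulr0 m); apply: cvgM; first exact: cvg_cst.
    by apply: cvg_expr; rewrite ger0_norm// ltW.
  move=> /cvgrPdist_lt/(_ e e0)[N _ /(_ N (leqnn N))].
  by rewrite /= sub0r normrN => Ne; exists N; exact: le_lt_trans (ler_norm _) Ne.
exists b, m; split => //.
rewrite -[weighted z]fineK// -EFinD -EFinM lee_fin /m powRM ?addr_ge0 ?invr_ge0//; last exact: ltW.
rewrite /K mulrAC; apply: ler_wpM2r; first exact: powR_ge0.
apply: le_trans (powRD_le p_ge1 m00 ler01) _.
by rewrite powR1 /m0 -powRrM mulVf ?lt0r_neq0// powRr1.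
Qed.

(** The limit is taken where [weighted] is finite and is constant elsewhere, which keeps it a
    pointwise limit of measurable functions. The random constants [m] are integrated through
    [weighted]; where that is infinite, so is the bound under the integral. *)
Lemma approx_limit : exists (g : seqspace Omega -> ts) (M : R),
  measurable_fun setT g /\
  forall n, \int[mu]_z (td (approx n z) (g z) `^ p)%:E <= (ratio ^+ n * M)%:E.
Proof.
have /choice[b bP] : forall z, exists b : ts, weighted z < +oo -> exists m : R,
    [/\ (0 <= m)%R, forall n, (td (approx n z) b <= m * q ^+ n)%R &
     (m `^ p)%:E <= K%:E * (weighted z + 1)].
  move=> z; have [/approx_cvg[b [m bm']]|_] := ltP (weighted z) +oo; last by exists point.
  by exists b => _; exists m.
pose g z := if weighted z < +oo then b z else point.
pose a n z := if weighted z < +oo then approx n z else point.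
have K_ge0 : (0 <= K)%R by rewrite mulr_ge0// powR_ge0.
have mg : measurable_fun setT g.
  apply: (measurable_tree_limit (f := a)) => [n|z e e0].
    apply: measurable_fun_ifT; last exact: measurable_cst.
    - by apply: measurable_fun_lte => //; exact: measurable_cst.
    - exact: measurable_approx.
  rewrite /a /g; case: ifP => [/bP[m [m0 bz _]]|_]; last first.
    by exists 0%N => n _; rewrite tdxx.
  have : (m * q ^+ n)%R @[n --> \oo] --> 0%R.
    rewrite -[X in _ --> X](mulr0 m); apply: cvgM; first exact: cvg_cst.
    by apply: cvg_expr; rewrite ger0_norm// ltW.
  move=> /cvgrPdist_lt/(_ e e0)[N _ HN]; exists N => n /HN.
  by rewrite /= sub0r normrN => Ne; exact: le_lt_trans (bz n) (le_lt_trans (ler_norm _) Ne).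
have Ifin : \int[mu]_z (weighted z + 1) \is a fin_num.
  rewrite ge0_integralD// integral_cst// [X in _ * X]probability_setT mule1.
  rewrite ge0_fin_numE; first by apply: lte_add_pinfty => //; exact: ltry.
  by apply: adde_ge0 => //; exact: integral_ge0.
exists g, (K * fine (\int[mu]_z (weighted z + 1)))%R; split => // n.
rewrite mulrA EFinM fineK// -ge0_integralZl_EFin//; first last.
- by rewrite mulr_ge0// exprn_ge0// ltW.
- by apply: emeasurable_funD.
- by move=> z _; rewrite adde_ge0.
apply: le_integral_nonneg => z; first by rewrite lee_fin powR_ge0.
rewrite /g; case: ifP => [/bP[m [m0 bz mK]]|].
  rewrite EFinM -muleA; apply: (@le_trans _ _ ((ratio ^+ n)%:E * (m `^ p)%:E)).
    rewrite -EFinM lee_fin -qp -powRM//; last by rewrite exprn_ge0// ltW.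
    apply: ge0_ler_powR; rewrite ?nnegrE ?td_ge0 ?mulr_ge0 ?exprn_ge0//; [exact: ltW|exact: ltW|].
    by rewrite mulrC.
  by apply: lee_wpmul2l => //; rewrite lee_fin exprn_ge0// ltW.
move=> /negbT; rewrite -leNgt leye_eq => /eqP ->.
rewrite addye// gt0_muley ?leey// lte_fin mulr_gt0 ?exprn_gt0//.
by rewrite mulr_gt0 ?powR_gt0// invr_gt0 subr_gt0.
Qed.

(** Let [eta] be the law of the limit [g]. The graft of the values of [g] on the subtrees has law
    [Phi eta], and [g] of the whole labelled tree has law [eta]. On their common space both are
    close to [approx n.+1], so couplings of arbitrarily small cost exist and the two laws agree. *)
Lemma Phi_fixpoint_exists : exists2 eta, Pp p eta & same_law (Phi eta) eta.
Proof.
have [g [M [mg gM]]] := approx_limit.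
have [eta lg] := law_exists mu mg.
have mht (f : seqspace Omega -> ts) : measurable_fun setT f ->
    measurable_fun setT (fun z => h (f z)) by move=> mf; exact: measurableT_comp mh mf.
have mdg n : measurable_fun setT (fun z => (td (approx n z) (g z) `^ p)%:E).
  by apply: measurable_td_powR => //; exact: measurable_approx.
have Pe : Pp p eta.
  rewrite /Pp /= -(law_integral lg mh h0); have [H aH] := approx_height 0.
  apply: (@le_lt_trans _ _ ((2 `^ p)%:E * (H%:E + (ratio ^+ 0 * M)%:E))).
    apply: le_trans (lee_wpmul2l _ (leeD aH (gM 0%N))); last first.
      by rewrite lee_fin powR_ge0.
    rewrite -ge0_integralD//; [|exact: mht (measurable_approx 0)|by move=> z _; rewrite lee_fin powR_ge0].
    rewrite -ge0_integralZl_EFin ?powR_ge0//; first last.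
    - by apply: emeasurable_funD => //; exact: mht (measurable_approx 0).
    - by move=> z _; rewrite adde_ge0// lee_fin powR_ge0.
    apply: le_integral_nonneg => z; first by rewrite lee_fin powR_ge0.
    rewrite -EFinD -EFinM lee_fin.
    apply: le_trans (powRD_le p_ge1 (height_ge0 _) (td_ge0 _ _)).
    apply: ge0_ler_powR; rewrite ?nnegrE ?addr_ge0 ?height_ge0 ?td_ge0//; first exact: ltW.
    by rewrite td_sym; exact: height_lip.
  by rewrite -EFinD -EFinM ltry.
exists eta => //; apply: (transport_le0 p_ge1) => e e0.
have lPhi := law_Phi (f := fun i (x : seqspace (seqspace Omega)) => g (x i)) (law_map lg).
have lJ := law_comp L_J lg.
(* The first term compares the graft of limits with [approx n.+1], by contraction; the second
   compares [approx n.+1] with its limit. *)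
pose B : R := (2 `^ p * (contraction * M + ratio * M))%R.
have step n : \int[P \x seq_prob mu]_z
    (td (xg z.1 (fun i => g (z.2 i))) (g (branch_join z)) `^ p)%:E <= (ratio ^+ n * B)%:E.
  have [Hn aHn] := approx_height n; have [H gH] := PpP Pe.
  have mJ : measurable_fun setT (@branch_join d Omega) by case: L_J.
  have iu : \int[P \x seq_prob mu]_z
      (td (xg z.1 (fun i => g (z.2 i))) (approx n.+1 (branch_join z)) `^ p)%:E <=
      (contraction * (ratio ^+ n * M))%:E.
    rewrite EFinM -contractionE; under eq_integral do rewrite approx_join.
    apply: (graft_contract_moment beta_gt0 p_ge1 L_ge0 X_itv Pm_ge0 mL mX mP
      (f := fun i (x : seqspace (seqspace Omega)) => g (x i))
      (f' := fun i (x : seqspace (seqspace Omega)) => approx n (x i))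
      (H := Num.max H Hn)) => // i.
    - exact: measurableT_comp mg (measurable_coord i).
    - exact: measurableT_comp (measurable_approx n) (measurable_coord i).
    - rewrite (law_integral (law_comp (law_coord mu i) lg) mh h0).
      by apply: le_trans gH _; rewrite lee_fin le_max lexx.
    - rewrite (law_integral (law_coord mu i) (mht _ (measurable_approx n)))//.
      by apply: le_trans aHn _; rewrite lee_fin le_max lexx orbT.
    under eq_integral do rewrite td_sym.
    rewrite (law_integral (law_coord mu i) (mdg n))//.
    by move=> z; rewrite lee_fin powR_ge0.
  have iv : \int[P \x seq_prob mu]_z
      (td (approx n.+1 (branch_join z)) (g (branch_join z)) `^ p)%:E <=
      (ratio ^+ n.+1 * M)%:E.
    rewrite (law_integral L_J (mdg n.+1))//.
    by move=> z; rewrite lee_fin powR_ge0.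
  have -> : (ratio ^+ n * B)%:E =
      (2 `^ p)%:E * ((contraction * (ratio ^+ n * M))%:E + (ratio ^+ n.+1 * M)%:E).
    rewrite -EFinD -EFinM exprS /B; congr EFin.
    have E (a b r c m : R) : (a * (b * (c * m + r * m)) = b * (c * (a * m) + r * a * m))%R by lra.
    exact: E.
  apply: le_trans (lee_wpmul2l _ (leeD iu iv)); last by rewrite lee_fin powR_ge0.
  apply: (td_triangle_moment p_ge1 (P \x seq_prob mu)
    (f := fun z => xg z.1 (fun i => g (z.2 i))) (f' := fun z => approx n.+1 (branch_join z))).
  - by case: lPhi.
  - exact: measurableT_comp (measurable_approx n.+1) mJ.
  - exact: measurableT_comp mg mJ.
have : (ratio ^+ n * B)%R @[n --> \oo] --> 0%R.
  rewrite -[X in _ --> X](mul0r B); apply: cvgM; last exact: cvg_cst.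
  by apply: cvg_expr; rewrite ger0_norm// ltW.
move=> /cvgrPdist_lt/(_ e e0)[N _ /(_ N (leqnn N))].
rewrite /= sub0r normrN => Ne; apply: (transport_le_intro lPhi lJ).
apply: le_trans (step N) _; rewrite lee_fin ltW//.
exact: le_lt_trans (ler_norm _) Ne.
Qed.

End operator.

(** The first conjunct guards the definition of [Phi]: its value is the law of the graft, not the
    default, and it stays in [Pp p]. *)
Theorem theorem1p6 (R : realType) (beta p : R) (d : measure_display)
  (Omega : measurableType d) (P : probability Omega R)
  (L : {RV P >-> R}) (X Pm : nat -> {RV P >-> R})
  (beta_gt0 : (0 < beta)%R) (p_ge1 : (1 <= p)%R)
  (L_gt0 : forall w, (0 < L w)%R)
  (X_itv : forall i w, (0 <= X i w <= L w)%R)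
  (Pm_ge0 : forall i w, (0 <= Pm i w)%R)
  (L_moment : \int[P]_w ((L w) `^ p)%:E < +oo)
  (Pm_moment : \int[P]_w (\sum_(0 <= j <oo) ((Pm j w) `^ (p * beta))%:E) < 1) :
  (forall eta, Pp p eta ->
     graft_law beta L X Pm eta (Phi beta L X Pm eta) /\
     Pp p (Phi beta L X Pm eta)) /\
  exists eta_star, [/\ Pp p eta_star,
    same_law (Phi beta L X Pm eta_star) eta_star,
    (forall eta, Pp p eta -> same_law (Phi beta L X Pm eta) eta ->
       same_law eta eta_star) &
    (forall eta, Pp p eta ->
       Wp p (iter n (Phi beta L X Pm) eta) eta_star @[n --> \oo] --> 0)].
Proof.
split=> [eta Pe|]; first by split; [exact: Phi_graft_law|exact: Pp_Phi].
have [eta Pe eE] := Phi_fixpoint_exists beta_gt0 p_ge1 L_gt0 X_itv Pm_ge0 L_moment Pm_moment.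
exists eta; split => // [nu Pn nE|nu Pn].
  exact: (Phi_fixpoint_unique beta_gt0 p_ge1 L_gt0 X_itv Pm_ge0 Pm_moment).
exact: (Phi_attractive beta_gt0 p_ge1 L_gt0 X_itv Pm_ge0 L_moment Pm_moment).
Qed.
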